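(* Assume that hypotheses H1 to H5 (listed in the context) are satisfied. Then $\widehat\theta_n$ converges almost surely to $\theta$ with the rate of convergence $$\|\widehat\theta_n-\theta\|^2=\mathcal{O}\left(\frac{n}{|\mathbb{T}_{n-1}|}\right)\quad\text{a.s.}$$ In addition, the following quadratic strong law holds: $$\lim_{n\to\infty}\frac1n\sum_{k=1}^n|\mathbb{T}_{k-1}|\,(\widehat\theta_k-\theta)^t\Lambda(\widehat\theta_k-\theta)=\mathrm{tr}\left(\Lambda^{-1/2}L\Lambda^{-1/2}\right)\quad\text{a.s.}$$ where $$\Lambda=I_2\otimes C,\qquad C=\mathbb{E}\left[\frac1{1+T^2}\begin{pmatrix} T^2 & T \\ T & 1 \end{pmatrix}\right],$$ $$L=\mathbb{E}\left[\frac1{(1+T^2)^2}\begin{pmatrix} P(T) & Q(T) \\ Q(T) & R(T) \end{pmatrix}\otimes\begin{pmatrix} T^2 & T \\ T & 1 \end{pmatrix}\right].$$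
   Context: **Model.** The first-order random coefficient bifurcating autoregressive (RCBAR) process $(X_n)_{n\ge1}$ is a real-valued process given, for all $n\ge1$, by $X_{2n}=a_nX_n+\varepsilon_{2n}$ and $X_{2n+1}=b_nX_n+\varepsilon_{2n+1}$, where $X_1$ is the initial state with $\mathbb{E}[X_1^2]<\infty$. The sequences $(a_n,b_n)_{n\ge1}$ and $(\varepsilon_{2n},\varepsilon_{2n+1})_{n\ge1}$ are each i.i.d. and are independent of each other. Put $\mathbb{G}_n=\{2^n,2^n+1,\dots,2^{n+1}-1\}$, $\mathbb{T}_n=\bigcup_{k=0}^n\mathbb{G}_k$ (so $|\mathbb{G}_n|=2^n$, $|\mathbb{T}_n|=2^{n+1}-1$), and $\mathcal{F}_n=\sigma\{X_k,\ k\in\mathbb{T}_n\}$. $[x]$ is the integer part of $x$. It is assumed throughout that for constants $a,b,c,d\in\mathbb{R}$, for all $n\ge0$ and $k\in\mathbb{G}_n$, a.s.: $\mathbb{E}[a_k|\mathcal{F}_n]=a$, $\mathbb{E}[b_k|\mathcal{F}_n]=b$, $\mathbb{E}[\varepsilon_{2k}|\mathcal{F}_n]=c$, $\mathbb{E}[\varepsilon_{2k+1}|\mathcal{F}_n]=d$. **Hypotheses.** H1: for all $k\ge1$, $\mathbb{E}[a_k^2]<1$ and $\mathbb{E}[b_k^2]<1$. H2: for all $n\ge0$, $k\in\mathbb{G}_n$, a.s. $\mathrm{Var}[a_k|\mathcal{F}_n]=\sigma_a^2\ge0$, $\mathrm{Var}[b_k|\mathcal{F}_n]=\sigma_b^2\ge0$,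 $\mathrm{Var}[\varepsilon_{2k}|\mathcal{F}_n]=\sigma_c^2>0$, $\mathrm{Var}[\varepsilon_{2k+1}|\mathcal{F}_n]=\sigma_d^2>0$. H3: for all $n\ge0$: for $k,l\in\mathbb{G}_{n+1}$ with $[k/2]\ne[l/2]$, $\varepsilon_k$ and $\varepsilon_l$ are conditionally independent given $\mathcal{F}_n$; for $k\ne l$ in $\mathbb{G}_n$, $(a_k,b_k)$ and $(a_l,b_l)$ are conditionally independent given $\mathcal{F}_n$; and there exist $\rho_{cd},\rho_{ab}$ with $\rho_{cd}^2<\sigma_c^2\sigma_d^2$, $\rho_{ab}^2\le\sigma_a^2\sigma_b^2$ such that for all $k\in\mathbb{G}_n$, a.s. $\mathbb{E}[(\varepsilon_{2k}-c)(\varepsilon_{2k+1}-d)|\mathcal{F}_n]=\rho_{cd}$ and $\mathbb{E}[(a_k-a)(b_k-b)|\mathcal{F}_n]=\rho_{ab}$ (the constants not depending on $n$). H4: there exist $\mu_a^4\ge\sigma_a^4$, $\mu_b^4\ge\sigma_b^4$, $\mu_c^4>\sigma_c^4$, $\mu_d^4>\sigma_d^4$ such that for all $n\ge0$, $k\in\mathbb{G}_n$, a.s. $\mathbb{E}[(a_k-a)^4|\mathcal{F}_n]=\mu_a^4$, $\mathbb{E}[(b_k-b)^4|\mathcal{F}_n]=\mu_b^4$, $\mathbb{E}[(\varepsilon_{2k}-c)^4|\mathcal{F}_n]=\mu_c^4$, $\mathbb{E}[(\varepsilon_{2k+1}-d)^4|\mathcal{F}_n]=\mu_d^4$; moreover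 $\mathbb{E}[\varepsilon_{2k}^4]>\mathbb{E}[\varepsilon_{2k}^2]^2$ and $\mathbb{E}[\varepsilon_{2k+1}^4]>\mathbb{E}[\varepsilon_{2k+1}^2]^2$; and there exist $\nu_{ab}^2\ge\rho_{ab}^2$, $\nu_{cd}^2>\rho_{cd}^2$ such that for all $k\in\mathbb{G}_n$, a.s. $\mathbb{E}[(a_k-a)^2(b_k-b)^2|\mathcal{F}_n]=\nu_{ab}^2$, $\mathbb{E}[(\varepsilon_{2k}-c)^2(\varepsilon_{2k+1}-d)^2|\mathcal{F}_n]=\nu_{cd}^2$. H5: there exists $\alpha>4$ such that a.s. the four quantities $\sup_{n\ge0}\sup_{k\in\mathbb{G}_n}\mathbb{E}[|Z_k|^\alpha|\mathcal{F}_n]$ are finite, for $Z_k=a_k-a$, $b_k-b$, $\varepsilon_{2k}-c$, $\varepsilon_{2k+1}-d$. **Estimator.** Let $c_n=1+X_n^2$, $\Phi_n=(X_n,1)^t$, $\chi_n=(X_{2n},X_{2n+1})^t$, $S_n=\sum_{k\in\mathbb{T}_n}\frac1{c_k}\Phi_k\Phi_k^t$. By convention $S_n$ is taken to be invertible for all $n\ge0$; otherwise $S_n$ is replaced by $S_n+I_2$, where $I_2$ is the identity matrix of order 2. The weighted least squares estimator of $\theta=\begin{pmatrix} a & b \\ c & d \end{pmatrix}$ is, for $n\ge1$, $\widehat\theta_n=S_{n-1}^{-1}\sum_{k\in\mathbb{T}_{n-1}}\frac1{c_k}\Phi_k\chi_k^t$. These $2\times2$ matrices are identified with the vectors $\theta=(a,c,b,d)^t$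 and $\widehat\theta_n=(\widehat a_n,\widehat c_n,\widehat b_n,\widehat d_n)^t$ (columns stacked). $\otimes$ is the Kronecker product and $\|\cdot\|$ the Euclidean norm. **The random variable $T$.** Let $(\kappa_n)_{n\ge1}$ be i.i.d. Bernoulli$(1/2)$, independent of the process. Set $k_1=1$, $k_{n+1}=2k_n+\kappa_n$, and $Y_n=X_{k_n}$. Under H1 and H2, $Y_n$ converges in distribution; $T$ denotes a random variable with the limit distribution (it is non-degenerate with $\mathbb{E}[T^2]<\infty$). **Polynomials.** $P(x)=\sigma_a^2x^2+\sigma_c^2$, $Q(x)=\rho_{ab}x^2+\rho_{cd}$, $R(x)=\sigma_b^2x^2+\sigma_d^2$. *)

(* Defs.v *)
From mathcomp Require Import all_boot all_order all_algebra.
From mathcomp Require Import mxtens.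
From mathcomp Require Import all_classical all_reals all_analysis measurable_realfun.

Set Implicit Arguments.
Unset Strict Implicit.
Unset Printing Implicit Defensive.

Import Order.TTheory GRing.Theory Num.Theory.
Import numFieldNormedType.Exports.

Local Open Scope classical_set_scope.
Local Open Scope ring_scope.

Section independence.
Context {disp : measure_display} {Omega : measurableType disp} {R : realType}.
Variable P : probability Omega R.

Definition sigma_family {disp' : measure_display} {E : measurableType disp'}
    (D : set nat) (X : nat -> Omega -> E) : set (set Omega) :=
  <<s \bigcup_(i in D) preimage_set_system setT (X i) measurable >>.

Definition indep_systems (G1 G2 : set (set Omega)) : Prop :=
  forall A B, G1 A -> G2 B -> P (A `&` B) = (P A * P B)%E.

Definition mutually_independent {disp' : measure_display}
    {E : measurableType disp'} (X : nat -> Omega -> E) : Prop :=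
  forall (J : seq nat) (B : nat -> set E), uniq J ->
    (forall i, measurable (B i)) ->
    P (\bigcap_(i in [set` J]) X i @^-1` B i)
      = (\prod_(i <- J) P (X i @^-1` B i))%E.

Definition identically_distributed {disp' : measure_display}
    {E : measurableType disp'} (X : nat -> Omega -> E) : Prop :=
  forall (i j : nat) (B : set E), measurable B ->
    P (X i @^-1` B) = P (X j @^-1` B).

Definition iid {disp' : measure_display} {E : measurableType disp'}
    (X : nat -> Omega -> E) : Prop :=
  mutually_independent X /\ identically_distributed X.

End independence.

Section conditioning.
Context {disp : measure_display} {Omega : measurableType disp} {R : realType}.
Variables (P : probability Omega R) (G : set (set Omega)).

(* [is_cexp P G X Z]: Z is a version of E[X | G], for integrable X and a
   sub-sigma-algebra G.  Conditional expectations being defined up to null sets,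
   "E[X | G] = m a.s." for a constant m reads [is_cexp P G X (cst m)]. *)
Definition is_cexp (X Z : Omega -> R) : Prop :=
  [/\ P.-integrable setT (EFin \o X),
      P.-integrable setT (EFin \o Z),
      (forall B : set R, measurable B -> G (Z @^-1` B)) &
      forall A, G A ->
        (\int[P]_(w in A) (Z w)%:E = \int[P]_(w in A) (X w)%:E)%E].

(* The same for X >= 0 that is not assumed integrable: E[X | G] is then valued
   in [0, +oo]. *)
Definition is_cexp_ge0 (X Z : Omega -> \bar R) : Prop :=
  [/\ (forall w, 0 <= Z w)%E,
      (forall B : set (\bar R), measurable B -> G (Z @^-1` B)) &
      forall A, G A -> (\int[P]_(w in A) Z w = \int[P]_(w in A) X w)%E].

Definition is_cvar (X V : Omega -> R) : Prop :=
  exists2 M, is_cexp X M & is_cexp (fun w => (X w - M w) ^+ 2) V.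

(* P(U in A, V in B | G) = P(U in A | G) P(V in B | G) a.s. for all A and B;
   as versions agree a.s., one pair of versions f, g suffices. *)
Definition cond_indep {d1 d2 : measure_display} {E1 : measurableType d1}
    {E2 : measurableType d2} (U : Omega -> E1) (V : Omega -> E2) : Prop :=
  forall (A : set E1) (B : set E2), measurable A -> measurable B ->
  exists f g, [/\ is_cexp \1_(U @^-1` A) f, is_cexp \1_(V @^-1` B) g &
    is_cexp \1_(U @^-1` A `&` V @^-1` B) (fun w => f w * g w)].

End conditioning.

Definition cvg_in_distribution {disp disp' : measure_display}
    {Omega : measurableType disp} {Omega' : measurableType disp'} {R : realType}
    (P : probability Omega R) (Q : probability Omega' R)
    (Y : nat -> Omega -> R) (T : Omega' -> R) : Prop :=
  forall f : R -> R, continuous f -> (exists M, forall x, `|f x| <= M) ->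
    ('E_P[f \o Y n] @[n --> \oo] --> 'E_Q[f \o T])%E.

Definition gen (n : nat) : seq nat := index_iota (2 ^ n)%N (2 ^ n.+1)%N.

Definition tree (n : nat) : seq nat := index_iota 1%N (2 ^ n.+1)%N.

Section model.
Context {disp : measure_display} {Omega : measurableType disp} {R : realType}.
Variable P : probability Omega R.
(* Only the values X_n, a_n, b_n with n >= 1 and eps_n with n >= 2 matter. *)
Variables X a_ b_ eps : nat -> {RV P >-> R}.

Let ab (k : nat) (w : Omega) : R * R := (a_ k w, b_ k w).
Let eps2 (k : nat) (w : Omega) : R * R :=
  (eps (2 * k)%N w, eps (2 * k).+1%N w).

Definition filtration (n : nat) : set (set Omega) :=
  sigma_family [set` tree n] X.

Definition is_RCBAR : Prop :=
  [/\ (forall n w, (0 < n)%N ->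
         X (2 * n)%N w = a_ n w * X n w + eps (2 * n)%N w /\
         X (2 * n).+1%N w = b_ n w * X n w + eps (2 * n).+1%N w),
      ('E_P[(fun w => (X 1 w) ^+ 2)%R] < +oo)%E,
      iid P (fun i => ab i.+1),
      iid P (fun i => eps2 i.+1) &
      indep_systems P (sigma_family [set i | (0 < i)%N] ab)
                      (sigma_family [set i | (0 < i)%N] eps2)].

Definition cond_means (a b c d : R) : Prop :=
  forall n k, k \in gen n ->
  [/\ is_cexp P (filtration n) (a_ k) (cst a),
      is_cexp P (filtration n) (b_ k) (cst b),
      is_cexp P (filtration n) (eps (2 * k)%N) (cst c) &
      is_cexp P (filtration n) (eps (2 * k).+1%N) (cst d)].

Definition H1 : Prop := forall k, (0 < k)%N ->
  ('E_P[(fun w => (a_ k w) ^+ 2)%R] < 1)%E /\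
  ('E_P[(fun w => (b_ k w) ^+ 2)%R] < 1)%E.

Definition H2 (sigma_a sigma_b sigma_c sigma_d : R) : Prop :=
  [/\ 0 <= sigma_a ^+ 2, 0 <= sigma_b ^+ 2,
      0 < sigma_c ^+ 2, 0 < sigma_d ^+ 2 &
   forall n k, k \in gen n ->
   [/\ is_cvar P (filtration n) (a_ k) (cst (sigma_a ^+ 2)),
       is_cvar P (filtration n) (b_ k) (cst (sigma_b ^+ 2)),
       is_cvar P (filtration n) (eps (2 * k)%N) (cst (sigma_c ^+ 2)) &
       is_cvar P (filtration n) (eps (2 * k).+1%N) (cst (sigma_d ^+ 2))]].

Definition H3 (a b c d sigma_a sigma_b sigma_c sigma_d rho_ab rho_cd : R)
    : Prop :=
  [/\ (forall n k l, k \in gen n.+1 -> l \in gen n.+1 -> k./2 != l./2 ->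
         cond_indep P (filtration n) (eps k) (eps l)),
      (forall n k l, k \in gen n -> l \in gen n -> k != l ->
         cond_indep P (filtration n) (ab k) (ab l)),
      rho_cd ^+ 2 < sigma_c ^+ 2 * sigma_d ^+ 2,
      rho_ab ^+ 2 <= sigma_a ^+ 2 * sigma_b ^+ 2 &
      forall n k, k \in gen n ->
        is_cexp P (filtration n)
          (fun w => (eps (2 * k)%N w - c) * (eps (2 * k).+1%N w - d))
          (cst rho_cd)
        /\ is_cexp P (filtration n)
          (fun w => (a_ k w - a) * (b_ k w - b)) (cst rho_ab)].

Definition H4 (a b c d sigma_a sigma_b sigma_c sigma_d rho_ab rho_cd : R)
    : Prop :=
  [/\ exists mu_a mu_b mu_c mu_d : R,
        [/\ mu_a ^+ 4 >= sigma_a ^+ 4, mu_b ^+ 4 >= sigma_b ^+ 4,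
            mu_c ^+ 4 > sigma_c ^+ 4, mu_d ^+ 4 > sigma_d ^+ 4 &
         forall n k, k \in gen n ->
         [/\ is_cexp P (filtration n)
               (fun w => (a_ k w - a) ^+ 4) (cst (mu_a ^+ 4)),
             is_cexp P (filtration n)
               (fun w => (b_ k w - b) ^+ 4) (cst (mu_b ^+ 4)),
             is_cexp P (filtration n)
               (fun w => (eps (2 * k)%N w - c) ^+ 4) (cst (mu_c ^+ 4)) &
             is_cexp P (filtration n)
               (fun w => (eps (2 * k).+1%N w - d) ^+ 4) (cst (mu_d ^+ 4))]],
      (forall k, (0 < k)%N ->
         ('E_P[(fun w => (eps (2 * k)%N w) ^+ 2)%R] ^+ 2
            < 'E_P[(fun w => (eps (2 * k)%N w) ^+ 4)%R])%E /\
         ('E_P[(fun w => (eps (2 * k).+1%N w) ^+ 2)%R] ^+ 2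
            < 'E_P[(fun w => (eps (2 * k).+1%N w) ^+ 4)%R])%E) &
      exists nu_ab nu_cd : R,
        [/\ nu_ab ^+ 2 >= rho_ab ^+ 2, nu_cd ^+ 2 > rho_cd ^+ 2 &
         forall n k, k \in gen n ->
           is_cexp P (filtration n)
             (fun w => (a_ k w - a) ^+ 2 * (b_ k w - b) ^+ 2)
             (cst (nu_ab ^+ 2))
           /\ is_cexp P (filtration n)
             (fun w => (eps (2 * k)%N w - c) ^+ 2
                         * (eps (2 * k).+1%N w - d) ^+ 2)
             (cst (nu_cd ^+ 2))]].

(* W n k is a version of E[|Z_k|^alpha | F_n]; there are countably many of them,
   so the choice of versions does not affect the a.s. statement. *)
Definition bounded_cond_moments (alpha : R) (Z : nat -> Omega -> R) : Prop :=
  exists W : nat -> nat -> Omega -> \bar R,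
    (forall n k, k \in gen n ->
       is_cexp_ge0 P (filtration n) (fun w => (`|Z k w| `^ alpha)%:E) (W n k))
    /\ {ae P, forall w, (ereal_sup
         [set x | exists n k, k \in gen n /\ x = W n k w] < +oo)%E}.

Definition H5 (a b c d : R) : Prop :=
  exists alpha : R, 4 < alpha /\
  [/\ bounded_cond_moments alpha (fun k w => a_ k w - a),
      bounded_cond_moments alpha (fun k w => b_ k w - b),
      bounded_cond_moments alpha (fun k w => eps (2 * k)%N w - c) &
      bounded_cond_moments alpha (fun k w => eps (2 * k).+1%N w - d)].

Variable kappa : nat -> {RV P >-> bool}.

Definition is_coin_sequence : Prop :=
  [/\ mutually_independent P (fun i => kappa i.+1 : Omega -> bool),
      (forall i, (0 < i)%N ->
         distribution P (kappa i) =1 bernoulli_prob (2^-1 : R)) &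
      indep_systems P (sigma_family [set i | (0 < i)%N] kappa)
                      (sigma_family [set i | (0 < i)%N] X)].

(* [walk m] is k_{m+1}, and [Y_ m] is Y_{m+1} = X_{k_{m+1}}. *)
Fixpoint walk (m : nat) (w : Omega) : nat :=
  if m is m'.+1 then (2 * walk m' w + kappa m w)%N else 1%N.

Definition Y_ (m : nat) (w : Omega) : R := X (walk m w) w.

End model.

Section estimator.
Context {R : realType}.

Definition mx22 (p q r s : R) : 'M[R]_2 :=
  \matrix_(i, j) nth 0 (nth [::] [:: [:: p; q]; [:: r; s]] i) j.

(* Stacks the columns of a matrix; the ordering is the one of [tensmx]. *)
Definition vec (m n : nat) (M : 'M[R]_(m, n)) : 'cV[R]_(n * m) :=
  \col_k M (mxtens_unindex k).2 (mxtens_unindex k).1.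

Definition enorm (n : nat) (v : 'cV[R]_n) : R :=
  Num.sqrt (\sum_i v i 0 ^+ 2).

Definition theta (a b c d : R) : 'M[R]_2 := mx22 a b c d.

(* Below, x is a trajectory of the process. *)
Variable x : nat -> R.

Definition weight (k : nat) : R := 1 + x k ^+ 2.

Definition Phi (k : nat) : 'cV[R]_2 := \col_i nth 0 [:: x k; 1] i.

Definition chi (k : nat) : 'cV[R]_2 :=
  \col_i nth 0 [:: x (2 * k)%N; x (2 * k).+1%N] i.

Definition S0 (n : nat) : 'M[R]_2 :=
  \sum_(k <- tree n) (weight k)^-1 *: (Phi k *m (Phi k)^T).

(* The convention making S_n invertible is applied separately for each n and
   each trajectory. *)
Definition S_ (n : nat) : 'M[R]_2 :=
  if S0 n \in unitmx then S0 n else S0 n + 1%:M.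

Definition theta_hat (n : nat) : 'M[R]_2 :=
  invmx (S_ n.-1) *m
    \sum_(k <- tree n.-1) (weight k)^-1 *: (Phi k *m (chi k)^T).

End estimator.

Section limit.
Context {R : realType}.

(* The symmetric positive semidefinite square root, when it exists. *)
Definition sqrtmx (n : nat) (A : 'M[R]_n) : 'M[R]_n :=
  xget 0 [set S | [/\ S^T = S,
    (forall v : 'cV[R]_n, 0 <= (v^T *m S *m v) 0 0) & S *m S = A]].

Context {disp : measure_display} {Omega : measurableType disp}.
Variables (Q : probability Omega R) (T : Omega -> R).

Definition expectation_mx (m n : nat) (M : Omega -> 'M[R]_(m, n))
    : 'M[R]_(m, n) :=
  \matrix_(i, j) fine ('E_Q[fun w => M w i j])%E.

Definition C_mx : 'M[R]_2 := expectation_mx (fun w =>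
  (1 + T w ^+ 2)^-1 *: mx22 (T w ^+ 2) (T w) (T w) 1).

Definition Lambda : 'M[R]_(2 * 2) := 1%:M *t C_mx.

Variables (sigma_a sigma_b sigma_c sigma_d rho_ab rho_cd : R).

Definition polyP : {poly R} := (sigma_a ^+ 2) *: 'X^2 + (sigma_c ^+ 2)%:P.
Definition polyQ : {poly R} := rho_ab *: 'X^2 + rho_cd%:P.
Definition polyR : {poly R} := (sigma_b ^+ 2) *: 'X^2 + (sigma_d ^+ 2)%:P.

Definition L_mx : 'M[R]_(2 * 2) := expectation_mx (fun w =>
  ((1 + T w ^+ 2) ^+ 2)^-1 *:
    (mx22 polyP.[T w] polyQ.[T w] polyQ.[T w] polyR.[T w]
       *t mx22 (T w ^+ 2) (T w) (T w) 1)).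

End limit.

(* Main.v *)
(* Write X_k = A_k X_1 + N_k, where A_k is the product of the coefficients on the
   path from the root to k, and N_k is the process started from 0; the initial
   state X_1 may depend on the noise.  As E[A_k^2] <= r^n with r < 1 on generation
   n, averages over a generation of bounded Lipschitz functions of X_k are
   asymptotically those of N_k, which concentrate around their mean because nodes
   with a remote common ancestor are almost independent; the means converge to
   E[phi(T)] because Y_n samples its generation uniformly.

   The estimation error is S_n^-1 M_n, where M_n is a sum of bounded Lipschitz
   functions of X_k times centered noise.  Replacing X_k by N_k in M_n gives a sum
   of orthogonal terms; this costs o(2^(n/2)) a.s., uniformly over bounded sets of
   initial states, by dyadic chaining in the initial state.  With
   w_n = M_n^2 / 2^n, the difference w_(n+1) - w_n / 2 is a cross term plus half
   the average over generation n of the squared summands of M; the cross terms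
   average to 0 and the squared summands obey the law of large numbers, hence the
   averages of w_n converge and w_n = o(n).  The matrices S_n / 2^n stay uniformly
   definite since E[(X_2k - t)^2 / (1 + X_2k^2)] is bounded below uniformly in t,
   the innovation having positive variance. *)

Require Import Defs.
From mathcomp Require Import all_boot all_order all_algebra.
From mathcomp Require Import mxtens.
From mathcomp Require Import all_classical all_reals all_analysis measurable_realfun.
From mathcomp Require Import zify ring lra.

Set Implicit Arguments.
Unset Strict Implicit.
Unset Printing Implicit Defensive.

Import Order.TTheory GRing.Theory Num.Theory.
Import numFieldNormedType.Exports.

Local Open Scope classical_set_scope.
Local Open Scope ring_scope.

(** * Expectation and independence *)

(** About half of the nodes lie in the last generation, so [w_n] has no reason to converge and only
    its averages do: summing [w_(n+1) = w_n / 2 + r_n] over n turns the averages of [r_n] into those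
    of [w_n], up to the factor 2. The weights [1 / (1 + x^2)] make every function of [X_k] that
    occurs bounded and Lipschitz, so second moments of the process suffice; fourth moments concern
    the noise. Conditional moments are used through the plain moments that they imply, and
    orthogonality comes from independence: in the order of the indices, the noise carried by node k
    is independent of the noise of the nodes before k. The chaining succeeds because moving the
    initial state by h changes [M_n] by a variance of order [(2 rho)^n h^2] with [rho < 1], against
    the normalisation [2^n]. The first two claims do not mention T, so no limit of [S_n / 2^n] is at
    hand for them; they rest on a lower bound of its determinant, with expectations in place of
    limits. *)

Ltac nonneg := by repeat first
  [ done | assumption | apply: sqr_ge0 | apply: mulr_ge0 | apply: addr_ge0
  | rewrite invr_ge0 | apply: exprn_ge0 | apply: sumr_ge0 => ? _
  | apply: ltW; assumption ].

Section expectation.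
Context {disp : measure_display} {Omega : measurableType disp} {R : realType}.
Variable P : probability Omega R.
Implicit Types f g : Omega -> R.

Definition itg f := P.-integrable setT (EFin \o f).
Definition Ex f : R := fine (\int[P]_w (f w)%:E)%E.

Lemma ExE f : itg f -> (\int[P]_w (f w)%:E = (Ex f)%:E)%E.
Proof. by move=> If; rewrite fineK//; exact: integrable_fin_num. Qed.

Lemma itg_mf f : itg f -> measurable_fun setT f.
Proof. by move=> /integrableP[/measurable_EFinP]. Qed.

Lemma itg_le f g : measurable_fun setT f -> itg g ->
  (forall w, `|f w| <= g w) -> itg f.
Proof.
move=> mf Ig fg; apply: (le_integrable measurableT _ _ Ig) => //.
  exact/measurable_EFinP.
by move=> w _ /=; rewrite lee_fin (le_trans (fg w))// ler_norm.
Qed.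

Lemma itgD f g : itg f -> itg g -> itg (fun w => f w + g w).
Proof. by move=> If Ig; apply: eq_integrable (integrableD measurableT If Ig). Qed.

Lemma itgB f g : itg f -> itg g -> itg (fun w => f w - g w).
Proof. by move=> If Ig; apply: eq_integrable (integrableB measurableT If Ig). Qed.

Lemma itgZ k f : itg f -> itg (fun w => k * f w).
Proof. by move=> If; apply: eq_integrable (integrableZl measurableT k If). Qed.

Lemma itg_cst k : itg (fun _ => k).
Proof. exact: finite_measure_integrable_cst. Qed.

Lemma itg_sum (I : Type) (s : seq I) (F : I -> Omega -> R) :
  (forall i, itg (F i)) -> itg (fun w => \sum_(i <- s) F i w).
Proof.
move=> IF; elim: s => [|i s IHs].
  by apply: eq_integrable (itg_cst 0) => // w _ /=; rewrite big_nil.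
apply: eq_integrable (itgD (IF i) IHs) => // w _ /=.
by rewrite big_cons.
Qed.

Lemma itg_abs f : itg f -> itg (fun w => `|f w|).
Proof. by move=> If; exact: (integrable_norm If). Qed.

Lemma itg_bounded f K : measurable_fun setT f -> (forall w, `|f w| <= K) -> itg f.
Proof. by move=> mf fK; apply: itg_le (itg_cst K) _. Qed.

Lemma eq_Ex f g : f =1 g -> Ex f = Ex g.
Proof. by move=> /funext ->. Qed.

Lemma ExD f g : itg f -> itg g -> Ex (fun w => f w + g w) = Ex f + Ex g.
Proof. exact: RintegralD. Qed.

Lemma ExB f g : itg f -> itg g -> Ex (fun w => f w - g w) = Ex f - Ex g.
Proof. exact: RintegralB. Qed.

Lemma ExZ k f : itg f -> Ex (fun w => k * f w) = k * Ex f.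
Proof. by move=> If; exact: (@RintegralZl _ _ _ P setT f k). Qed.

Lemma Ex_cst k : Ex (fun _ => k) = k.
Proof.
by rewrite /Ex integral_cst//= probability_setT mule1.
Qed.

Lemma Ex_sum (I : Type) (s : seq I) (F : I -> Omega -> R) :
  (forall i, itg (F i)) ->
  Ex (fun w => \sum_(i <- s) F i w) = \sum_(i <- s) Ex (F i).
Proof.
move=> IF; elim: s => [|i s IHs].
  rewrite big_nil -[RHS](Ex_cst 0); apply: eq_Ex => w.
  by rewrite big_nil.
rewrite big_cons -IHs -ExD//; last exact: itg_sum.
by apply: eq_Ex => w; rewrite big_cons.
Qed.

Lemma Ex_ge0 f : (forall w, 0 <= f w) -> 0 <= Ex f.
Proof. by move=> f0; apply: Rintegral_ge0. Qed.

Lemma Ex_le f g : itg f -> itg g -> (forall w, f w <= g w) -> Ex f <= Ex g.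
Proof. by move=> If Ig fg; apply: le_Rintegral. Qed.

Lemma Ex_norm f : itg f -> `|Ex f| <= Ex (fun w => `|f w|).
Proof. by move=> If; apply: (@le_normr_Rintegral _ _ _ P setT f). Qed.

Lemma Ex_le_norm_bound f K : measurable_fun setT f -> (forall w, `|f w| <= K) ->
  `|Ex f| <= K.
Proof.
move=> mf fK; apply: (le_trans (Ex_norm (itg_bounded mf fK))).
rewrite -[leRHS](Ex_cst K); apply: Ex_le => //; last exact: itg_cst.
exact/itg_abs/(itg_bounded mf fK).
Qed.

End expectation.

Section square_integrable.
Context {disp : measure_display} {Omega : measurableType disp} {R : realType}.
Variable P : probability Omega R.
Implicit Types f g : Omega -> R.
Local Notation itg := (itg P).
Local Notation Ex := (Ex P).

Definition sq f := measurable_fun setT f /\ itg (fun w => f w ^+ 2).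

Lemma sq_itgM f g : sq f -> sq g -> itg (fun w => f w * g w).
Proof.
move=> [mf If] [mg Ig]; apply: itg_le (itgD If Ig) _; first exact: measurable_funM.
move=> w; rewrite ler_norml; apply/andP; split; nra.
Qed.

Lemma sq_cst k : sq (fun _ => k).
Proof. by split; [exact: measurable_cst|exact: itg_cst]. Qed.

Lemma sq_itg f : sq f -> itg f.
Proof.
move=> /sq_itgM /(_ (sq_cst 1)) h; apply: eq_integrable h => // w _ /=.
by rewrite mulr1.
Qed.

Lemma sqD f g : sq f -> sq g -> sq (fun w => f w + g w).
Proof.
move=> hf hg; split; first by apply: measurable_funD; [case: hf|case: hg].
apply: eq_integrable (itgD (itgD hf.2 (itgZ 2 (sq_itgM hf hg))) hg.2) => // w _ /=.
by congr EFin; ring.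
Qed.

Lemma sqZ k f : sq f -> sq (fun w => k * f w).
Proof.
move=> [mf If]; split.
  by apply: measurable_funM => //; exact: measurable_cst.
apply: eq_integrable (itgZ (k ^+ 2) If) => // w _ /=.
by congr EFin; ring.
Qed.

Lemma sqB f g : sq f -> sq g -> sq (fun w => f w - g w).
Proof.
move=> hf hg; have := sqD hf (sqZ (-1) hg).
by under eq_fun do rewrite mulN1r.
Qed.

Lemma sq_sum (I : Type) (s : seq I) (F : I -> Omega -> R) :
  (forall i, sq (F i)) -> sq (fun w => \sum_(i <- s) F i w).
Proof.
move=> hF; elim: s => [|i s IHs].
  by under eq_fun do rewrite big_nil; exact: sq_cst.
by under eq_fun do rewrite big_cons; exact: sqD.
Qed.

Lemma sq_bounded f K : measurable_fun setT f -> (forall w, `|f w| <= K) -> sq f.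
Proof.
move=> mf fK; split => //; apply: (@itg_bounded _ _ _ _ _ (K ^+ 2)).
  exact: measurable_funX.
move=> w; rewrite normrX lerXn2r ?nnegrE//.
by rewrite (le_trans _ (fK w)).
Qed.

Lemma Ex_sqD f g : sq f -> sq g -> Ex (fun w => (f w + g w) ^+ 2) =
  Ex (fun w => f w ^+ 2) + 2 * Ex (fun w => f w * g w) + Ex (fun w => g w ^+ 2).
Proof.
move=> hf hg; have If := hf.2; have Ig := hg.2; have Ifg := sq_itgM hf hg.
rewrite -ExZ// -ExD//; last exact: itgZ.
rewrite -ExD//; last by apply: itgD => //; exact: itgZ.
by apply: eq_Ex => w; ring.
Qed.

Lemma Ex_sqD_le f g : sq f -> sq g -> Ex (fun w => (f w + g w) ^+ 2) <=
  2 * Ex (fun w => f w ^+ 2) + 2 * Ex (fun w => g w ^+ 2).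
Proof.
move=> hf hg; have If := hf.2; have Ig := hg.2.
rewrite -!ExZ// -ExD; [|exact: itgZ|exact: itgZ].
apply: Ex_le; [exact: (sqD hf hg).2|by apply: itgD; exact: itgZ|].
move=> w /=; have := sqr_ge0 (f w - g w); nra.
Qed.

Lemma Ex_cauchy_schwarz f g : sq f -> sq g ->
  Ex (fun w => f w * g w) ^+ 2 <= Ex (fun w => f w ^+ 2) * Ex (fun w => g w ^+ 2).
Proof.
move=> hf hg; have Ifg := sq_itgM hf hg.
set a := Ex (fun w => f w ^+ 2); set b := Ex (fun w => g w ^+ 2).
set c := Ex _.
have a0 : 0 <= a by apply: Ex_ge0 => w; exact: sqr_ge0.
have b0 : 0 <= b by apply: Ex_ge0 => w; exact: sqr_ge0.
have H t : 0 <= a + 2 * (t * c) + t ^+ 2 * b.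
  have <- : Ex (fun w => (f w + t * g w) ^+ 2) = a + 2 * (t * c) + t ^+ 2 * b.
    rewrite (Ex_sqD hf (sqZ t hg)); congr (_ + 2 * _ + _).
      by rewrite -ExZ//; apply: eq_Ex => w; ring.
    by rewrite -ExZ; [apply: eq_Ex => w; ring|case: hg].
  by apply: Ex_ge0 => w; exact: sqr_ge0.
have [b_eq0|bN0] := eqVneq b 0.
  have [->|cN0] := eqVneq c 0; first by rewrite expr0n mulr_ge0.
  have := H (- (a + 1) / (2 * c)); rewrite b_eq0 mulr0 addr0.
  have -> : a + 2 * (- (a + 1) / (2 * c) * c) = -1 by field.
  by lra.
have bgt0 : 0 < b by rewrite lt_neqAle eq_sym bN0.
have := H (- c / b).
have -> : a + 2 * (- c / b * c) + (- c / b) ^+ 2 * b = (a * b - c ^+ 2) / b by field.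
by rewrite pmulr_lge0 ?invr_gt0// subr_ge0.
Qed.

Lemma sqr_Ex_le f : sq f -> Ex f ^+ 2 <= Ex (fun w => f w ^+ 2).
Proof.
move=> hf; have := Ex_cauchy_schwarz hf (@sq_cst 1).
have -> : (fun w => f w * 1) = f by apply/funext => w; rewrite mulr1.
by rewrite expr1n Ex_cst mulr1.
Qed.

End square_integrable.

Section independence.
Context {disp : measure_display} {Omega : measurableType disp} {R : realType}.
Variable P : probability Omega R.

(** Finite measures that agree on a pi-system agree on the sigma-algebra it generates. This is
    applied to one side at a time: for fixed [B], the probability of the intersection with [B] and
    the multiple of [P] by [P B] are two such measures. *)
Lemma indep_systems_generated (G1 G2 : set (set Omega)) :
  G1 `<=` measurable -> G2 `<=` measurable ->
  setI_closed G1 -> setI_closed G2 -> G1 setT -> G2 setT ->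
  indep_systems P G1 G2 -> indep_systems P <<s G1 >> <<s G2 >>.
Proof.
move=> mG1 mG2 I1 I2 T1 T2 h12.
have half (G : set (set Omega)) (B : set Omega) : G `<=` measurable -> setI_closed G ->
    G setT -> measurable B ->
    (forall A, G A -> P (A `&` B) = (P A * P B)%E) ->
    forall A, <<s G >> A -> P (A `&` B) = (P A * P B)%E.
  move=> mG IG TG mB h A sA.
  have [r PB0 PBE] : exists2 r : R, 0 <= r & P B = r%:E.
    by exists (fine (P B)); rewrite ?fine_ge0// fineK// fin_num_measure.
  transitivity (mscale (NngNum PB0) P A); last first.
    by rewrite muleC PBE.
  transitivity (mrestr P mB A); first by [].
  apply: (g_sigma_algebra_measure_unique G mG (fun=> setT)) => //.
  - by rewrite bigcup_const//; exists 0%N.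
  - move=> C GC; by rewrite [LHS](h C GC) muleC PBE.
  - move=> _; rewrite /mrestr; apply: (le_lt_trans (probability_le1 _ _)).
      exact: measurableI.
    by rewrite ltry.
have sm G : G `<=` measurable -> <<s G >> `<=` (@measurable _ Omega).
  exact: (smallest_sub (@sigma_algebra_measurable _ Omega)).
move=> A B sA sB.
apply: (half G1) => //; first exact: (sm _ mG2).
move=> C GC; rewrite setIC muleC.
apply: (half G2) => //; first exact: mG1.
by move=> D GD; rewrite setIC muleC; exact: h12.
Qed.

Definition indep2 (U V : Omega -> R) := forall A B : set R,
  measurable A -> measurable B ->
  P (U @^-1` A `&` V @^-1` B) = (P (U @^-1` A) * P (V @^-1` B))%E.

(** Independence identifies the law of the pair with the product of the two laws; integrability and
    the value then follow from the Tonelli and Fubini theorems for the function [x * y]. *)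
Lemma indep2_ExM (U V : Omega -> R) : indep2 U V -> itg P U -> itg P V ->
  itg P (fun w => U w * V w) /\
  Ex P (fun w => U w * V w) = Ex P U * Ex P V.
Proof.
move=> hUV IU IV.
have mU := itg_mf IU; have mV := itg_mf IV.
have mUV : measurable_fun setT (fun w => (U w, V w)) by exact: measurable_fun_pair.
pose U' : {RV P >-> R} := mfun_Sub (mem_set mU).
pose V' : {RV P >-> R} := mfun_Sub (mem_set mV).
pose UV' : {RV P >-> (R * R)%type} := mfun_Sub (mem_set mUV).
pose pU := distribution P U'; pose pV := distribution P V'.
pose pUV := distribution P UV'.
have prodE X : measurable X -> (pU \x pV)%E X = pUV X.
  apply: product_measure_unique => A B mA mB.
  by rewrite -[RHS]hUV.
pose f (xy : R * R) : \bar R := (xy.1 * xy.2)%:E.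
have mf : measurable_fun setT f.
  by apply/measurable_EFinP; apply: measurable_funM; [exact: measurable_fst|exact: measurable_snd].
have IpU : pU.-integrable setT (EFin : R -> \bar R).
  by apply: integrable_pushforward => //; exact: measurable_EFin.
have IpV : pV.-integrable setT (EFin : R -> \bar R).
  by apply: integrable_pushforward => //; exact: measurable_EFin.
have iV : (\int[pV]_y y%:E = (Ex P V)%:E)%E.
  by rewrite integral_pushforward//= -ExE.
have iU : (\int[pU]_y y%:E = (Ex P U)%:E)%E.
  by rewrite integral_pushforward//= -ExE.
have If : (pU \x pV)%E.-integrable setT f.
  apply/integrable12ltyP => //.
  have -> : (\int[pU]_x \int[pV]_y `|f (x, y)| = \int[pU]_x (`|x%:E| * \int[pV]_y `|y%:E|))%E.
    apply: eq_integral => x _; rewrite -ge0_integralZl//.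
      by apply: eq_integral => y _; rewrite /f/= normrM EFinM.
    by apply: measurableT_comp => //; exact: measurable_EFin.
  rewrite ge0_integralZr//; first last.
  - exact: integral_ge0.
  - by apply: measurableT_comp => //; exact: measurable_EFin.
  rewrite lte_mul_pinfty//; first exact: integral_ge0.
  - rewrite ge0_fin_numE; last exact: integral_ge0.
    by case/integrableP : IpU.
  - by case/integrableP : IpV.
have IUV : pUV.-integrable setT f.
  case/integrableP : If => _ If'; apply/integrableP; split => //.
  move: If'; rewrite (eq_measure_integral pUV)//.
  by move=> A mA _; exact: prodE.
have IfUV : itg P (fun w => U w * V w).
  case/integrableP : IUV => _ If'; apply/integrableP; split.
    by apply/measurable_EFinP; exact: measurable_funM.
  move: If'; rewrite ge0_integral_pushforward//.
  exact: measurableT_comp.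
split => //; apply: EFin_inj; rewrite -ExE//.
have -> : (\int[P]_w (U w * V w)%:E = \int[pUV]_z f z)%E.
  by rewrite integral_pushforward.
rewrite -(eq_measure_integral pUV (m1 := (pU \x pV)%E)); last first.
  by move=> A mA _; exact: prodE.
rewrite -integral12_prod_meas1// /fubini_F EFinM -iU -iV.
transitivity (\int[pU]_x (x%:E * (Ex P V)%:E))%E.
  apply: eq_integral => x _; rewrite -iV -integralZl//.
rewrite iV.
by rewrite -integralZr.
Qed.

End independence.

Section family.
Context {disp : measure_display} {Omega : measurableType disp} {R : realType}.
Variable P : probability Omega R.
Context {disp' : measure_display} {E : measurableType disp'}.
Variable zeta : nat -> Omega -> E.
Hypothesis mzeta : forall i, measurable_fun setT (zeta i).

Definition events (J : set nat) : set (set Omega) :=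
  \bigcup_(i in J) preimage_set_system setT (zeta i) measurable.

(** The real functions of the variables [zeta i] with [i] in [J]. Stated as measurability for the
    generated sigma-algebra, it inherits the closure properties of [measurable_fun]. *)
Definition mJ (J : set nat) (f : Omega -> R) :=
  measurable_fun setT (f : g_sigma_algebraType (events J) -> R).

Lemma events_measurable J : events J `<=` measurable.
Proof. by move=> _ [i _ [B mB <-]]; exact: mzeta. Qed.

Lemma sigma_events_measurable J : <<s events J >> `<=` measurable.
Proof.
by apply: smallest_sub; [exact: sigma_algebra_measurable|exact: events_measurable].
Qed.

Lemma events_mono J J' : J `<=` J' -> events J `<=` events J'.
Proof. by move=> JJ' A [i Ji ?]; exists i => //; exact: JJ'. Qed.

Lemma mJ_mono J J' f : J `<=` J' -> mJ J f -> mJ J' f.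
Proof.
move=> JJ' mf _ B mB; have := mf measurableT B mB.
exact: (sub_smallest2r (@smallest_sigma_algebra _ _ _) (events_mono JJ')).
Qed.

Lemma mJ_mf J f : mJ J f -> measurable_fun setT f.
Proof. by move=> mf _ B mB; apply: (@sigma_events_measurable J); exact: mf. Qed.

Lemma mJ_coord J i (h : E -> R) : J i -> measurable_fun setT h ->
  mJ J (fun w => h (zeta i w)).
Proof.
move=> Ji mh _ B mB; apply: sub_sigma_algebra; exists i => //.
exists (h @^-1` B) => //.
by rewrite -[X in measurable X]setTI; exact: mh.
Qed.

Lemma mJ_cst J k : mJ J (fun _ => k).
Proof. exact: measurable_cst. Qed.

Lemma mJD J f g : mJ J f -> mJ J g -> mJ J (fun w => f w + g w).
Proof. exact: measurable_funD. Qed.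

Lemma mJM J f g : mJ J f -> mJ J g -> mJ J (fun w => f w * g w).
Proof. exact: measurable_funM. Qed.

Lemma mJB J f g : mJ J f -> mJ J g -> mJ J (fun w => f w - g w).
Proof. exact: measurable_funB. Qed.

Lemma mJX J n f : mJ J f -> mJ J (fun w => f w ^+ n).
Proof. by move=> mf; elim: n => [|n IH]; [exact: mJ_cst|under eq_fun do rewrite exprS; exact: mJM]. Qed.

Lemma mJ_comp J (h : R -> R) f : measurable_fun setT h -> mJ J f ->
  mJ J (fun w => h (f w)).
Proof. by move=> mh mf; exact: measurableT_comp. Qed.

(** Independence is asked on [D] only: in the application the indices 0 and 1, which belong to no
    node of the tree, are excluded. *)
Variable D : set nat.
Hypothesis hind : forall (J : seq nat) (B : nat -> set E), uniq J ->
  (forall i, i \in J -> D i) -> (forall i, measurable (B i)) ->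
  P (\bigcap_(i in [set` J]) zeta i @^-1` B i) =
  (\prod_(i <- J) P (zeta i @^-1` B i))%E.

(** A pi-system whose sigma-algebra contains [events J]; the latter is not stable under intersection
    in general. *)
Definition cylinders (J : set nat) : set (set Omega) :=
  [set A | exists s, exists2 B : nat -> set E,
    [/\ uniq s, (forall i, i \in s -> J i) & forall i, measurable (B i)] &
    A = \bigcap_(i in [set` s]) zeta i @^-1` B i].

Lemma cylinders_measurable J : cylinders J `<=` measurable.
Proof.
move=> _ [s [B [us sJ mB] ->]].
rewrite bigcap_seq; apply: bigsetI_measurable => i _.
by rewrite -[X in measurable X]setTI; exact: mzeta.
Qed.

Lemma cylinders_setT J : cylinders J setT.
Proof.
exists [::], (fun=> setT); first by split.
by apply/seteqP; split => // w _ i.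
Qed.

Lemma cylinders_setI J : setI_closed (cylinders J).
Proof.
move=> _ _ [s [B [us sJ mB] ->]] [t [C [ut tJ mC] ->]].
exists (undup (s ++ t)).
exists (fun i => (if i \in s then B i else setT) `&` (if i \in t then C i else setT)).
  split; first exact: undup_uniq.
    by move=> i; rewrite mem_undup mem_cat => /orP[/sJ|/tJ].
  by move=> i; apply: measurableI; case: ifP.
apply/seteqP; split => [w [wB wC] i _|w wBC]; first split.
- by case: ifP => // /wB.
- by case: ifP => // /wC.
split=> i /= ii.
- have := wBC i; rewrite /= mem_undup mem_cat ii => /(_ isT) [+ _].
  by [].
- have := wBC i; rewrite /= mem_undup mem_cat ii orbT => /(_ isT) [_ +].
  by [].
Qed.

Lemma events_sub_cylinders J : <<s events J >> `<=` <<s cylinders J >>.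
Proof.
apply: sub_smallest2r; first exact: smallest_sigma_algebra.
move=> _ [i Ji [B mB <-]]; exists [:: i], (fun=> B).
  by split => // j; rewrite inE => /eqP ->.
rewrite setTI; apply/seteqP; split => [w wB j /=|w /(_ i)]; last first.
  by rewrite /= inE eqxx; exact.
by rewrite inE => /eqP ->.
Qed.

Lemma events_indep J1 J2 : J1 `<=` D -> J2 `<=` D -> J1 `&` J2 = set0 ->
  indep_systems P <<s events J1 >> <<s events J2 >>.
Proof.
move=> J1D J2D J12 A B /events_sub_cylinders sA /events_sub_cylinders sB.
apply: (indep_systems_generated (@cylinders_measurable J1) (@cylinders_measurable J2)) sA sB.
- exact: cylinders_setI.
- exact: cylinders_setI.
- exact: cylinders_setT.
- exact: cylinders_setT.
move=> _ _ [s [F [us sJ mF] ->]] [t [G [ut tJ mG] ->]].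
have st i : i \in s -> i \in t -> False.
  by move=> /sJ i1 /tJ i2; have : (J1 `&` J2) i by []; rewrite J12.
pose H i := if i \in s then F i else G i.
have Ht i : i \in t -> H i = G i.
  by move=> it; rewrite /H; case: ifP => // /st /(_ it).
have mH i : measurable (H i) by rewrite /H; case: ifP.
have ust : uniq (s ++ t).
  by rewrite cat_uniq us ut andbT /=; apply/hasPn => i it; apply/negP => /st /(_ it).
transitivity (P (\bigcap_(i in [set` s ++ t]) zeta i @^-1` H i)).
  congr (P _); apply/seteqP; split => [w [wF wG] i /=|w wH].
    by rewrite mem_cat /H; case: ifPn => [/wF //|_ /= /wG].
  split => i /= ii.
    by have := wH i; rewrite /= mem_cat ii /H ii => /(_ isT).
  by have := wH i; rewrite /= mem_cat ii orbT Ht// => /(_ isT).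
rewrite hind//; last by move=> i; rewrite mem_cat => /orP[/sJ/J1D|/tJ/J2D].
rewrite big_cat/= hind//; last by move=> i /sJ /J1D.
rewrite hind//; last by move=> i /tJ /J2D.
congr (_ * _)%E; apply: eq_big_seq => i ii; last by rewrite Ht.
by rewrite /H ii.
Qed.

Lemma mJ_ExM J1 J2 U V : J1 `<=` D -> J2 `<=` D -> J1 `&` J2 = set0 ->
  mJ J1 U -> mJ J2 V -> itg P U -> itg P V ->
  itg P (fun w => U w * V w) /\
  Ex P (fun w => U w * V w) = Ex P U * Ex P V.
Proof.
move=> J1D J2D J12 mU mV IU IV; apply: indep2_ExM => // A B mA mB.
apply: (events_indep J1D J2D J12).
  by rewrite -[X in <<s _ >> X]setTI; exact: mU.
by rewrite -[X in <<s _ >> X]setTI; exact: mV.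
Qed.

Definition sqJ J (f : Omega -> R) := mJ J f /\ itg P (fun w => f w ^+ 2).

Lemma sqJ_sq J f : sqJ J f -> sq P f.
Proof. by move=> [/mJ_mf]. Qed.

Lemma sqJ_mono J J' f : J `<=` J' -> sqJ J f -> sqJ J' f.
Proof. by move=> JJ' [mf ?]; split => //; exact: mJ_mono mf. Qed.

Lemma sqJM J1 J2 J U V : J1 `<=` D -> J2 `<=` D -> J1 `&` J2 = set0 ->
  J1 `<=` J -> J2 `<=` J -> sqJ J1 U -> sqJ J2 V -> sqJ J (fun w => U w * V w) /\
  Ex P (fun w => (U w * V w) ^+ 2) =
  Ex P (fun w => U w ^+ 2) * Ex P (fun w => V w ^+ 2).
Proof.
move=> J1D J2D J12 J1J J2J [mU IU] [mV IV].
have [I1 E1] := mJ_ExM J1D J2D J12 (mJX 2 mU) (mJX 2 mV) IU IV.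
split; last by rewrite -E1; apply: eq_Ex => w; rewrite exprMn.
split; first by apply: mJM; [exact: mJ_mono mU|exact: mJ_mono mV].
by apply: eq_integrable I1 => // w _ /=; rewrite exprMn.
Qed.

End family.

(** * Averages of sequences *)

Section sequences.
Context {R : realType}.
Implicit Types u v w r : nat -> R.

Lemma cvgr0_le u v : (\forall n \near \oo, `|u n| <= v n) ->
  v n @[n --> \oo] --> 0 -> u n @[n --> \oo] --> 0.
Proof.
move=> uv v0; apply/cvgr0Pnorm_lt => e e0.
have /cvgr0Pnorm_lt/(_ e e0) := v0.
apply: filterS2 uv => n uvn ve; apply: (le_lt_trans uvn).
by apply: le_lt_trans ve; rewrite ler_norm.
Qed.

Lemma cvg_expr0 (x : R) : 0 <= x -> x < 1 -> x ^+ n @[n --> \oo] --> 0.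
Proof. by move=> x0 x1; apply: cvg_expr; rewrite ger0_norm. Qed.

Lemma cvg_invn : (n.+1%:R^-1 : R) @[n --> \oo] --> 0.
Proof. exact: cvg_harmonic. Qed.

Lemma half_rec0 v r : (forall n, 0 <= v n) -> (forall n, v n.+1 <= v n / 2 + r n) ->
  r n @[n --> \oo] --> 0 -> v n @[n --> \oo] --> 0.
Proof.
move=> v0 vr r0; apply/cvgr0Pnorm_lt => e e0.
(* Errors below [e / 4] accumulate to at most [e / 2], the powers of 1/2 having sum 2; the other
   half of [e] absorbs the decaying initial value. *)
have e4 : 0 < e / 4 by lra.
have /cvgr0Pnorm_lt/(_ _ e4) [N _ rN] := r0.
have bnd k : v (k + N)%N <= v N * 2^-1 ^+ k + e / 2.
  elim: k => [|k IHk]; first by rewrite add0n expr0; have := v0 N; lra.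
  have /rN : (N <= k + N)%N by rewrite leq_addl.
  rewrite ltr_norml => /andP[_ h].
  have := vr (k + N)%N; rewrite -addSn exprS.
  by nra.
have h0 : v N * 2^-1 ^+ k @[k --> \oo] --> 0.
  rewrite -[X in _ --> X](mulr0 (v N)); apply: cvgMr.
  by apply: cvg_expr0; lra.
have e2 : 0 < e / 2 by lra.
have /cvgr0Pnorm_lt/(_ _ e2) [M _ hM] := h0.
exists (M + N)%N => // n /= Mn.
have Mk : (M <= n - N)%N by lia.
have := hM _ Mk; have := bnd (n - N)%N; rewrite subnK; last by lia.
rewrite ltr_norml => h1 /andP[_ h2]; rewrite ger0_norm//.
by lra.
Qed.

Lemma cvgr0_norm u : u n @[n --> \oo] --> 0 -> `|u n| @[n --> \oo] --> 0.
Proof. by move=> u0; rewrite -[X in _ --> X](@normr0 _ R); exact: cvg_norm. Qed.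

Lemma half_rec_div w r : (forall n, w n.+1 = w n / 2 + r n) ->
  r n / n.+1%:R @[n --> \oo] --> 0 -> w n / n.+1%:R @[n --> \oo] --> 0.
Proof.
move=> wr r0.
have nE n x : `|x / n.+1%:R| = `|x| / n.+1%:R :> R.
  by rewrite normrM normfV normr_nat.
have : `|w n| / n.+1%:R @[n --> \oo] --> 0.
  apply: (@half_rec0 _ (fun n => `|r n| / n.+1%:R)).
  - by move=> n; rewrite divr_ge0.
  - move=> n; have n1 : (0 : R) < n.+1%:R by rewrite ltr0n.
    apply: (@le_trans _ _ (`|w n.+1| / n.+1%:R)).
      by rewrite ler_wpM2l// lef_pV2 ?posrE ?ltr0n// ler_nat.
    rewrite mulrAC -mulrDl ler_wpM2r ?invr_ge0// wr.
    by rewrite (le_trans (ler_normD _ _))// normrM (ger0_norm (x := 2^-1))//; lra.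
  - by have := cvgr0_norm r0; under eq_fun do rewrite nE.
by apply: cvgr0_le; apply: nearW => n; rewrite nE.
Qed.

Lemma cvg_near_eq u v (l : R) : (\forall n \near \oo, u n = v n) ->
  u n @[n --> \oo] --> l -> v n @[n --> \oo] --> l.
Proof.
move=> uv; apply: cvg_trans; apply: near_eq_cvg.
by apply: filterS uv => n.
Qed.

Lemma cvg_eq u v (l : R) : (forall n, u n = v n) ->
  u n @[n --> \oo] --> l -> v n @[n --> \oo] --> l.
Proof. by move=> /funext ->. Qed.

Lemma seq_cvgD u v (l m : R) : u n @[n --> \oo] --> l -> v n @[n --> \oo] --> m ->
  u n + v n @[n --> \oo] --> l + m.
Proof. by move=> ul vm; exact: cvgD. Qed.

Lemma seq_cvgB u v (l m : R) : u n @[n --> \oo] --> l -> v n @[n --> \oo] --> m ->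
  u n - v n @[n --> \oo] --> l - m.
Proof. by move=> ul vm; exact: cvgB. Qed.

Lemma seq_cvgM u v (l m : R) : u n @[n --> \oo] --> l -> v n @[n --> \oo] --> m ->
  u n * v n @[n --> \oo] --> l * m.
Proof. by move=> ul vm; exact: cvgM. Qed.

Lemma seq_cvgZ k u (l : R) : u n @[n --> \oo] --> l ->
  k * u n @[n --> \oo] --> k * l.
Proof. by move=> ul; exact: cvgMr. Qed.

Lemma cvg_succ u (l : R) : u n @[n --> \oo] --> l -> u n.+1 @[n --> \oo] --> l.
Proof. by rewrite -(cvg_shiftS u). Qed.

Lemma cvg_of_succ u (l : R) : u n.+1 @[n --> \oo] --> l -> u n @[n --> \oo] --> l.
Proof. by rewrite -(cvg_shiftS u). Qed.

Lemma cvg_natr_ratio : (n%:R / n.+1%:R : R) @[n --> \oo] --> (1 : R).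
Proof.
have -> : (fun n => n%:R / n.+1%:R : R) = (fun n => 1 - n.+1%:R^-1).
  by apply/funext => n; rewrite -[in LHS](addrK 1 n%:R) -natr1 mulrBl divff// mul1r.
rewrite -[X in _ --> X]subr0; apply: cvgB; [exact: cvg_cst|exact: cvg_invn].
Qed.

Lemma cvg_divn_succ u (l : R) : u n / n.+1%:R @[n --> \oo] --> l ->
  n%:R^-1 * u n @[n --> \oo] --> l.
Proof.
move=> ul; apply: cvg_of_succ.
have h : n.+2%:R / n.+1%:R @[n --> \oo] --> (1 : R).
  have -> : (fun n => n.+2%:R / n.+1%:R : R) = (fun n => 1 + n.+1%:R^-1).
    by apply/funext => n; rewrite -natr1 mulrDl divff// mul1r.
  by rewrite -[X in _ --> X]addr0; apply: cvgD; [exact: cvg_cst|exact: cvg_invn].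
have := seq_cvgM h (cvg_succ ul); rewrite mul1r => H; apply: cvg_eq H => n /=.
have n0 : (0 : R) <= n%:R by [].
by field; apply/andP; split; apply: lt0r_neq0; lra.
Qed.

(** The quotient is the average over [n.+1] terms minus [n / n.+1] times the average over [n] terms,
    and both tend to [l]. *)
Lemma avg_term0 r (l : R) : n%:R^-1 * (\sum_(0 <= k < n) r k) @[n --> \oo] --> l ->
  r n / n.+1%:R @[n --> \oo] --> 0.
Proof.
move=> rl; have rl' := cvg_succ rl.
have := seq_cvgB rl' (seq_cvgM rl cvg_natr_ratio).
rewrite mulr1 subrr => H; apply: cvg_near_eq H; exists 1%N => // n /= n1.
have n0 : (n%:R : R) != 0 by rewrite pnatr_eq0; lia.
have n10 : (n.+1%:R : R) != 0 by rewrite pnatr_eq0.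
rewrite big_nat_recr//=.
rewrite [n%:R^-1 * _]mulrC -mulrA [n%:R^-1 * _]mulrA mulVf// mul1r.
by rewrite mulrDr [X in X + _ - _]mulrC [X in X - _]addrC addrK mulrC.
Qed.

(** Summing the recursion expresses the sum of the [w k.+1] as twice the sum of the [r k], up to
    [w 0 - w n], and [w n] is [o(n)] by the two previous lemmas on such recursions. *)
Lemma half_rec_avg w r (l : R) : (forall n, w n.+1 = w n / 2 + r n) ->
  n%:R^-1 * (\sum_(0 <= k < n) r k) @[n --> \oo] --> l ->
  n%:R^-1 * (\sum_(0 <= k < n) w k.+1) @[n --> \oo] --> 2 * l.
Proof.
move=> wr rl; have w0 := cvg_divn_succ (half_rec_div wr (avg_term0 rl)).
have sumE n : \sum_(0 <= k < n) w k.+1 = 2 * (\sum_(0 <= k < n) r k) + w 0%N - w n.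
  elim: n => [|n IHn]; first by rewrite !big_geq//; lra.
  rewrite !big_nat_recr//= IHn wr; lra.
have c0 : n%:R^-1 * w 0%N @[n --> \oo] --> (0 : R).
  apply: cvg_of_succ; rewrite -[X in _ --> X](mul0r (w 0%N)); apply: cvgMl.
  exact: cvg_invn.
have := seq_cvgB (seq_cvgD (seq_cvgZ (k := 2) rl) c0) w0; rewrite addr0 subr0 => H.
apply: cvg_eq H => n /=.
by rewrite sumE mulrBr mulrDr mulrCA.
Qed.

Lemma cesaro_mean r (l : R) : r n @[n --> \oo] --> l ->
  n%:R^-1 * (\sum_(0 <= k < n) r k) @[n --> \oo] --> l.
Proof.
move=> /cesaro h.
by apply: cvg_of_succ; apply: cvg_eq h => n.
Qed.

Lemma sum_inv_sq_le2 N : \sum_(0 <= j < N) (j.+1%:R ^- 2 : R) <= 2.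
Proof.
suff h : \sum_(0 <= j < N) (j.+1%:R ^- 2 : R) <= 2 - N%:R^-1.
  by apply: (le_trans h); rewrite lerBlDr lerDl invr_ge0.
elim: N => [|[|N] IHN]; first by rewrite big_geq// invr0; lra.
  by rewrite big_nat1 expr1n invr1; lra.
rewrite big_nat_recr//=; have x0 : (0 : R) < N.+1%:R by rewrite ltr0n.
apply: (le_trans (lerD IHN (lexx _))).
rewrite -!(@natr1 _ N.+1); set x := N.+1%:R in x0 *.
have -> : 2 - (x + 1)^-1 = 2 - x^-1 + (x * (x + 1))^-1.
  by field; apply/andP; split; apply: lt0r_neq0; lra.
rewrite lerD2l lef_pV2 ?posrE; nra.
Qed.

Lemma sum_geo_le (x : R) N : 0 <= x -> x < 1 ->
  \sum_(0 <= j < N) x ^+ j <= (1 - x)^-1.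
Proof.
move=> x0 x1; have h : (1 - x) * (\sum_(0 <= j < N) x ^+ j) = 1 - x ^+ N.
  elim: N => [|N IHN]; first by rewrite big_geq// mulr0 expr0 subrr.
  by rewrite big_nat_recr//= mulrDr IHN exprS; ring.
rewrite -[leRHS]mulr1 ler_pdivlMl; last lra.
by rewrite h gerBl exprn_ge0.
Qed.

End sequences.

(** * Almost sure convergence from moment bounds *)

Section almost_sure.
Context {disp : measure_display} {Omega : measurableType disp} {R : realType}.
Variable P : probability Omega R.

(** By monotone convergence the sum of the series has expectation at most [C], so it is finite
    almost surely and its terms tend to 0. This plays the role of the Borel-Cantelli lemma. *)
Lemma summable_Ex_cvg0 (f : nat -> Omega -> R) (C : R) :
  (forall n, itg P (f n)) -> (forall n w, 0 <= f n w) ->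
  (forall N, \sum_(0 <= n < N) Ex P (f n) <= C) ->
  {ae P, forall w, f n w @[n --> \oo] --> 0}.
Proof.
move=> If f0 hC.
pose F w : \bar R := (\sum_(n <oo) (f n w)%:E)%E.
have mf n : measurable_fun setT (EFin \o f n) by case/integrableP : (If n).
have F0 w : (0 <= F w)%E by apply: nneseries_ge0 => n _ _; rewrite lee_fin.
have IF : P.-integrable setT F.
  apply/integrableP; split.
    apply: (@ge0_emeasurable_sum _ _ _ _ (fun n w => (f n w)%:E) xpredT) => //.
      by move=> n w _ _; rewrite lee_fin.
    by move=> n _; exact: mf.
  rewrite (eq_integral F); last by move=> w _; rewrite gee0_abs.
  rewrite integral_nneseries//; last by move=> n w _; rewrite lee_fin.
  apply: (@le_lt_trans _ _ C%:E); last exact: ltry.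
  apply: lime_le; first by apply: is_cvg_nneseries => n _ _; apply: integral_ge0 => w _; rewrite lee_fin.
  apply: nearW => N; under eq_bigr do rewrite ExE//.
  by rewrite sumEFin lee_fin.
have := integrable_ae measurableT IF; apply: filterS => w /(_ Logic.I) Fw.
apply: cvg_series_cvg_0.
apply: nondecreasing_is_cvgn.
  by apply: nondecreasing_series => n _ _; exact: f0.
exists (fine (F w)) => _ [N _ <-].
rewrite -lee_fin fineK// /series/= -sumEFin.
by apply: nneseries_lim_ge => n _ _; rewrite lee_fin.
Qed.

Lemma geometric_Ex_cvg0 (f : nat -> Omega -> R) (C x : R) :
  (forall n, itg P (f n)) -> (forall n w, 0 <= f n w) -> 0 <= x -> x < 1 -> 0 <= C ->
  (forall n, Ex P (f n) <= C * x ^+ n) ->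
  {ae P, forall w, f n w @[n --> \oo] --> 0}.
Proof.
move=> If f0 x0 x1 C0 hf; apply: (@summable_Ex_cvg0 _ (C / (1 - x))) => // N.
apply: (@le_trans _ _ (C * \sum_(0 <= n < N) x ^+ n)).
  by rewrite mulr_sumr; apply: ler_sum => n _.
by apply: ler_wpM2l => //; exact: sum_geo_le.
Qed.

End almost_sure.

Section strong_law.
Context {disp : measure_display} {Omega : measurableType disp} {R : realType}.
Variable P : probability Omega R.

Lemma floor_sqrt N : exists j, (j ^ 2 <= N)%N && (N < j.+1 ^ 2)%N.
Proof.
elim: N => [|N [j /andP[jN Nj]]]; first by exists 0%N.
have [h|h] := ltnP N.+1 (j.+1 ^ 2); first by exists j; rewrite h leqW.
by exists j.+1; rewrite h /= (leq_ltn_trans (n := j.+1 ^ 2)) ?ltn_sqr.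
Qed.

(* Convergence along squares plus a crude bound on the gaps between squares. *)
Lemma strong_law (D : nat -> Omega -> R) (C : R) : 0 <= C ->
  (forall n, sq P (D n)) ->
  (forall m N, (m <= N)%N ->
     Ex P (fun w => (\sum_(m <= n < N) D n w) ^+ 2) <= C * (N - m)%:R) ->
  {ae P, forall w, N%:R^-1 * (\sum_(0 <= n < N) D n w) @[N --> \oo] --> 0}.
Proof.
move=> C0 sD hD.
pose S m N w := \sum_(m <= n < N) D n w.
have sS m N : sq P (S m N) by apply: sq_sum.
(* [g j] controls the sum up to [j ^ 2] together with all fluctuations before [j.+1 ^ 2]: these are
   [2 * j + 1] squares, each of expectation at most [C * (2 * j + 1)], whence the bound
   [C * (j ^ 2 + (3 * j) ^ 2)]. Dividing by the fourth power in [f] makes the expectations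
   summable. *)
pose g j w := S 0%N (j ^ 2)%N w ^+ 2 + \sum_(j ^ 2 <= N < j.+1 ^ 2) S (j ^ 2)%N N w ^+ 2.
pose f j w := j.+1%:R ^- 4 * g j.+1 w.
have Ig j : itg P (g j).
  by apply: itgD; [case: (sS 0%N (j ^ 2)%N)|apply: itg_sum => N; case: (sS (j ^ 2)%N N)].
have g0 j w : 0 <= g j w.
  by rewrite addr_ge0 ?sqr_ge0// sumr_ge0// => N _; exact: sqr_ge0.
have Eg j : (0 < j)%N -> Ex P (g j) <= 10 * C * j%:R ^+ 2.
  move=> j0; have j1 : (1 : R) <= j%:R by rewrite ler1n.
  rewrite /g ExD; last 2 first.
  - by case: (sS 0%N (j ^ 2)%N).
  - by apply: itg_sum => N; case: (sS (j ^ 2)%N N).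
  rewrite Ex_sum; last by move=> N; case: (sS (j ^ 2)%N N).
  have h1 : Ex P (fun w => S 0%N (j ^ 2)%N w ^+ 2) <= C * j%:R ^+ 2.
    by rewrite -natrX -[X in X%:R]subn0; exact: hD.
  have h2 : \sum_(j ^ 2 <= N < j.+1 ^ 2) Ex P (fun w => S (j ^ 2)%N N w ^+ 2) <=
      \sum_(j ^ 2 <= N < j.+1 ^ 2) C * (2 * j%:R + 1).
    rewrite big_nat [leRHS]big_nat; apply: ler_sum => N /andP[N1 N2].
    apply: (le_trans (hD _ _ N1)); apply: ler_wpM2l => //.
    rewrite -natrM natr1 ler_nat; nia.
  rewrite (le_trans (lerD h1 h2))// sumr_const_nat.
  have -> : (j.+1 ^ 2 - j ^ 2 = 2 * j + 1)%N by nia.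
  rewrite -[X in _ + X]mulr_natr natrD natrM; set x := j%:R in j1 *.
  have : 0 <= C * (9 * x ^+ 2 - (2 * x + 1) ^+ 2) by rewrite mulr_ge0//; nra.
  by lra.
have : {ae P, forall w, f j w @[j --> \oo] --> 0}.
  apply: (@summable_Ex_cvg0 _ _ _ _ _ (20 * C)).
  - by move=> n; apply: itgZ.
  - by move=> n w; rewrite mulr_ge0// invr_ge0 exprn_ge0.
  move=> N; apply: (@le_trans _ _ (10 * C * \sum_(0 <= j < N) (j.+1%:R ^- 2))).
    rewrite mulr_sumr; apply: ler_sum => j _.
    rewrite /f ExZ//; have := Eg j.+1 isT.
    have : (0 : R) < j.+1%:R by rewrite ltr0n.
    set x := j.+1%:R => x0 h.
    have -> : 10 * C * x ^- 2 = x ^- 4 * (10 * C * x ^+ 2).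
      by field; exact: lt0r_neq0.
    by apply: ler_wpM2l => //; rewrite invr_ge0 exprn_ge0// ltW.
  have -> : 20 * C = 10 * C * 2 by ring.
  by rewrite ler_wpM2l ?sum_inv_sq_le2// mulr_ge0.
apply: filterS => w fw.
have key N : (0 < N)%N -> exists2 j, (N < j.+2 ^ 2)%N &
    (N%:R^-1 * S 0%N N w) ^+ 2 <= 2 * f j w.
  move=> N0; have [[|j] /andP[jN Nj]] := floor_sqrt N; first by lia.
  exists j => //.
  have h : S 0%N N w = S 0%N (j.+1 ^ 2)%N w + S (j.+1 ^ 2)%N N w.
    by rewrite /S -big_cat_nat.
  have h2 : S (j.+1 ^ 2)%N N w ^+ 2 <=
      \sum_(j.+1 ^ 2 <= N < j.+2 ^ 2) S (j.+1 ^ 2)%N N w ^+ 2.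
    rewrite (bigD1_seq N) ?iota_uniq ?mem_index_iota ?jN//=.
    by rewrite lerDl sumr_ge0// => i _; exact: sqr_ge0.
  have x0 : (0 : R) < j.+1%:R by rewrite ltr0n.
  have y0 : (0 : R) < N%:R by rewrite ltr0n.
  have xy : j.+1%:R ^+ 2 <= N%:R :> R by rewrite -natrX ler_nat.
  rewrite exprMn exprVn /f /g [leRHS]mulrCA.
  apply: (@le_trans _ _ (j.+1%:R ^- 4 * S 0%N N w ^+ 2)).
    rewrite ler_wpM2r ?sqr_ge0// lef_pV2 ?posrE ?exprn_gt0//.
    by rewrite (_ : 4%N = (2 * 2)%N)// exprM lerXn2r ?nnegrE// ?exprn_ge0// ltW.
  rewrite ler_wpM2l ?invr_ge0 ?exprn_ge0 ?(ltW x0)// h.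
  set s := \sum_(_ <= _ < _) _ in h2 *.
  set p := S 0%N _ w; set q := S _ N w in h2 *.
  have := sqr_ge0 (p - q); nra.
apply/cvgr0Pnorm_lt => e e0.
have e2 : 0 < e ^+ 2 / 2 by rewrite divr_gt0// exprn_gt0.
have /cvgr0Pnorm_lt/(_ _ e2) [M _ hM] := fw.
exists (M.+1 ^ 2)%N => // N /= MN.
have [|j Nj hj] := key N; first by nia.
have Mj : (M <= j)%N by nia.
have := hM _ Mj; rewrite ltr_norml => /andP[_ h].
rewrite -(ltr_pXn2r (n := 2)) ?nnegrE ?(ltW e0)// real_normK ?num_real//.
by apply: (le_lt_trans hj); lra.
Qed.

End strong_law.

(** * The process along a line of descent *)

(** The fixed point of [B = 2 / (1 + r) * (r * B) + 2 / (1 - r) * V], the recursion for second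
    moments used in [path_value_sq]. *)
Definition value_bound {R : realType} (r V : R) : R := 2 * V * (1 + r) / (1 - r) ^+ 2.

Section tree_process.
Context {disp : measure_display} {Omega : measurableType disp} {R : realType}.
Variable P : probability Omega R.
(* [zeta k.*2] is the coefficient pair (a_k, b_k), [zeta k.*2.+1] the innovation
   pair (eps_{2k}, eps_{2k+1}). *)
Variable zeta : nat -> Omega -> R * R.

(** Indexed by the child: [coef k] and [innov k] are the coefficient and the innovation in the
    recursion that yields the value at [k] from the value at its parent [k./2]. *)
Definition coef (k : nat) (w : Omega) : R :=
  if odd k then (zeta k./2.*2 w).2 else (zeta k./2.*2 w).1.

Definition innov (k : nat) (w : Omega) : R :=
  if odd k then (zeta k./2.*2.+1 w).2 else (zeta k./2.*2.+1 w).1.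

Fixpoint path_coef (j k : nat) (w : Omega) : R :=
  if j is j'.+1 then coef k w * path_coef j' k./2 w else 1.

(* The value at k of the autoregression started from 0 at the j-th ancestor. *)
Fixpoint path_value (j k : nat) (w : Omega) : R :=
  if j is j'.+1 then coef k w * path_value j' k./2 w + innov k w else 0.

Definition node (p : nat) : set nat := [set i | i./2 = p].

Fixpoint path_nodes (j k : nat) : set nat :=
  if j is j'.+1 then node k./2 `|` path_nodes j' k./2 else set0.

(** The noise carried by the nodes 1 to [k - 1]. It contains the noise carried by the strict
    ancestors of [k], which determines the value at [k], and is disjoint from [node k], which acts
    on the children of [k]. *)
Definition below (k : nat) : set nat := [set i | (1 < i < k.*2)%N].

Definition noise_index : set nat := [set i | (1 < i)%N].

Lemma path_nodesP j k i : path_nodes j k i ->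
  exists2 m, (m < j)%N & i./2 = (k %/ 2 ^ m.+1)%N.
Proof.
elim: j k => [//|j IHj] k /= [->|/IHj [m mj ->]]; first by exists 0%N; rewrite // expn1 divn2.
by exists m.+1; rewrite // -divn2 -divnMA -expnS.
Qed.

Lemma path_nodes_below j k : (2 ^ j <= k)%N -> path_nodes j k `<=` below k.
Proof.
move=> jk i /path_nodesP [m mj ik]; rewrite /below/=.
have k0 : (0 < k)%N by apply: leq_trans jk; rewrite expn_gt0.
have h1 : (0 < i./2)%N.
  by rewrite ik divn_gt0 ?expn_gt0// (leq_trans _ jk)// leq_exp2l.
have h2 : (i./2 < k)%N.
  rewrite ik ltn_divLR ?expn_gt0// -[ltnLHS]muln1 ltn_pmul2l//.
  by rewrite -[ltnLHS](expn0 2) ltn_exp2l.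
by have := odd_double_half i; lia.
Qed.

Lemma node_below p k : (p < k)%N -> (0 < p)%N -> node p `<=` below k.
Proof. by move=> pk p0 i; rewrite /node /below/= => ip; lia. Qed.

Lemma below_mono k l : (k <= l)%N -> below k `<=` below l.
Proof. by move=> kl i; rewrite /below/=; lia. Qed.

Lemma below_noise k : below k `<=` noise_index.
Proof. by move=> i; rewrite /below/noise_index/=; lia. Qed.

Lemma node_noise p : (0 < p)%N -> node p `<=` noise_index.
Proof. by move=> p0 i; rewrite /node /noise_index/=; lia. Qed.

Lemma below_node p : below p `&` node p = set0.
Proof.
by apply/seteqP; split => // i []; rewrite /below/node/=; lia.
Qed.

(** The size of an index determines its generation, so a common ancestor sits at the same depth on
    both paths; from there upwards the paths coincide, in particular at the [j]-th ancestors. *)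
Lemma path_nodes_disjoint n j k l : k \in gen n -> l \in gen n -> (j <= n)%N ->
  (k %/ 2 ^ j)%N <> (l %/ 2 ^ j)%N -> path_nodes j k `&` path_nodes j l = set0.
Proof.
rewrite !mem_index_iota => /andP[k1 k2] /andP[l1 l2] jn kl.
apply/seteqP; split => // i [/path_nodesP [m mj ik] /path_nodesP [m' mj' il]].
have size x m0 : (2 ^ n <= x)%N -> (x < 2 ^ n.+1)%N -> (m0 < j)%N ->
    (2 ^ (n - m0.+1) <= x %/ 2 ^ m0.+1 < 2 ^ (n - m0.+1).+1)%N.
  move=> x1 x2 mm; have e : (n = n - m0.+1 + m0.+1)%N by lia.
  rewrite leq_divRL ?expn_gt0// ltn_divLR ?expn_gt0// -!expnD addSn -e.
  by rewrite x1 x2.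
have mm' : m = m'.
  have := size _ _ k1 k2 mj; have := size _ _ l1 l2 mj'; rewrite -ik -il.
  move=> /andP[a1 a2] /andP[b1 b2].
  have := leq_ltn_trans a1 b2; have := leq_ltn_trans b1 a2.
  by rewrite !ltn_exp2l//; lia.
apply: kl; rewrite -mm' in il.
have e : (2 ^ j = 2 ^ m.+1 * 2 ^ (j - m.+1))%N by rewrite -expnD; congr expn; lia.
by rewrite e !divnMA -ik -il.
Qed.

Hypothesis mzeta : forall i, measurable_fun setT (zeta i).

Lemma coef_mJ k : mJ zeta (node k./2) (coef k).
Proof.
rewrite /coef; case: (odd k).
  by apply: (mJ_coord (h := snd)); rewrite ?/node/= ?doubleK//; exact: measurable_snd.
by apply: (mJ_coord (h := fst)); rewrite ?/node/= ?doubleK//; exact: measurable_fst.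
Qed.

Lemma innov_mJ k : mJ zeta (node k./2) (innov k).
Proof.
rewrite /innov; case: (odd k).
  by apply: (mJ_coord (h := snd)); rewrite ?/node/= ?uphalf_double//; exact: measurable_snd.
by apply: (mJ_coord (h := fst)); rewrite ?/node/= ?uphalf_double//; exact: measurable_fst.
Qed.

Hypothesis hind : forall (J : seq nat) (B : nat -> set (R * R)), uniq J ->
  (forall i, i \in J -> noise_index i) -> (forall i, measurable (B i)) ->
  P (\bigcap_(i in [set` J]) zeta i @^-1` B i) =
  (\prod_(i <- J) P (zeta i @^-1` B i))%E.

Variables r V : R.
Hypotheses (r0 : 0 <= r) (r1 : r < 1) (V0 : 0 <= V).
Hypothesis coef_sq : forall k, (1 < k)%N ->
  itg P (fun w => coef k w ^+ 2) /\ Ex P (fun w => coef k w ^+ 2) <= r.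
Hypothesis innov_sq : forall k, (1 < k)%N ->
  itg P (fun w => innov k w ^+ 2) /\ Ex P (fun w => innov k w ^+ 2) <= V.

(** The coefficient [coef k] is carried by the parent [k./2], whereas [U] only involves strict
    ancestors of [k./2]: by independence the second moments multiply. *)
Lemma coef_step j k (U : Omega -> R) (K : R) : (2 ^ j.+1 <= k)%N ->
  sqJ P zeta (path_nodes j k./2) U -> Ex P (fun w => U w ^+ 2) <= K -> 0 <= K ->
  sqJ P zeta (path_nodes j.+1 k) (fun w => coef k w * U w) /\
  Ex P (fun w => (coef k w * U w) ^+ 2) <= r * K.
Proof.
move=> jk sU EU K0.
have k2 : (1 < k)%N by rewrite (leq_trans _ jk)// -[ltnLHS](expn0 2) ltn_exp2l.
have jk2 : (2 ^ j <= k./2)%N by move: jk; rewrite expnS; lia.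
have k20 : (0 < k./2)%N by lia.
have [Ic Ec] := coef_sq k2.
have [||| h1 h2|sC EC] := sqJM (J := path_nodes j.+1 k) mzeta hind
  (node_noise k20) _ _ _ _ (conj (coef_mJ (k := k)) Ic) sU.
- by move=> i /(path_nodes_below jk2); exact: below_noise.
- apply/seteqP; split => // i [ki /(path_nodes_below jk2) bi].
  by rewrite -(below_node k./2); split.
- exact: subsetUl.
- by apply: subsetUr.
split => //; rewrite EC; apply: ler_pM => //.
- by apply: Ex_ge0 => w; exact: sqr_ge0.
- by apply: Ex_ge0 => w; exact: sqr_ge0.
Qed.

Lemma path_coef_sq j k : (2 ^ j <= k)%N ->
  sqJ P zeta (path_nodes j k) (path_coef j k) /\
  Ex P (fun w => path_coef j k w ^+ 2) <= r ^+ j.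
Proof.
elim: j k => [|j IHj] k jk.
  split; first by split; [exact: mJ_cst|exact: (@sq_cst _ _ _ P 1).2].
  by rewrite /= expr1n Ex_cst.
have jk2 : (2 ^ j <= k./2)%N by move: jk; rewrite expnS; lia.
have [sA EA] := IHj _ jk2.
by rewrite exprS; apply: coef_step => //; exact: exprn_ge0.
Qed.

Local Notation B := (value_bound r V).

Lemma value_bound_ge0 : 0 <= B.
Proof.
have h1 : 0 <= 1 + r by have := r0; lra.
have h2 : 0 <= (1 - r) ^+ 2 by exact: sqr_ge0.
by rewrite /value_bound !mulr_ge0// invr_ge0.
Qed.

Lemma path_value_sq j k : (2 ^ j <= k)%N ->
  sqJ P zeta (path_nodes j k) (path_value j k) /\
  Ex P (fun w => path_value j k w ^+ 2) <= B.
Proof.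
elim: j k => [|j IHj] k jk.
  split; first by split; [exact: mJ_cst|exact: (@sq_cst _ _ _ P 0).2].
  by rewrite /= expr0n Ex_cst value_bound_ge0.
have jk2 : (2 ^ j <= k./2)%N by move: jk; rewrite expnS; lia.
have k2 : (1 < k)%N by rewrite (leq_trans _ jk)// -[ltnLHS](expn0 2) ltn_exp2l.
have [sZ EZ] := IHj _ jk2.
have [sC EC] := coef_step jk sZ EZ value_bound_ge0.
have [Ii Ei] := innov_sq k2.
have si : sqJ P zeta (path_nodes j.+1 k) (innov k).
  by apply: (sqJ_mono _) (conj (innov_mJ (k := k)) Ii); exact: subsetUl.
split.
  split; first by apply: mJD; [case: sC|case: si].
  by have [_] := sqD (sqJ_sq mzeta sC) (sqJ_sq mzeta si).
have h1 : 0 < 1 - r by rewrite subr_gt0.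
have h2 : 0 < 1 + r by have := r0; lra.
(* (x + y)^2 <= x^2 / t + y^2 / (1 - t) with t = (1 + r) / 2 *)
apply: (@le_trans _ _ (2 / (1 + r) * Ex P (fun w => (coef k w * path_value j k./2 w) ^+ 2)
    + 2 / (1 - r) * Ex P (fun w => innov k w ^+ 2))).
  have I1 := sC.2; rewrite -!ExZ// -ExD; [|exact: itgZ|exact: itgZ].
  apply: Ex_le.
  - by have [_] := sqD (sqJ_sq mzeta sC) (sqJ_sq mzeta si).
  - by apply: itgD; exact: itgZ.
  move=> w /=; set x := coef k w * _; set y := innov k w.
  rewrite -subr_ge0.
  have -> : 2 / (1 + r) * x ^+ 2 + 2 / (1 - r) * y ^+ 2 - (x + y) ^+ 2 =
      ((1 - r) * x - (1 + r) * y) ^+ 2 / ((1 - r) * (1 + r)).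
    by field; apply/andP; split; exact: lt0r_neq0.
  by rewrite divr_ge0 ?sqr_ge0// mulr_ge0 ?ltW.
apply: (@le_trans _ _ (2 / (1 + r) * (r * B) + 2 / (1 - r) * V)).
  by apply: lerD; apply: ler_wpM2l => //; rewrite divr_ge0 ?ltW.
rewrite le_eqVlt; apply/orP; left; apply/eqP; rewrite /value_bound.
by field; apply/andP; split; exact: lt0r_neq0.
Qed.

(** The innovations of the last [j] steps cancel: the difference is the product of the last [j]
    coefficients by the value accumulated above them. Restarting from 0 at the [j]-th ancestor thus
    costs a geometrically small error. *)
Lemma path_value_diff_sq i j k : (2 ^ (j + i) <= k)%N ->
  sqJ P zeta (path_nodes (j + i) k) (fun w => path_value (j + i) k w - path_value j k w) /\
  Ex P (fun w => (path_value (j + i) k w - path_value j k w) ^+ 2) <= r ^+ j * B.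
Proof.
elim: j k => [|j IHj] k jk.
  have [sZ EZ] := path_value_sq jk; rewrite add0n expr0 mul1r.
  by under eq_fun do rewrite subr0; under [in X in _ /\ X]eq_fun do rewrite subr0.
have jk2 : (2 ^ (j + i) <= k./2)%N by move: jk; rewrite addSn expnS; lia.
have [sD ED] := IHj _ jk2.
have [|sC EC] := coef_step jk sD ED; first by rewrite mulr_ge0 ?exprn_ge0 ?value_bound_ge0.
have -> : (fun w => path_value (j.+1 + i) k w - path_value j.+1 k w) =
  (fun w => coef k w * (path_value (j + i) k./2 w - path_value j k./2 w)).
  by apply/funext => w /=; ring.
split => //; rewrite exprS -mulrA; apply: le_trans EC.
by rewrite le_eqVlt; apply/orP; left; apply/eqP; apply: eq_Ex => w /=; ring.
Qed.

End tree_process.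

Section autoregression.
Context {disp : measure_display} {Omega : measurableType disp} {R : realType}.
Variables (zeta : nat -> Omega -> R * R) (X : nat -> Omega -> R).
Local Notation coef := (coef zeta).
Local Notation innov := (innov zeta).
Local Notation path_coef := (path_coef zeta).
Local Notation path_value := (path_value zeta).
Hypothesis X_rec : forall k w, (1 < k)%N ->
  X k w = coef k w * X k./2 w + innov k w.

Lemma X_path j k w : (2 ^ j <= k)%N ->
  X k w = path_coef j k w * X (k %/ 2 ^ j)%N w + path_value j k w.
Proof.
elim: j k => [|j IHj] k jk; first by rewrite expn0 divn1 /=; ring.
have k2 : (1 < k)%N by rewrite (leq_trans _ jk)// -[ltnLHS](expn0 2) ltn_exp2l.
have jk2 : (2 ^ j <= k./2)%N by move: jk; rewrite expnS; lia.
rewrite X_rec// IHj// expnS divnMA divn2 /=; ring.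
Qed.

Lemma X_gen n k w : k \in gen n ->
  X k w = path_coef n k w * X 1%N w + path_value n k w.
Proof.
rewrite mem_index_iota => /andP[k1 k2]; rewrite (X_path w k1).
suff -> : (k %/ 2 ^ n = 1)%N by [].
by apply/eqP; rewrite eqn_leq -ltnS ltn_divLR ?expn_gt0// leq_divRL ?expn_gt0// mul1n -expnS k1 k2.
Qed.

End autoregression.

Section tree_noise_def.
Context {disp : measure_display} {Omega : measurableType disp} {R : realType}.

Record tree_noise (P : probability Omega R) (zeta : nat -> Omega -> R * R)
    (r V : R) : Prop := TreeNoise {
  tn_meas : forall i, measurable_fun setT (zeta i);
  tn_indep : forall (J : seq nat) (B : nat -> set (R * R)), uniq J ->
    (forall i, i \in J -> noise_index i) -> (forall i, measurable (B i)) ->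
    P (\bigcap_(i in [set` J]) zeta i @^-1` B i) =
    (\prod_(i <- J) P (zeta i @^-1` B i))%E;
  tn_r0 : 0 <= r; tn_r1 : r < 1; tn_V0 : 0 <= V;
  tn_coef : forall k, (1 < k)%N ->
    itg P (fun w => coef zeta k w ^+ 2) /\ Ex P (fun w => coef zeta k w ^+ 2) <= r;
  tn_innov : forall k, (1 < k)%N ->
    itg P (fun w => innov zeta k w ^+ 2) /\ Ex P (fun w => innov zeta k w ^+ 2) <= V
}.

End tree_noise_def.

Section generations.
Context {R : realType}.
Implicit Types (x : R) (F : nat -> R).

Definition gen_avg (n : nat) F : R := 2 ^- n * \sum_(k <- gen n) F k.

Lemma size_gen n : size (gen n) = (2 ^ n)%N.
Proof. by rewrite size_iota expnS; lia. Qed.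

Lemma gen_bounds n k : k \in gen n -> (2 ^ n <= k)%N && (k < 2 ^ n.+1)%N.
Proof. by rewrite mem_index_iota. Qed.

Lemma gen_gt0 n k : k \in gen n -> (0 < k)%N.
Proof. by move=> /gen_bounds /andP[+ _]; apply: leq_trans; rewrite expn_gt0. Qed.

Lemma sqr_sum_le (I : Type) (s : seq I) (F : I -> R) :
  (\sum_(i <- s) F i) ^+ 2 <= (size s)%:R * \sum_(i <- s) F i ^+ 2.
Proof.
elim: s => [|i s IHs]; first by rewrite !big_nil expr0n mul0r.
rewrite !big_cons /= -natr1; set S := \sum_(j <- s) F j in IHs *.
set T := \sum_(j <- s) F j ^+ 2 in IHs *; set x := F i.
have n0 : (0 : R) <= (size s)%:R by [].
set n := (size s)%:R in n0 IHs *.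
have T0 : 0 <= T by apply: sumr_ge0 => j _; exact: sqr_ge0.
have [nE|nN] := eqVneq n 0.
  have S0 : S = 0.
    by apply/eqP; rewrite -sqrf_eq0 eq_le sqr_ge0 andbT -[leRHS](mul0r T) -nE.
  by rewrite nE S0; nra.
have n1 : 0 < n by rewrite lt_neqAle eq_sym nN.
rewrite -subr_ge0 -(pmulr_rge0 _ n1).
have := sqr_ge0 (n * x - S); nra.
Qed.

Lemma sqr_gen_avg_le n F : gen_avg n F ^+ 2 <= gen_avg n (fun k => F k ^+ 2).
Proof.
rewrite /gen_avg exprMn; have h : 0 < 2 ^+ n :> R by rewrite exprn_gt0.
apply: (@le_trans _ _ ((2 ^- n) ^+ 2 * ((2 ^+ n) * \sum_(k <- gen n) F k ^+ 2))).
  rewrite ler_wpM2l ?sqr_ge0//; apply: (le_trans (sqr_sum_le _ _)).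
  by rewrite size_gen natrX.
rewrite le_eqVlt; apply/orP; left; apply/eqP; field.
exact: lt0r_neq0.
Qed.

Lemma gen_avg_le n F G : (forall k, k \in gen n -> F k <= G k) ->
  gen_avg n F <= gen_avg n G.
Proof.
move=> FG; rewrite ler_wpM2l ?invr_ge0 ?exprn_ge0//.
by rewrite big_seq [leRHS]big_seq; apply: ler_sum.
Qed.

Lemma gen_avg_const n x : gen_avg n (fun=> x) = x.
Proof.
by rewrite /gen_avg big_const_seq count_predT size_gen iter_addr_0 -[x *+ _]mulr_natl natrX mulrA mulVf ?mul1r.
Qed.

Lemma gen_avgB n F G : gen_avg n (fun k => F k - G k) = gen_avg n F - gen_avg n G.
Proof. by rewrite /gen_avg sumrB mulrBr. Qed.

Lemma gen_avgD n F G : gen_avg n (fun k => F k + G k) = gen_avg n F + gen_avg n G.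
Proof. by rewrite /gen_avg big_split mulrDr. Qed.

Lemma gen_avgZ n x F : gen_avg n (fun k => x * F k) = x * gen_avg n F.
Proof. by rewrite /gen_avg -mulr_sumr mulrCA. Qed.

Lemma norm_gen_avg_le n F : `|gen_avg n F| <= gen_avg n (fun k => `|F k|).
Proof.
rewrite /gen_avg normrM ger0_norm ?invr_ge0 ?exprn_ge0// ler_wpM2l ?invr_ge0 ?exprn_ge0//.
exact: ler_norm_sum.
Qed.

Lemma eq_gen_avg n F G : (forall k, k \in gen n -> F k = G k) ->
  gen_avg n F = gen_avg n G.
Proof. by move=> FG; rewrite /gen_avg; congr (_ * _); exact: eq_big_seq. Qed.

Lemma count_same_ancestor n j p : (count (fun l => l %/ 2 ^ j == p) (gen n) <= 2 ^ j)%N.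
Proof.
rewrite -size_filter.
have sz : size (index_iota (p * 2 ^ j) (p.+1 * 2 ^ j)) = (2 ^ j)%N.
  by rewrite size_iota mulSn addnK.
apply: leq_trans (eq_leq sz); apply: uniq_leq_size; first by rewrite filter_uniq// iota_uniq.
move=> l; rewrite mem_filter mem_index_iota => /andP[/eqP <- _].
by rewrite leq_trunc_div/= -ltn_divLR ?expn_gt0.
Qed.

Definition bounded_lipschitz (K : R) (phi : R -> R) :=
  [/\ 0 <= K, forall x, `|phi x| <= K & forall x y, `|phi x - phi y| <= K * `|x - y|].

Lemma bounded_lipschitz_continuous K phi : bounded_lipschitz K phi -> continuous phi.
Proof.
move=> [K0 _ lip] x; apply/cvgrPdist_lt => e e0.
have K1 : 0 < K + 1 by lra.
near=> y; apply: (le_lt_trans (lip x y)).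
have : `|x - y| < e / (K + 1).
  near: y; apply: (@cvgr_dist_lt _ _ _ (nbhs x) _ id x) => //.
  by rewrite divr_gt0.
rewrite ltr_pdivlMr// => h; apply: le_lt_trans h.
by have := normr_ge0 (x - y); nra.
Unshelve. all: by end_near. Qed.

Lemma bounded_lipschitz_measurable K phi : bounded_lipschitz K phi ->
  measurable_fun setT phi.
Proof. by move=> /bounded_lipschitz_continuous; exact: continuous_measurable_fun. Qed.

Lemma bounded_lipschitz_sqr K phi x y : bounded_lipschitz K phi ->
  (phi x - phi y) ^+ 2 <= K ^+ 2 * (x - y) ^+ 2.
Proof.
move=> [K0 _ lip]; rewrite -exprMn -[leLHS]real_normK ?num_real//.
rewrite -[leRHS]real_normK ?num_real// normrM (ger0_norm K0).
by rewrite lerXn2r ?nnegrE// mulr_ge0.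
Qed.

End generations.

(** * A law of large numbers on the tree *)

Section law_of_large_numbers.
Context {disp : measure_display} {Omega : measurableType disp} {R : realType}.
Variables (P : probability Omega R) (zeta : nat -> Omega -> R * R) (r V : R).
Hypothesis H : tree_noise P zeta r V.
Local Notation B := (value_bound r V).

Lemma noise_coef_sq j k : (2 ^ j <= k)%N ->
  sqJ P zeta (path_nodes j k) (path_coef zeta j k) /\
  Ex P (fun w => path_coef zeta j k w ^+ 2) <= r ^+ j.
Proof. by case: H => *; apply: path_coef_sq. Qed.

Lemma noise_value_sq j k : (2 ^ j <= k)%N ->
  sqJ P zeta (path_nodes j k) (path_value zeta j k) /\
  Ex P (fun w => path_value zeta j k w ^+ 2) <= B.
Proof. by case: H => *; apply: path_value_sq. Qed.

Lemma noise_value_diff_sq i j k : (2 ^ (j + i) <= k)%N ->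
  sq P (fun w => path_value zeta (j + i) k w - path_value zeta j k w) /\
  Ex P (fun w => (path_value zeta (j + i) k w - path_value zeta j k w) ^+ 2) <= r ^+ j * B.
Proof.
case: H => mz hi rp rl Vp hc hv jk.
have [s E] := path_value_diff_sq mz hi rp rl Vp hc hv jk.
by split => //; exact: (sqJ_sq mz s).
Qed.

Lemma noise_bound_ge0 : 0 <= B.
Proof. by case: H => *; apply: value_bound_ge0. Qed.

Lemma noise_ExM J1 J2 (U W : Omega -> R) : J1 `<=` noise_index -> J2 `<=` noise_index ->
  J1 `&` J2 = set0 -> mJ zeta J1 U -> mJ zeta J2 W -> itg P U -> itg P W ->
  itg P (fun w => U w * W w) /\ Ex P (fun w => U w * W w) = Ex P U * Ex P W.
Proof.
case: H => mz hi _ _ _ _ _ s1 s2 d mU mW IU IW.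
exact: (mJ_ExM mz hi s1 s2 d mU mW IU IW).
Qed.

Lemma gen_avg_sq n (F : nat -> Omega -> R) : (forall k, k \in gen n -> sq P (F k)) ->
  sq P (fun w => gen_avg n (F^~ w)).
Proof.
move=> sF; apply: sqZ.
(* The lemmas on sums ask for integrability at every index, which is known on the generation only;
   terms outside are set to 0. The same device recurs below. *)
have -> : (fun w => \sum_(k <- gen n) F k w) =
   (fun w => \sum_(k <- gen n) (if k \in gen n then F k w else 0)).
  by apply/funext => w; rewrite big_seq [RHS]big_seq; apply: eq_bigr => k ->.
apply: (@sq_sum _ _ _ _ _ _ (fun k w => if k \in gen n then F k w else 0)) => k.
by case: (boolP (k \in gen n)) => kn; [exact: sF|exact: sq_cst].
Qed.

Lemma Ex_gen_avg n (F : nat -> Omega -> R) : (forall k, k \in gen n -> itg P (F k)) ->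
  Ex P (fun w => gen_avg n (F^~ w)) = gen_avg n (fun k => Ex P (F k)).
Proof.
move=> IF; pose G k w := if k \in gen n then F k w else 0.
have IG k : itg P (G k).
  by rewrite /G; case: (boolP (k \in gen n)) => kn; [exact: IF|exact: itg_cst].
have -> : (fun w => gen_avg n (F^~ w)) = (fun w => 2 ^- n * \sum_(k <- gen n) G k w).
  by apply/funext => w; apply: eq_gen_avg => k kn; rewrite /G kn.
rewrite ExZ; last exact: itg_sum.
rewrite Ex_sum//; congr (_ * _); apply: eq_big_seq => k kn.
by apply: eq_Ex => w; rewrite /G kn.
Qed.

Variables (K : R) (phi : R -> R).
Hypothesis BL : bounded_lipschitz K phi.

Let tphi j k w := phi (path_value zeta j k w).

Lemma phi_value_sq j k : (2 ^ j <= k)%N -> sq P (tphi j k).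
Proof.
move=> jk; have [K0 phiK lip] := BL; apply: (@sq_bounded _ _ _ _ _ K) => [|w]; last exact: phiK.
apply: measurableT_comp; first exact: bounded_lipschitz_measurable BL.
by have [/sqJ_sq [] //] := noise_value_sq jk; exact: tn_meas H.
Qed.

(** Two nodes with distinct [j]-th ancestors have independent truncated values. There remain at most
    [2 ^ n * 2 ^ j] pairs, each contributing at most [(2 * K) ^+ 2], to be divided by
    [2 ^ (2 * n)]. *)
Lemma truncated_avg_var n j : (j <= n)%N ->
  Ex P (fun w => gen_avg n (fun k => tphi j k w - Ex P (tphi j k)) ^+ 2) <=
  4 * K ^+ 2 * 2^-1 ^+ (n - j).
Proof.
move=> jn; have [K0 phiK lip] := BL.
have k2 k : k \in gen n -> (2 ^ j <= k)%N.
  by move=> /gen_bounds /andP[+ _]; apply: leq_trans; rewrite leq_exp2l.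
pose psi k w := if k \in gen n then tphi j k w - Ex P (tphi j k) else 0.
have psiK k w : `|psi k w| <= 2 * K.
  rewrite /psi; case: ifPn => [kn|_]; last by rewrite normr0 mulr_ge0.
  apply: (le_trans (ler_normB _ _)).
  have := phiK (path_value zeta j k w).
  have := @Ex_le_norm_bound _ _ _ P _ K (phi_value_sq (k2 _ kn)).1 (fun w => phiK _).
  by rewrite /tphi; lra.
have spsi k : sq P (psi k).
  rewrite /psi; case: (boolP (k \in gen n)) => kn; last exact: sq_cst.
  by apply: sqB; [exact: phi_value_sq (k2 _ kn)|exact: sq_cst].
have -> : (fun w => gen_avg n (fun k => tphi j k w - Ex P (tphi j k)) ^+ 2) =
   (fun w => (2 ^- n) ^+ 2 * \sum_(k <- gen n) \sum_(l <- gen n) psi k w * psi l w).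
  apply/funext => w; rewrite /gen_avg exprMn; congr (_ * _).
  rewrite expr2 mulr_suml; under eq_bigr do rewrite mulr_sumr.
  rewrite big_seq [RHS]big_seq; apply: eq_bigr => k kn.
  rewrite big_seq [RHS]big_seq; apply: eq_bigr => l ln.
  by rewrite /psi kn ln.
rewrite ExZ; last by apply: itg_sum => k; apply: itg_sum => l; exact: sq_itgM.
rewrite Ex_sum; last by move=> k; apply: itg_sum => l; exact: sq_itgM.
have Epsi k l : k \in gen n -> l \in gen n -> Ex P (fun w => psi k w * psi l w) <=
    if (l %/ 2 ^ j == k %/ 2 ^ j)%N then 4 * K ^+ 2 else 0.
  move=> kn ln; case: eqP => [_|kl].
    rewrite (le_trans (ler_norm _))//; apply: Ex_le_norm_bound.
      by apply: measurable_funM; [exact: (spsi k).1|exact: (spsi l).1].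
    move=> w; rewrite normrM; have := ler_pM (normr_ge0 _) (normr_ge0 _) (psiK k w) (psiK l w).
    by move=> h; apply: (le_trans h); lra.
  have sJ k' : k' \in gen n -> mJ zeta (path_nodes j k') (psi k').
    move=> k'n; rewrite /psi k'n; apply: mJB; last exact: mJ_cst.
    apply: mJ_comp; first exact: bounded_lipschitz_measurable BL.
    by have [[]] := noise_value_sq (k2 _ k'n).
  have nJ k' : k' \in gen n -> path_nodes j k' `<=` noise_index.
    by move=> k'n i /(path_nodes_below (k2 _ k'n)); exact: below_noise.
  have [|_ ->] := noise_ExM (nJ _ kn) (nJ _ ln) _ (sJ _ kn) (sJ _ ln)
    (sq_itg (spsi k)) (sq_itg (spsi l)).
    by apply: (path_nodes_disjoint kn ln jn) => kl'; apply: kl; rewrite kl'.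
  have -> : Ex P (psi k) = 0; last by rewrite mul0r.
  have I1 := sq_itg (phi_value_sq (k2 _ kn)).
  rewrite /psi kn ExB//; last exact: itg_cst.
  by rewrite Ex_cst subrr.
apply: (@le_trans _ _ ((2 ^- n) ^+ 2 * \sum_(k <- gen n) (2 ^+ j * (4 * K ^+ 2)))).
  rewrite ler_wpM2l ?sqr_ge0// big_seq [leRHS]big_seq; apply: ler_sum => k kn.
  rewrite Ex_sum; last by move=> l; exact: sq_itgM.
  apply: (@le_trans _ _ (\sum_(l <- gen n) if (l %/ 2 ^ j == k %/ 2 ^ j)%N then 4 * K ^+ 2 else 0)).
    by rewrite big_seq [leRHS]big_seq; apply: ler_sum => l ln; exact: Epsi.
  rewrite -big_mkcond/= big_const_seq iter_addr_0 -[_ *+ count _ _]mulr_natl.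
  apply: ler_wpM2r; first by rewrite mulr_ge0// sqr_ge0.
  by rewrite -natrX ler_nat; exact: count_same_ancestor.
have := gen_avg_const n (2 ^+ j * (4 * K ^+ 2)); rewrite /gen_avg => E.
rewrite expr2 -mulrA E exprVn.
have -> : 2 ^+ n = 2 ^+ (n - j) * 2 ^+ j :> R by rewrite -exprD subnK.
rewrite le_eqVlt; apply/orP; left; apply/eqP; field.
by apply/andP; split; rewrite expf_neq0.
Qed.

Lemma truncated_avg_dist n j : (j <= n)%N ->
  Ex P (fun w => (gen_avg n (tphi n ^~ w) - gen_avg n (tphi j ^~ w)) ^+ 2) <=
  K ^+ 2 * B * r ^+ j.
Proof.
move=> jn; have [K0 phiK lip] := BL.
have k2 k : k \in gen n -> (2 ^ n <= k)%N by move=> /gen_bounds /andP[].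
have k2' k : k \in gen n -> (2 ^ j <= k)%N.
  by move=> /k2; apply: leq_trans; rewrite leq_exp2l.
have k3 k : k \in gen n -> (2 ^ (j + (n - j)) <= k)%N by move=> /k2; rewrite subnKC.
have s1 k : k \in gen n -> sq P (fun w => tphi n k w - tphi j k w).
  by move=> kn; apply: sqB; apply: phi_value_sq; auto.
apply: (@le_trans _ _ (Ex P (fun w => gen_avg n (fun k => (tphi n k w - tphi j k w) ^+ 2)))).
  have s2 := gen_avg_sq s1.
  apply: Ex_le.
  - case: s2 => _; apply: eq_integrable => // w _ /=.
    by rewrite gen_avgB.
  - have sF k : k \in gen n -> itg P (fun w => (tphi n k w - tphi j k w) ^+ 2).
      by move=> /s1 [].
    apply: itgZ; pose G k w := if k \in gen n then (tphi n k w - tphi j k w) ^+ 2 else 0.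
    have IG k : itg P (G k) by rewrite /G; case: (boolP (k \in gen n)) => kn; [exact: sF|exact: itg_cst].
    apply: eq_integrable (itg_sum (gen n) IG) => // w _ /=.
    by congr EFin; apply: eq_big_seq => k kn; rewrite /G kn.
  - by move=> w; rewrite -gen_avgB; exact: sqr_gen_avg_le.
rewrite Ex_gen_avg; last by move=> k /s1 [].
rewrite -[leRHS](gen_avg_const n); apply: gen_avg_le => k kn.
have [sD ED] := noise_value_diff_sq (k3 _ kn); rewrite subnKC// in sD ED.
apply: (@le_trans _ _ (Ex P (fun w => K ^+ 2 * (path_value zeta n k w - path_value zeta j k w) ^+ 2))).
  apply: Ex_le; [by case: (s1 _ kn)|by apply: itgZ; case: sD|move=> w].
  exact: bounded_lipschitz_sqr BL.
rewrite ExZ; last by case: sD.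
by rewrite -mulrA ler_wpM2l ?sqr_ge0// mulrC.
Qed.

Lemma half_bounds n :
  [/\ (n./2 <= n)%N, (n <= (2 * n./2).+1)%N & (n <= 2 * (n - n./2))%N].
Proof. by split; lia. Qed.

Theorem tree_lln :
  {ae P, forall w, gen_avg n (fun k => phi (path_value zeta n k w)) -
     gen_avg n (fun k => Ex P (fun w => phi (path_value zeta n k w))) @[n --> \oo] --> 0}.
Proof.
have [K0 phiK lip] := BL.
have r0 := tn_r0 H; have r1 := tn_r1 H; have B0 := noise_bound_ge0.
pose L n w := gen_avg n (tphi n ^~ w) - gen_avg n (fun k => Ex P (tphi n k)).
have k2 n k : k \in gen n -> (2 ^ n <= k)%N by move=> /gen_bounds /andP[].
have k2' n j k : (j <= n)%N -> k \in gen n -> (2 ^ j <= k)%N.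
  by move=> jn /k2; apply: leq_trans; rewrite leq_exp2l.
have sT n j : (j <= n)%N -> sq P (fun w => gen_avg n (tphi j ^~ w)).
  by move=> jn; apply: gen_avg_sq => k kn; apply: phi_value_sq; exact: k2' kn.
have IT n j k : (j <= n)%N -> k \in gen n -> itg P (tphi j k).
  by move=> jn kn; apply: sq_itg; apply: phi_value_sq; exact: k2' kn.
have sL n : sq P (L n) by apply: sqB; [exact: sT|exact: sq_cst].
(* [L] splits into three parts: the truncation error, minus its mean, and the centered truncated
   average. The first two have the same bound, whence [6 = 3 + 3]. *)
have main n j : (j <= n)%N -> Ex P (fun w => L n w ^+ 2) <=
   6 * (K ^+ 2 * B * r ^+ j) + 3 * (4 * K ^+ 2 * 2^-1 ^+ (n - j)).
  move=> jn.
  pose D w := gen_avg n (tphi n ^~ w) - gen_avg n (tphi j ^~ w).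
  pose M w := gen_avg n (fun k => tphi j k w - Ex P (tphi j k)).
  have sD : sq P D by apply: sqB; exact: sT.
  have sM : sq P M.
    have -> : M = (fun w => gen_avg n (tphi j ^~ w) - gen_avg n (fun k => Ex P (tphi j k))).
      by apply/funext => w; rewrite /M gen_avgB.
    by apply: sqB; [exact: sT|exact: sq_cst].
  have ED : Ex P D = gen_avg n (fun k => Ex P (tphi n k)) - gen_avg n (fun k => Ex P (tphi j k)).
    rewrite /D ExB; [|exact/sq_itg/sT|exact/sq_itg/sT].
    by rewrite !Ex_gen_avg// => k; exact: IT.
  have LE w : L n w = D w - Ex P D + M w.
    by rewrite /L ED /D /M gen_avgB; ring.
  have hD := truncated_avg_dist jn; have hM := truncated_avg_var jn.
  have hED : Ex P D ^+ 2 <= K ^+ 2 * B * r ^+ j.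
    by apply: le_trans hD; exact: sqr_Ex_le.
  apply: (@le_trans _ _ (3 * Ex P (fun w => D w ^+ 2) + 3 * Ex P D ^+ 2 + 3 * Ex P (fun w => M w ^+ 2))).
    have I1 := sD.2; have I2 := sM.2.
    have e : 3 * Ex P D ^+ 2 = Ex P (fun=> 3 * Ex P D ^+ 2) by rewrite Ex_cst.
    rewrite -ExZ// -[X in _ + _ + X]ExZ// e -ExD; [|exact: itgZ|exact: itg_cst].
    rewrite -ExD; [|by apply: itgD; [exact: itgZ|exact: itg_cst]|exact: itgZ].
    apply: Ex_le; first by case: (sL n).
      by apply: itgD; [apply: itgD; [exact: itgZ|exact: itg_cst]|exact: itgZ].
    move=> w; rewrite LE; move: (D w) (Ex P D) (M w) => x y z.
    by have := sqr_ge0 (x + y); have := sqr_ge0 (x - z); have := sqr_ge0 (y + z); nra.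
  rewrite /D in hED hD *; rewrite /M; lra.
have m2 : r <= Num.max r 2^-1 by rewrite le_max lexx.
have m3 : 2^-1 <= Num.max r 2^-1 by rewrite le_max lexx orbT.
(* Truncation at half the height balances [r ^ j] against [2^-1 ^ (n - j)]. Both are then powers of
   about [n / 2], and the square root absorbs the halving; the parity of [n] costs one factor
   [s^-1]. *)
pose s := Num.sqrt (Num.max r 2^-1).
have m0 : 0 < Num.max r 2^-1 by rewrite lt_max; apply/orP; right; lra.
have m1 : Num.max r 2^-1 < 1 by rewrite gt_max r1; lra.
have s0 : 0 < s by rewrite sqrtr_gt0.
have s1 : s < 1 by rewrite -sqrtr1 ltr_sqrt.
have s2 : s ^+ 2 = Num.max r 2^-1 by rewrite sqr_sqrtr// ltW.
have c1 : 0 <= K ^+ 2 * B by rewrite mulr_ge0 ?sqr_ge0.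
have c2 : 0 <= K ^+ 2 by rewrite sqr_ge0.
have : {ae P, forall w, L n w ^+ 2 @[n --> \oo] --> 0}.
  apply: (@geometric_Ex_cvg0 _ _ _ _ _ (6 * (K ^+ 2 * B) / s + 12 * K ^+ 2) s) => //.
  - by move=> n; case: (sL n).
  - by move=> n w; exact: sqr_ge0.
  - exact: ltW.
  - by apply: addr_ge0; [apply: divr_ge0; [exact: mulr_ge0|exact: ltW]|exact: mulr_ge0].
  move=> n; have [hf1 hf2 hf3] := half_bounds n; apply: (le_trans (main n n./2 hf1)).
  have s01 : s \in `[0, 1] by rewrite in_itv/= !ltW.
  have decr a b : (a <= b)%N -> s ^+ b <= s ^+ a.
    by move=> ab; rewrite ler_wiXn2l ?ltW.
  have h1 : r ^+ n./2 <= s ^+ n / s.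
    apply: (@le_trans _ _ ((s ^+ 2) ^+ n./2)).
      by rewrite s2 lerXn2r ?nnegrE ?(ltW m0).
    by rewrite ler_pdivlMr// -exprM -exprSr; exact: decr.
  have h2 : 2^-1 ^+ (n - n./2) <= s ^+ n.
    apply: (@le_trans _ _ ((s ^+ 2) ^+ (n - n./2))).
      by rewrite s2 lerXn2r ?nnegrE ?(ltW m0) ?invr_ge0.
    by rewrite -exprM; exact: decr.
  have := ler_wpM2l c1 h1; have := ler_wpM2l c2 h2.
  set u := r ^+ _; set v := 2^-1 ^+ _; set t := s ^+ n => q1 q2.
  have -> : (6 * (K ^+ 2 * B) / s + 12 * K ^+ 2) * t = 6 * (K ^+ 2 * B * (t / s)) + 12 * (K ^+ 2 * t).
    by field; exact: lt0r_neq0.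
  by lra.
apply: filterS => w Lw; apply/cvgr0Pnorm_lt => e e0.
have /cvgr0Pnorm_lt/(_ (e ^+ 2)) := Lw; rewrite exprn_gt0// => /(_ isT).
apply: filterS => n; rewrite normrX => h.
by rewrite -(ltr_pXn2r (n := 2)) ?nnegrE ?(ltW e0).
Qed.

End law_of_large_numbers.

Section initial_state.
Context {disp : measure_display} {Omega : measurableType disp} {R : realType}.
Variables (P : probability Omega R) (zeta : nat -> Omega -> R * R) (r V : R).
Hypothesis H : tree_noise P zeta r V.

Lemma cvg0_of_sqr (u : nat -> R) : u n ^+ 2 @[n --> \oo] --> 0 -> u n @[n --> \oo] --> 0.
Proof.
move=> u2; apply/cvgr0Pnorm_lt => e e0.
have /cvgr0Pnorm_lt/(_ (e ^+ 2)) := u2; rewrite exprn_gt0// => /(_ isT).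
apply: filterS => n; rewrite normrX => h.
by rewrite -(ltr_pXn2r (n := 2)) ?nnegrE ?(ltW e0).
Qed.

Lemma gen_ge n k : k \in gen n -> (2 ^ n <= k)%N.
Proof. by move=> /gen_bounds /andP[]. Qed.

Lemma path_coef_avg0 :
  {ae P, forall w, gen_avg n (fun k => `|path_coef zeta n k w|) @[n --> \oo] --> 0}.
Proof.
have sA n k : k \in gen n -> sq P (path_coef zeta n k).
  by move=> /gen_ge nk; have [/(sqJ_sq (tn_meas H))] := noise_coef_sq H nk.
have sN n k : k \in gen n -> sq P (fun w => `|path_coef zeta n k w|).
  move=> /sA [mA IA]; split; first exact: measurableT_comp.
  by apply: eq_integrable IA => // w _ /=; rewrite real_normK ?num_real.
have : {ae P, forall w, gen_avg n (fun k => `|path_coef zeta n k w|) ^+ 2 @[n --> \oo] --> 0}.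
  apply: (@geometric_Ex_cvg0 _ _ _ _ _ 1 r) => //.
  - by move=> n; have [] := gen_avg_sq (@sN n).
  - by move=> n w; exact: sqr_ge0.
  - exact: tn_r0 H.
  - exact: tn_r1 H.
  move=> n; rewrite mul1r.
  have I2 k : k \in gen n -> itg P (fun w => `|path_coef zeta n k w| ^+ 2).
    by move=> /sN [].
  apply: (@le_trans _ _ (Ex P (fun w => gen_avg n (fun k => `|path_coef zeta n k w| ^+ 2)))).
    apply: Ex_le; first by have [] := gen_avg_sq (@sN n).
      apply: itgZ; pose G k w := if k \in gen n then `|path_coef zeta n k w| ^+ 2 else 0.
      have IG k : itg P (G k).
        by rewrite /G; case: (boolP (k \in gen n)) => kn; [exact: I2|exact: itg_cst].
      apply: eq_integrable (itg_sum (gen n) IG) => // w _ /=.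
      by congr EFin; apply: eq_big_seq => k kn; rewrite /G kn.
    by move=> w; exact: sqr_gen_avg_le.
  rewrite Ex_gen_avg//.
  rewrite -[leRHS](gen_avg_const n); apply: gen_avg_le => k /gen_ge kn.
  have [_] := noise_coef_sq H kn; apply: le_trans.
  rewrite le_eqVlt; apply/orP; left; apply/eqP; apply: eq_Ex => w.
  by rewrite real_normK ?num_real.
by apply: filterS => w; exact: cvg0_of_sqr.
Qed.

Variable X : nat -> Omega -> R.
Hypothesis X_rec : forall k w, (1 < k)%N ->
  X k w = coef zeta k w * X k./2 w + innov zeta k w.

(** Along a trajectory [X 1] is a constant, and Lipschitz continuity pulls it out of the average,
    leaving the average of the moduli of [path_coef]. *)
Lemma avg_initial_state0 (K : R) (phi : R -> R) : bounded_lipschitz K phi ->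
  {ae P, forall w, gen_avg n (fun k => phi (X k w)) -
     gen_avg n (fun k => phi (path_value zeta n k w)) @[n --> \oo] --> 0}.
Proof.
move=> [K0 phiK lip]; have := path_coef_avg0; apply: filterS => w Aw.
have := seq_cvgZ (k := K * `|X 1%N w|) Aw; rewrite mulr0.
apply: cvgr0_le; apply: nearW => n.
rewrite -gen_avgB; apply: (le_trans (norm_gen_avg_le _ _)).
rewrite -gen_avgZ; apply: gen_avg_le => k kn.
rewrite (X_gen X_rec w kn); apply: (le_trans (lip _ _)).
by rewrite addrK normrM mulrAC mulrA.
Qed.

Lemma tree_lln_X (K : R) (phi : R -> R) : bounded_lipschitz K phi ->
  {ae P, forall w, gen_avg n (fun k => phi (X k w)) -
     gen_avg n (fun k => Ex P (fun w => phi (path_value zeta n k w))) @[n --> \oo] --> 0}.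
Proof.
move=> BL; have := tree_lln H BL; have := avg_initial_state0 BL.
apply: filterS2 => w h1 h2; have := seq_cvgD h1 h2; rewrite addr0.
apply: cvg_eq => n /=; ring.
Qed.

End initial_state.

(** * Sums of predictable weights times fresh noise *)

Section orthogonal_sums.
Context {disp : measure_display} {Omega : measurableType disp} {R : realType}.
Variables (P : probability Omega R) (zeta : nat -> Omega -> R * R) (r V : R).
Hypothesis H : tree_noise P zeta r V.

(** Predictable weights, independent of any [fresh] noise at the same node. The bound [U] depends on
    the node because it is used for weights that grow with the generation ([mart]) and for others
    that decay ([AX]). *)
Definition past (u : nat -> Omega -> R) (U : nat -> R) := forall k, (0 < k)%N ->
  sqJ P zeta (below k) (u k) /\ Ex P (fun w => u k w ^+ 2) <= U k.

Definition fresh (v : nat -> Omega -> R) (C : R) := forall k, (0 < k)%N ->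
  [/\ sqJ P zeta (node k) (v k), Ex P (v k) = 0 & Ex P (fun w => v k w ^+ 2) <= C].

Variables (u v : nat -> Omega -> R) (U : nat -> R) (C : R).
Hypotheses (hu : past u U) (hv : fresh v C).

Lemma orthogonal_term k : (0 < k)%N ->
  sqJ P zeta (below k.+1) (fun w => u k w * v k w) /\
  Ex P (fun w => (u k w * v k w) ^+ 2) <= U k * C.
Proof.
move=> k0; have [su Eu] := hu k0; have [sv _ Ev] := hv k0.
have [sd ->] := sqJM (J := below k.+1) (tn_meas H) (tn_indep H)
  (@below_noise k) (node_noise k0) (below_node k)
  (below_mono (leqnSn k)) (node_below (leqnn k.+1) k0) su sv.
by split => //; apply: ler_pM => //; apply: Ex_ge0 => w; exact: sqr_ge0.
Qed.

(** The partial sum times [u q] is a function of the noise before [q], and [v q] is centered and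
    independent of it: the new term is orthogonal to the sum of all earlier ones. *)
Lemma orthogonal_sum p q : (0 < p)%N -> (p <= q)%N ->
  sqJ P zeta (below q) (fun w => \sum_(p <= k < q) u k w * v k w) /\
  Ex P (fun w => (\sum_(p <= k < q) u k w * v k w) ^+ 2) <= (\sum_(p <= k < q) U k) * C.
Proof.
move=> p0; elim: q => [|q IHq] pq; first by lia.
move: pq; rewrite leq_eqVlt => /orP[/eqP <-|pq].
  under eq_fun do rewrite big_geq//; under [in X in _ /\ X]eq_fun do rewrite big_geq//.
  rewrite big_geq//; split; first by split; [exact: mJ_cst|exact: (@sq_cst _ _ _ P 0).2].
  by rewrite expr0n Ex_cst mul0r.
have q0 : (0 < q)%N by lia.
have [sS ES] := IHq pq; have [sd Ed] := orthogonal_term q0.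
have E0 : Ex P (fun w => (\sum_(p <= k < q) u k w * v k w) * (u q w * v q w)) = 0.
  have [su _] := hu q0; have [sv Ev _] := hv q0.
  have IS := sq_itgM (sqJ_sq (tn_meas H) sS) (sqJ_sq (tn_meas H) su).
  have [_] := noise_ExM H (@below_noise q) (node_noise q0) (below_node q)
    (mJM sS.1 su.1) sv.1 IS (sq_itg (sqJ_sq (tn_meas H) sv)).
  by rewrite Ev mulr0 => E'; rewrite -[RHS]E'; apply: eq_Ex => w; rewrite mulrA.
have sS' := sqJ_mono (below_mono (leqnSn q)) sS.
have e1 : (fun w => \sum_(p <= k < q.+1) u k w * v k w) =
  (fun w => (\sum_(p <= k < q) u k w * v k w) + u q w * v q w).
  by apply/funext => w; rewrite big_nat_recr.
have hS := sqJ_sq (tn_meas H) sS; have hd := sqJ_sq (tn_meas H) sd.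
split.
  rewrite e1; split; first by apply: mJD; [case: sS'|case: sd].
  by have [] := sqD hS hd.
have -> : (fun w => (\sum_(p <= k < q.+1) u k w * v k w) ^+ 2) =
  (fun w => ((\sum_(p <= k < q) u k w * v k w) + u q w * v q w) ^+ 2).
  by apply/funext => w; rewrite big_nat_recr.
by rewrite Ex_sqD// E0 mulr0 addr0 big_nat_recr//= mulrDl lerD.
Qed.

Lemma orthogonal_avg0 (K : R) : 0 <= K -> 0 <= C -> (forall k, (0 < k)%N -> U k <= K) ->
  {ae P, forall w, gen_avg n (fun k => u k w * v k w) @[n --> \oo] --> 0}.
Proof.
move=> K0 C0 UK.
have : {ae P, forall w, gen_avg n (fun k => u k w * v k w) ^+ 2 @[n --> \oo] --> 0}.
  have pn n : (0 < 2 ^ n)%N by rewrite expn_gt0.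
  have pnq n : (2 ^ n <= 2 ^ n.+1)%N by rewrite leq_exp2l.
  have c1 : 0 <= K * C by exact: mulr_ge0.
  apply: (@geometric_Ex_cvg0 _ _ _ _ _ (K * C) 2^-1) => //; [| |lra|].
  - move=> n; have [s _] := orthogonal_sum (pn n) (pnq n).
    have [_ I2] := sqJ_sq (tn_meas H) s.
    apply: eq_integrable (itgZ ((2 ^- n) ^+ 2) I2) => // w _ /=.
    by rewrite exprMn.
  - by move=> n w; exact: sqr_ge0.
  move=> n; have [s E] := orthogonal_sum (pn n) (pnq n).
  have [_ I2] := sqJ_sq (tn_meas H) s.
  have -> : (fun w => gen_avg n (fun k => u k w * v k w) ^+ 2) =
    (fun w => (2 ^- n) ^+ 2 * (\sum_(2 ^ n <= k < 2 ^ n.+1) u k w * v k w) ^+ 2).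
    by apply/funext => w; rewrite exprMn.
  rewrite ExZ//.
  apply: (@le_trans _ _ ((2 ^- n) ^+ 2 * ((\sum_(k <- gen n) K) * C))).
    rewrite ler_wpM2l ?sqr_ge0//; apply: (le_trans E); apply: ler_wpM2r => //.
    rewrite [leLHS]big_nat [leRHS]big_seq; rewrite [leRHS](eq_bigl (fun k => (2 ^ n <= k < 2 ^ n.+1)%N)); last by move=> k; rewrite mem_index_iota.
    by apply: ler_sum => k /andP[k1 _]; apply: UK; exact: leq_trans (pn n) k1.
  have := gen_avg_const n K; rewrite /gen_avg => E'.
  by rewrite expr2 -mulrA [X in _ * X]mulrA E' exprVn mulrC.
by apply: filterS => w; exact: cvg0_of_sqr.
Qed.

End orthogonal_sums.

(** * Growth of the scores *)

Section orthogonal_strong_law.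
Context {disp : measure_display} {Omega : measurableType disp} {R : realType}.
Variables (P : probability Omega R) (zeta : nat -> Omega -> R * R) (r V : R).
Hypothesis H : tree_noise P zeta r V.

Lemma trunc_log_gen n k : k \in gen n -> trunc_log 2 k = n.
Proof. by move=> /gen_bounds h; exact: trunc_log_eq. Qed.

Lemma pow_trunc_log_le k : (0 < k)%N -> (2 ^ trunc_log 2 k <= k)%N.
Proof. by move=> k0; exact: trunc_logP. Qed.

Lemma big_gen m N (F : nat -> R) : (m <= N)%N ->
  \sum_(m <= n < N) \sum_(k <- gen n) F k = \sum_(2 ^ m <= k < 2 ^ N) F k.
Proof.
elim: N => [|N IHN]; first by rewrite leqn0 => /eqP ->; rewrite !big_geq.
rewrite leq_eqVlt => /orP[/eqP <-|mN]; first by rewrite !big_geq.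
by rewrite big_nat_recr//= IHN// -big_cat_nat//= leq_exp2l.
Qed.

(** Weights of second moment of order [2 ^ n] are tailored to [mart]. The average over generation
    [n] then has second moment at most [2 ^- (2 * n) * (2 ^ n * (K * 2 ^ n) * C) = K * C], and
    distinct generations are orthogonal, so [strong_law] applies to the sequence of averages. *)
Lemma orthogonal_strong_law (u v : nat -> Omega -> R) (C K : R) : 0 <= C -> 0 <= K ->
  past P zeta u (fun k => K * 2 ^+ trunc_log 2 k) -> fresh P zeta v C ->
  {ae P, forall w,
    N%:R^-1 * (\sum_(0 <= n < N) gen_avg n (fun k => u k w * v k w)) @[N --> \oo] --> 0}.
Proof.
move=> C0 K0 hu hv.
pose u' k w := 2 ^- trunc_log 2 k * u k w.
pose U' k := K * 2 ^- trunc_log 2 k.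
have hu' : past P zeta u' U'.
  move=> k k0; have [su Eu] := hu k k0; split.
    split; first by apply: mJM; [exact: mJ_cst|case: su].
    by have [] := sqZ (2 ^- trunc_log 2 k) (sqJ_sq (tn_meas H) su).
  have -> : (fun w => u' k w ^+ 2) = (fun w => (2 ^- trunc_log 2 k) ^+ 2 * u k w ^+ 2).
    by apply/funext => w; rewrite exprMn.
  rewrite ExZ; last by case: su.
  apply: (@le_trans _ _ ((2 ^- trunc_log 2 k) ^+ 2 * (K * 2 ^+ trunc_log 2 k))).
    by rewrite ler_wpM2l ?sqr_ge0.
  rewrite le_eqVlt; apply/orP; left; apply/eqP; rewrite /U'; field.
  by rewrite expf_neq0.
have avgE n w : gen_avg n (fun k => u k w * v k w) = \sum_(k <- gen n) u' k w * v k w.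
  rewrite /gen_avg mulr_sumr; apply: eq_big_seq => k kn.
  by rewrite /u' (trunc_log_gen kn) mulrA.
have pn n : (0 < 2 ^ n)%N by rewrite expn_gt0.
have sumE m N w : (m <= N)%N -> \sum_(m <= n < N) gen_avg n (fun k => u k w * v k w) =
    \sum_(2 ^ m <= k < 2 ^ N) u' k w * v k w.
  by move=> mN; rewrite -big_gen//; apply: eq_bigr => n _; rewrite avgE.
have le2 m N : (m <= N)%N -> (2 ^ m <= 2 ^ N)%N by move=> mN; rewrite leq_exp2l.
apply: (@strong_law _ _ _ _ _ (K * C)); first exact: mulr_ge0.
  move=> n.
  have [s _] := orthogonal_sum H hu' hv (pn n) (le2 _ _ (leqnSn n)).
  have -> : (fun w => gen_avg n (fun k => u k w * v k w)) =
    (fun w => \sum_(2 ^ n <= k < 2 ^ n.+1) u' k w * v k w).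
    by apply/funext => w; rewrite avgE.
  exact: (sqJ_sq (tn_meas H) s).
move=> m N mN; have [_ E] := orthogonal_sum H hu' hv (pn m) (le2 _ _ mN).
have -> : (fun w => (\sum_(m <= n < N) gen_avg n (fun k => u k w * v k w)) ^+ 2) =
    (fun w => (\sum_(2 ^ m <= k < 2 ^ N) u' k w * v k w) ^+ 2).
  by apply/funext => w; rewrite sumE.
apply: (le_trans E); rewrite -big_gen//.
have -> : \sum_(m <= n < N) \sum_(k <- gen n) U' k = \sum_(m <= n < N) K.
  apply: eq_bigr => n _; rewrite -[RHS](gen_avg_const n) /gen_avg mulr_sumr.
  by apply: eq_big_seq => k kn; rewrite /U' (trunc_log_gen kn) mulrC.
by rewrite sumr_const_nat -[K *+ _]mulr_natr mulrAC.
Qed.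

End orthogonal_strong_law.

Section quadratic_law.
Context {disp : measure_display} {Omega : measurableType disp} {R : realType}.
Variables (P : probability Omega R) (zeta : nat -> Omega -> R * R) (r V : R).
Hypothesis H : tree_noise P zeta r V.

(** The process [N_k] of the overview, [trunc_log 2 k] being the generation of [k]. It is indexed by
    the node alone, as sums across generations require. *)
Definition Xt (k : nat) (w : Omega) : R := path_value zeta (trunc_log 2 k) k w.

Lemma Xt_gen n k w : k \in gen n -> Xt k w = path_value zeta n k w.
Proof. by move=> kn; rewrite /Xt (trunc_log_gen kn). Qed.

Lemma Xt_mJ k : (0 < k)%N -> mJ zeta (below k) (Xt k).
Proof.
move=> k0; have h := pow_trunc_log_le k0.
have [[m _] _] := noise_value_sq H h.
exact: (mJ_mono (path_nodes_below h) m).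
Qed.

Lemma past_bounded (K : R) (phi : R -> R) (u : nat -> Omega -> R) (U : nat -> R) :
  bounded_lipschitz K phi -> past P zeta u U ->
  past P zeta (fun k w => u k w * phi (Xt k w)) (fun k => K ^+ 2 * U k).
Proof.
move=> BL hu k k0; have [su Eu] := hu k k0; have [K0 phiK _] := BL.
have mphi : mJ zeta (below k) (fun w => phi (Xt k w)).
  by apply: mJ_comp; [exact: bounded_lipschitz_measurable BL|exact: Xt_mJ].
have m2 := mJM su.1 mphi.
have le w : (u k w * phi (Xt k w)) ^+ 2 <= K ^+ 2 * u k w ^+ 2.
  rewrite exprMn mulrC ler_wpM2r ?sqr_ge0//.
  by rewrite -[leLHS]real_normK ?num_real// lerXn2r ?nnegrE.
have I2 : itg P (fun w => (u k w * phi (Xt k w)) ^+ 2).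
  apply: itg_le (itgZ (K ^+ 2) su.2) _.
    by apply: measurable_funX; exact: (mJ_mf (tn_meas H) m2).
  by move=> w; rewrite ger0_norm ?sqr_ge0.
split; first by split.
apply: (@le_trans _ _ (Ex P (fun w => K ^+ 2 * u k w ^+ 2))).
  by apply: Ex_le => //; apply: itgZ; case: su.
by rewrite ExZ; [rewrite ler_wpM2l ?sqr_ge0|case: su].
Qed.

Lemma past1 : past P zeta (fun _ _ => 1) (fun=> 1).
Proof.
move=> k k0; split; last by rewrite expr1n Ex_cst.
by split; [exact: mJ_cst|exact: (@sq_cst _ _ _ P 1).2].
Qed.

Lemma past_phi (K : R) (phi : R -> R) : bounded_lipschitz K phi ->
  past P zeta (fun k w => phi (Xt k w)) (fun=> K ^+ 2).
Proof.
move=> BL k k0; have := past_bounded BL past1 k0.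
by under eq_fun do rewrite mul1r; under [in X in _ /\ X]eq_fun do rewrite mul1r; rewrite mulr1.
Qed.

(* A centered noise pair attached to the nodes: [al] is a function of the
   coefficients and [be] of the innovations, hence they are independent. *)
Record centered_pair (al be : nat -> Omega -> R) (sa sb M : R) : Prop := CenteredPair {
  cp_al : forall k, (0 < k)%N -> mJ zeta [set k.*2] (al k);
  cp_be : forall k, (0 < k)%N -> mJ zeta [set k.*2.+1] (be k);
  cp_al4 : forall k, (0 < k)%N -> itg P (fun w => al k w ^+ 4) /\ Ex P (fun w => al k w ^+ 4) <= M;
  cp_be4 : forall k, (0 < k)%N -> itg P (fun w => be k w ^+ 4) /\ Ex P (fun w => be k w ^+ 4) <= M;
  cp_Eal : forall k, (0 < k)%N -> Ex P (al k) = 0;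
  cp_Ebe : forall k, (0 < k)%N -> Ex P (be k) = 0;
  cp_Eal2 : forall k, (0 < k)%N -> Ex P (fun w => al k w ^+ 2) = sa;
  cp_Ebe2 : forall k, (0 < k)%N -> Ex P (fun w => be k w ^+ 2) = sb
}.

Variables (al be : nat -> Omega -> R) (sa sb M : R).
Hypothesis Hab : centered_pair al be sa sb M.

Lemma node_even k : [set k.*2] `<=` node k.
Proof. by move=> _ ->; rewrite /node/= doubleK. Qed.

Lemma node_odd k : [set k.*2.+1] `<=` node k.
Proof. by move=> _ ->; rewrite /node/= uphalf_double. Qed.

Lemma sq_of_pow4 J (x : Omega -> R) : mJ zeta J x -> itg P (fun w => x w ^+ 4) ->
  sqJ P zeta J x /\ sqJ P zeta J (fun w => x w ^+ 2).
Proof.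
move=> mx I4; have mx2 := mJX 2 mx.
have I22 : itg P (fun w => (x w ^+ 2) ^+ 2).
  by apply: eq_integrable I4 => // w _ /=; rewrite -exprM.
split; split => //; apply: sq_itg; split => //; exact: (mJ_mf (tn_meas H) mx2).
Qed.

Lemma fresh_sub J (x : nat -> Omega -> R) C : (forall k, J k `<=` node k) ->
  (forall k, (0 < k)%N -> [/\ sqJ P zeta (J k) (x k), Ex P (x k) = 0 &
    Ex P (fun w => x k w ^+ 2) <= C]) -> fresh P zeta x C.
Proof.
by move=> Jn h k k0; have [s E0 E2] := h k k0; split => //; exact: (sqJ_mono (Jn k) s).
Qed.

Lemma fresh_al : fresh P zeta al sa.
Proof.
apply: (fresh_sub node_even) => k k0; split.
- by have [] := sq_of_pow4 (cp_al Hab k0) (cp_al4 Hab k0).1.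
- exact: (cp_Eal Hab k0).
- by rewrite (cp_Eal2 Hab k0).
Qed.

Lemma fresh_be : fresh P zeta be sb.
Proof.
apply: (fresh_sub node_odd) => k k0; split.
- by have [] := sq_of_pow4 (cp_be Hab k0) (cp_be4 Hab k0).1.
- exact: (cp_Ebe Hab k0).
- by rewrite (cp_Ebe2 Hab k0).
Qed.

(** Fourth moments serve here to bound the variance of the centered squares, which makes them fresh
    noise to which [orthogonal_avg0] applies. *)
Lemma fresh_centered_sqr J (x : nat -> Omega -> R) (s : R) : (forall k, J k `<=` node k) ->
  (forall k, (0 < k)%N -> mJ zeta (J k) (x k)) ->
  (forall k, (0 < k)%N -> itg P (fun w => x k w ^+ 4) /\ Ex P (fun w => x k w ^+ 4) <= M) ->
  (forall k, (0 < k)%N -> Ex P (fun w => x k w ^+ 2) = s) ->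
  fresh P zeta (fun k w => x k w ^+ 2 - s) (2 * M + 2 * s ^+ 2).
Proof.
move=> Jn mx x4 Ex2; apply: (fresh_sub Jn) => k k0.
have [_ s2] := sq_of_pow4 (mx k k0) (x4 k k0).1; have S2 := sqJ_sq (tn_meas H) s2.
have sc := @sq_cst _ _ _ P (- s).
have hD := sqD S2 sc.
split.
- by split; [apply: mJB; [case: s2|exact: mJ_cst]|case: hD].
- by rewrite ExB; [rewrite Ex2// Ex_cst subrr|exact: sq_itg|exact: itg_cst].
- apply: (le_trans (Ex_sqD_le S2 sc)); rewrite Ex_cst sqrrN lerD2r ler_wpM2l//.
  apply: le_trans (x4 k k0).2; rewrite le_eqVlt; apply/orP; left; apply/eqP.
  by apply: eq_Ex => w; rewrite -exprM.
Qed.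

(** Independence of coefficients and innovations makes the product centered, which is why no mixed
    term appears in the limit of the squared increments. *)
Lemma fresh_product : fresh P zeta (fun k w => al k w * be k w) (sa * sb).
Proof.
move=> k k0.
have [s1 _] := sq_of_pow4 (cp_al Hab k0) (cp_al4 Hab k0).1.
have [s2 _] := sq_of_pow4 (cp_be Hab k0) (cp_be4 Hab k0).1.
have d : [set k.*2] `&` [set k.*2.+1] = set0 :> set nat.
  by apply/seteqP; split => // i [/= -> /eqP]; rewrite eqn_leq ltnn andbF.
have n1 := subset_trans (@node_even k) (node_noise k0).
have n2 := subset_trans (@node_odd k) (node_noise k0).
have [s E2] := sqJM (tn_meas H) (tn_indep H) n1 n2 d (@node_even k) (@node_odd k) s1 s2.
have [_ E] := noise_ExM H n1 n2 d s1.1 s2.1 (sq_itg (sqJ_sq (tn_meas H) s1)) (sq_itg (sqJ_sq (tn_meas H) s2)).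
split => //.
  by rewrite E (cp_Eal Hab k0) mul0r.
by rewrite E2 (cp_Eal2 Hab k0) (cp_Ebe2 Hab k0).
Qed.

Lemma variances_ge0 : [/\ 0 <= sa, 0 <= sb & 0 <= M].
Proof.
split.
- by rewrite -(cp_Eal2 Hab (ltn0Sn 0)); apply: Ex_ge0 => w; exact: sqr_ge0.
- by rewrite -(cp_Ebe2 Hab (ltn0Sn 0)); apply: Ex_ge0 => w; exact: sqr_ge0.
- apply: le_trans (cp_al4 Hab (ltn0Sn 0)).2; apply: Ex_ge0 => w.
  by rewrite exprn_even_ge0.
Qed.

Variables (K : R) (g f : R -> R).
Hypotheses (BLg : bounded_lipschitz K g) (BLf : bounded_lipschitz K f).

(** The pair [(g, f)] will be [(1 - pw, qw)] for the score of the coefficients, [(qw, pw)] for that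
    of the constants, and their sum for polarization. *)
Definition increment (k : nat) (w : Omega) : R :=
  g (Xt k w) * al k w + f (Xt k w) * be k w.

Definition mart (q : nat) (w : Omega) : R := \sum_(1 <= k < q) increment k w.

Lemma mart_sq q : (0 < q)%N -> sqJ P zeta (below q) (mart q) /\
  Ex P (fun w => mart q w ^+ 2) <= 2 * K ^+ 2 * (sa + sb) * q%:R.
Proof.
move=> q0; have [sa0 sb0 _] := variances_ge0.
have [sA EA] := orthogonal_sum H (past_phi BLg) fresh_al (ltn0Sn 0) q0.
have [sB EB] := orthogonal_sum H (past_phi BLf) fresh_be (ltn0Sn 0) q0.
have e : mart q = (fun w => \sum_(1 <= k < q) g (Xt k w) * al k w +
    \sum_(1 <= k < q) f (Xt k w) * be k w).
  by apply/funext => w; rewrite /mart -big_split.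
have hA := sqJ_sq (tn_meas H) sA; have hB := sqJ_sq (tn_meas H) sB.
rewrite e; split.
  split; first by apply: mJD; [case: sA|case: sB].
  by have [] := sqD hA hB.
apply: (le_trans (Ex_sqD_le hA hB)).
have sumK : \sum_(1 <= k < q) K ^+ 2 <= K ^+ 2 * q%:R.
  rewrite sumr_const_nat -[leLHS]mulr_natr ler_wpM2l ?sqr_ge0// ler_nat; lia.
have := le_trans EA (ler_wpM2r sa0 sumK); have := le_trans EB (ler_wpM2r sb0 sumK).
move: (Ex P _) (Ex P _) => x y; move: (q%:R : R) => t; nra.
Qed.

Lemma past_mart :
  past P zeta mart (fun k => 4 * K ^+ 2 * (sa + sb) * 2 ^+ trunc_log 2 k).
Proof.
have [sa0 sb0 _] := variances_ge0.
move=> k k0; have [s E] := mart_sq k0; split => //; apply: (le_trans E).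
have h : k%:R <= 2 * 2 ^+ trunc_log 2 k :> R.
  by rewrite -exprS -natrX ler_nat ltnW// trunc_log_ltn.
have c : 0 <= 2 * K ^+ 2 * (sa + sb) by apply: mulr_ge0; [apply: mulr_ge0 => //; exact: sqr_ge0|exact: addr_ge0].
apply: (le_trans (ler_wpM2l c h)); rewrite le_eqVlt; apply/orP; left; apply/eqP.
by ring.
Qed.

Lemma mart_cross0 : {ae P, forall w,
  N%:R^-1 * (\sum_(0 <= n < N) gen_avg n (fun k => mart k w * increment k w))
    @[N --> \oo] --> 0}.
Proof.
have [sa0 sb0 _] := variances_ge0.
have c : 0 <= 4 * K ^+ 2 * (sa + sb) by apply: mulr_ge0; [apply: mulr_ge0 => //; exact: sqr_ge0|exact: addr_ge0].
have part phi x s : bounded_lipschitz K phi -> fresh P zeta x s -> 0 <= s ->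
  {ae P, forall w, N%:R^-1 * (\sum_(0 <= n < N)
     gen_avg n (fun k => mart k w * phi (Xt k w) * x k w)) @[N --> \oo] --> 0}.
  move=> BL fx s0.
  have hp : past P zeta (fun k w => mart k w * phi (Xt k w))
      (fun k => K ^+ 2 * (4 * K ^+ 2 * (sa + sb)) * 2 ^+ trunc_log 2 k).
    by move=> k k0; have := past_bounded BL past_mart k0; rewrite mulrA.
  by apply: (orthogonal_strong_law H s0 _ hp fx); rewrite mulr_ge0 ?sqr_ge0.
have := part _ _ _ BLf fresh_be sb0; have := part _ _ _ BLg fresh_al sa0.
apply: filterS2 => w h1 h2; have := seq_cvgD h1 h2; rewrite addr0.
apply: cvg_eq => N; rewrite -mulrDr -big_split/=; congr (_ * _).
apply: eq_bigr => n _; rewrite -gen_avgD; apply: eq_gen_avg => k _.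
by rewrite /increment; ring.
Qed.

Lemma increment_sqr_avg : {ae P, forall w,
  gen_avg n (fun k => increment k w ^+ 2) -
  gen_avg n (fun k => sa * g (Xt k w) ^+ 2 + sb * f (Xt k w) ^+ 2) @[n --> \oo] --> 0}.
Proof.
have [sa0 sb0 M0] := variances_ge0.
have part phi psi x s : bounded_lipschitz K phi -> bounded_lipschitz K psi ->
  fresh P zeta x s -> 0 <= s ->
  {ae P, forall w, gen_avg n (fun k => phi (Xt k w) * psi (Xt k w) * x k w) @[n --> \oo] --> 0}.
  move=> BL1 BL2 fx s0.
  apply: (orthogonal_avg0 H (past_bounded BL2 (past_phi BL1)) fx (mulr_ge0 (sqr_ge0 K) (sqr_ge0 K)) s0).
  by [].
have c s : 0 <= 2 * M + 2 * s ^+ 2 by have := sqr_ge0 s; lra.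
have p1 := part _ _ _ _ BLg BLg (fresh_centered_sqr node_even (cp_al Hab) (cp_al4 Hab) (cp_Eal2 Hab)) (c _).
have p2 := part _ _ _ _ BLf BLf (fresh_centered_sqr node_odd (cp_be Hab) (cp_be4 Hab) (cp_Ebe2 Hab)) (c _).
have p3 := part _ _ _ _ BLg BLf fresh_product (mulr_ge0 sa0 sb0).
move: p1 p2 p3; apply: filterS3 => w h1 h2 h3.
have := seq_cvgD (seq_cvgD h1 h2) (seq_cvgZ (k := 2) h3); rewrite mulr0 !addr0.
apply: cvg_eq => n; rewrite -gen_avgZ -!gen_avgD -gen_avgB.
by apply: eq_gen_avg => k _; rewrite /increment; ring.
Qed.

Definition normalized_sqr n w := mart (2 ^ n) w ^+ 2 / 2 ^+ n.

(** The square of [mart] is expanded node by node, not generation by generation: [mart k] is the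
    partial sum up to node [k], so each cross term is already a predictable weight times fresh
    noise, and only the diagonal squares remain. *)
Lemma normalized_sqr_rec n w : normalized_sqr n.+1 w = normalized_sqr n w / 2 +
  (gen_avg n (fun k => mart k w * increment k w) + gen_avg n (fun k => increment k w ^+ 2) / 2).
Proof.
have step p q : (0 < p)%N -> (p <= q)%N -> mart q w ^+ 2 = mart p w ^+ 2 +
    2 * (\sum_(p <= k < q) mart k w * increment k w) + \sum_(p <= k < q) increment k w ^+ 2.
  move=> p0; elim: q => [|q IHq]; first by lia.
  rewrite leq_eqVlt => /orP[/eqP <-|pq]; first by rewrite !big_geq//; ring.
  rewrite !(big_nat_recr q)//= /mart big_nat_recr /=; last by lia.
  by have := IHq pq; rewrite /mart => h; rewrite sqrrD h; ring.
rewrite /normalized_sqr (step (2 ^ n)%N (2 ^ n.+1)%N) ?expn_gt0 ?leq_exp2l//.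
rewrite /gen_avg /gen [2 ^+ n.+1]exprS.
move: (\sum_(_ <= _ < _) _) (\sum_(_ <= _ < _) _) (mart _ w) => x y z; field.
by rewrite expf_neq0.
Qed.

Let q2 x := sa * g x ^+ 2 + sb * f x ^+ 2.

Lemma q2_bounded x : `|q2 x| <= (sa + sb) * K ^+ 2.
Proof.
have [sa0 sb0 _] := variances_ge0.
have [_ gK _] := BLg; have [_ fK _] := BLf.
have h1 : g x ^+ 2 <= K ^+ 2 by rewrite -[leLHS]real_normK ?num_real// lerXn2r ?nnegrE ?(le_trans _ (gK x)).
have h2 : f x ^+ 2 <= K ^+ 2 by rewrite -[leLHS]real_normK ?num_real// lerXn2r ?nnegrE ?(le_trans _ (fK x)).
rewrite ger0_norm; last by rewrite addr_ge0// mulr_ge0// sqr_ge0.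
by have := ler_wpM2l sa0 h1; have := ler_wpM2l sb0 h2; rewrite /q2; lra.
Qed.

(** Since the cross terms average to 0, each of them is [o(n)] by [avg_term0]. The squares enter
    through the bound on [q2] alone, as no limit law is available at this point. *)
Theorem normalized_sqr_sublinear :
  {ae P, forall w, normalized_sqr n w / n.+1%:R @[n --> \oo] --> 0}.
Proof.
have := mart_cross0; have := increment_sqr_avg; apply: filterS2 => w h1 h2.
apply: half_rec_div (fun n => normalized_sqr_rec n w) _.
have inv0 := @cvg_invn R.
have h3 : gen_avg n (fun k => q2 (Xt k w)) / n.+1%:R @[n --> \oo] --> 0.
  have := seq_cvgZ (k := (sa + sb) * K ^+ 2) inv0; rewrite mulr0; apply: cvgr0_le.
  apply: nearW => n; rewrite normrM normfV normr_nat ler_wpM2r ?invr_ge0//.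
  apply: (le_trans (norm_gen_avg_le _ _)); rewrite -[leRHS](gen_avg_const n).
  by apply: gen_avg_le => k _; exact: q2_bounded.
have h4 := seq_cvgM h1 inv0; rewrite mul0r in h4.
have := seq_cvgD (avg_term0 h2) (seq_cvgZ (k := 2^-1) (seq_cvgD h4 h3)).
rewrite addr0 mulr0 addr0; apply: cvg_eq => n.
by rewrite /q2; ring.
Qed.

Theorem normalized_sqr_avg (l : R) :
  {ae P, forall w, gen_avg n (fun k => q2 (Xt k w)) @[n --> \oo] --> l} ->
  {ae P, forall w, n%:R^-1 * (\sum_(0 <= k < n) normalized_sqr k.+1 w) @[n --> \oo] --> l}.
Proof.
have := mart_cross0; have := increment_sqr_avg; apply: filterS3 => w h1 h2 h3.
have -> : l = 2 * (0 + 2^-1 * l) by rewrite add0r mulrA mulfV ?mul1r.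
apply: half_rec_avg (fun n => normalized_sqr_rec n w) _.
have h4 := seq_cvgD h1 h3; rewrite add0r in h4.
have h5 := cesaro_mean h4.
have := seq_cvgD h2 (seq_cvgZ (k := 2^-1) h5); apply: cvg_eq => n.
rewrite mulrCA -mulrDr mulr_sumr -big_split/=; congr (_ * _).
by apply: eq_bigr => k _; rewrite subrK mulrC.
Qed.

End quadratic_law.

(** * Uniformity in the initial state by dyadic chaining *)

Section dyadic_chaining.
Context {R : realType}.

(** Cauchy-Schwarz with weights [(3 / 2) ^+ j], the constant 3 being the sum of the powers of 2/3.
    The ratio 3/2 is less than 2, the rate at which the squared increments of the dyadic levels will
    decay. *)
Lemma weighted_sum_sqr (c : nat -> R) J :
  (\sum_(0 <= j < J) c j) ^+ 2 <= 3 * \sum_(0 <= j < J) (3 / 2) ^+ j * c j ^+ 2.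
Proof.
elim: J c => [|J IHJ] c; first by rewrite !big_geq// expr0n mulr0.
rewrite !big_nat_recl//= expr0 mul1r.
have := IHJ (fun j => c j.+1).
under [X in _ -> _ <= 3 * (_ + X)]eq_bigr do rewrite exprS -mulrA.
rewrite -mulr_sumr.
move: (\sum_(0 <= i < J) c i.+1) (\sum_(0 <= i < J) _ * _) (c 0%N) => y z x h.
by have := sqr_ge0 (2 * x - y); nra.
Qed.

(** The right-hand side does not depend on [x]. The dyadic approximation of [x] from below moves at
    each level by nothing or by one dyadic step, whose square is at most the sum over all steps of
    that level; the Lipschitz bound covers what is left below level [J]. *)
Lemma dyadic_chaining (D : R -> R) (Lam x : R) (N J : nat) : 0 <= Lam ->
  (forall y z, `|D y - D z| <= Lam * `|y - z|) -> 0 <= x -> x < N%:R ->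
  (D x - D 0) ^+ 2 <= 3 * \sum_(0 <= i < N) (D i%:R - D 0) ^+ 2 +
   9 * \sum_(0 <= j < J) (3 / 2) ^+ j *
       (\sum_(0 <= i < N * 2 ^ j) (D (i.*2.+1%:R / 2 ^+ j.+1) - D (i%:R / 2 ^+ j)) ^+ 2) +
   3 * (Lam ^+ 2 * (2 ^- J) ^+ 2).
Proof.
move=> L0 lip x0 xN.
pose ix j := Num.truncn (2 ^+ j * x); pose p j : R := (ix j)%:R / 2 ^+ j.
have e0 j : (0 : R) < 2 ^+ j by rewrite exprn_gt0.
have ixP j : (ix j)%:R <= 2 ^+ j * x < (ix j).+1%:R.
  by apply: truncn_itv; rewrite mulr_ge0// ltW.
have ixN j : (ix j < N * 2 ^ j)%N.
  have /andP[h1 _] := ixP j; rewrite -(ltr_nat R) natrM natrX.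
  by apply: (le_lt_trans h1); rewrite mulrC ltr_pM2r.
have ixS j : ix j.+1 = (ix j).*2 \/ ix j.+1 = (ix j).*2.+1.
  have /andP[h1 h2] := ixP j; have /andP[h3 h4] := ixP j.+1.
  have q1 : ((ix j).*2 < (ix j.+1).+1)%N.
    rewrite -(ltr_nat R); apply: le_lt_trans h4; rewrite exprS -mul2n natrM -mulrA.
    by rewrite ler_wpM2l.
  have q2 : (ix j.+1 < (ix j).+1.*2)%N.
    rewrite -(ltr_nat R); apply: (le_lt_trans h3); rewrite exprS -mul2n natrM -mulrA.
    by rewrite ltr_pM2l.
  by lia.
have tel : D x - D 0 = (D (p 0%N) - D 0) + (\sum_(0 <= j < J) (D (p j.+1) - D (p j)) + (D x - D (p J))).
  by rewrite telescope_sumr//; ring.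
have t1 : (D (p 0%N) - D 0) ^+ 2 <= \sum_(0 <= i < N) (D i%:R - D 0) ^+ 2.
  rewrite (bigD1_seq (ix 0%N)) ?iota_uniq//=; last first.
    by rewrite mem_index_iota/=; have := ixN 0%N; rewrite expn0 muln1.
  by rewrite /p expr0 divr1 lerDl sumr_ge0// => i _; exact: sqr_ge0.
have t2 j : (D (p j.+1) - D (p j)) ^+ 2 <=
   \sum_(0 <= i < N * 2 ^ j) (D (i.*2.+1%:R / 2 ^+ j.+1) - D (i%:R / 2 ^+ j)) ^+ 2.
  have s0 : 0 <= \sum_(0 <= i < N * 2 ^ j) (D (i.*2.+1%:R / 2 ^+ j.+1) - D (i%:R / 2 ^+ j)) ^+ 2.
    by apply: sumr_ge0 => i _; exact: sqr_ge0.
  have [E|E] := ixS j.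
    have -> : p j.+1 = p j; last by rewrite subrr expr0n.
    rewrite /p E -mul2n natrM exprS; field; exact: lt0r_neq0.
  rewrite (bigD1_seq (ix j)) ?iota_uniq//=; last by rewrite mem_index_iota ixN.
  by rewrite /p E lerDl sumr_ge0// => i _; exact: sqr_ge0.
have t3 : (D x - D (p J)) ^+ 2 <= Lam ^+ 2 * (2 ^- J) ^+ 2.
  have h : `|D x - D (p J)| <= Lam * 2 ^- J.
    apply: (le_trans (lip _ _)); apply: ler_wpM2l => //.
    have /andP[h1 h2] := ixP J.
    have -> : x - p J = (2 ^+ J * x - (ix J)%:R) / 2 ^+ J.
      by rewrite /p; field; exact: lt0r_neq0.
    rewrite normrM normfV (ger0_norm (ltW (e0 J))) ger0_norm ?subr_ge0//.
    rewrite -[leRHS]mul1r ler_wpM2r ?invr_ge0 ?(ltW (e0 J))//.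
    by rewrite lerBlDr nat1r; exact: ltW.
  rewrite -exprMn -[leLHS]real_normK ?num_real// lerXn2r ?nnegrE//.
  by rewrite mulr_ge0// invr_ge0 ltW.
have t4 : (\sum_(0 <= j < J) (D (p j.+1) - D (p j))) ^+ 2 <=
    3 * \sum_(0 <= j < J) (3 / 2) ^+ j * (\sum_(0 <= i < N * 2 ^ j)
      (D (i.*2.+1%:R / 2 ^+ j.+1) - D (i%:R / 2 ^+ j)) ^+ 2).
  apply: (le_trans (weighted_sum_sqr _ _)); rewrite ler_wpM2l//.
  apply: ler_sum => j _; apply: ler_wpM2l; last exact: t2.
  by rewrite exprn_ge0// divr_ge0.
rewrite tel; move: t1 t3 t4.
move: (D (p 0%N) - D 0) (\sum_(0 <= j < J) (D (p j.+1) - D (p j))) (D x - D (p J)) => a b c.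
move: (\sum_(_ <= _ < N) _) (\sum_(_ <= _ < J) _) (Lam ^+ 2 * _) => A B C t1 t3 t4.
by have := sqr_ge0 (a - b); have := sqr_ge0 (a - c); have := sqr_ge0 (b - c); nra.
Qed.

End dyadic_chaining.

Section anticipating_initial_state.
Context {disp : measure_display} {Omega : measurableType disp} {R : realType}.
Variables (P : probability Omega R) (zeta : nat -> Omega -> R * R) (r V : R).
Hypothesis H : tree_noise P zeta r V.

Definition AX (k : nat) (w : Omega) : R := path_coef zeta (trunc_log 2 k) k w.

Lemma past_AX : past P zeta AX (fun k => r ^+ trunc_log 2 k).
Proof.
move=> k k0; have h := pow_trunc_log_le k0; have [s E] := noise_coef_sq H h.
by split => //; exact: (sqJ_mono (path_nodes_below h) s).
Qed.

Variables (K : R) (phi : R -> R) (v : nat -> Omega -> R) (C : R).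
Hypotheses (BL : bounded_lipschitz K phi) (C0 : 0 <= C) (hv : fresh P zeta v C).

(** One of the two sums of the score, as a function of the initial state: [y = X 1 w] gives the
    process [X], and [y = 0] gives [Xt]. *)
Definition flow_sum (n : nat) (y : R) (w : Omega) : R :=
  \sum_(1 <= k < 2 ^ n) phi (AX k w * y + Xt zeta k w) * v k w.

(** The value 3/4 is what closes the induction of [sum_path_rate], which needs
    [2 + 1 <= 2 * (2 * rho)]. *)
Let rho := Num.max r (3 / 4).

Let pn n : (1 <= 2 ^ n)%N.
Proof. by rewrite expn_gt0. Qed.

Lemma rho_bounds : [/\ r <= rho, 3 / 4 <= rho & rho < 1].
Proof.
rewrite /rho !le_max !lexx orbT /=; split => //.
by rewrite gt_max (tn_r1 H)/=; lra.
Qed.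

Lemma sum_path_rate n : \sum_(1 <= k < 2 ^ n) r ^+ trunc_log 2 k <= 2 * (2 * rho) ^+ n.
Proof.
have [h1 h2 h3] := rho_bounds; have h0 := tn_r0 H.
rewrite -{1}(expn0 2) -big_gen//.
elim: n => [|n IHn]; first by rewrite big_geq// expr0.
rewrite big_nat_recr//=.
have -> : \sum_(k <- gen n) r ^+ trunc_log 2 k = 2 ^+ n * r ^+ n.
  have := gen_avg_const n (r ^+ n); rewrite /gen_avg => <-.
  rewrite mulrA mulfV ?mul1r ?expf_neq0//.
  by apply: eq_big_seq => k kn; rewrite (trunc_log_gen kn).
have h4 : 2 ^+ n * r ^+ n <= (2 * rho) ^+ n.
  rewrite -exprMn lerXn2r ?nnegrE//; [by rewrite mulr_ge0|rewrite mulr_ge0//; lra|lra].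
have h5 : 0 <= (2 * rho) ^+ n by rewrite exprn_ge0// mulr_ge0//; lra.
rewrite exprS; move: IHn h4 h5.
move: (\sum_(_ <= _ < _) _) (2 ^+ n * r ^+ n) ((2 * rho) ^+ n) => x y z a1 a2 a3.
nra.
Qed.

Lemma past_flow y z : past P zeta
  (fun k w => phi (AX k w * y + Xt zeta k w) - phi (AX k w * z + Xt zeta k w))
  (fun k => K ^+ 2 * (y - z) ^+ 2 * r ^+ trunc_log 2 k).
Proof.
move=> k k0; have [sA EA] := past_AX k0.
have mphi t : mJ zeta (below k) (fun w => phi (AX k w * t + Xt zeta k w)).
  apply: mJ_comp; first exact: bounded_lipschitz_measurable BL.
  apply: mJD; last exact: (Xt_mJ H k0).
  by apply: mJM; [case: sA|exact: mJ_cst].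
have m1 := mJB (mphi y) (mphi z).
have le w : (phi (AX k w * y + Xt zeta k w) - phi (AX k w * z + Xt zeta k w)) ^+ 2 <=
    K ^+ 2 * (y - z) ^+ 2 * AX k w ^+ 2.
  apply: (le_trans (bounded_lipschitz_sqr _ _ BL)).
  by rewrite le_eqVlt; apply/orP; left; apply/eqP; ring.
have I2 := itgZ (K ^+ 2 * (y - z) ^+ 2) sA.2.
have I1 : itg P (fun w => (phi (AX k w * y + Xt zeta k w) - phi (AX k w * z + Xt zeta k w)) ^+ 2).
  apply: itg_le I2 _.
    by apply: measurable_funX; exact: (mJ_mf (tn_meas H) m1).
  by move=> w; rewrite ger0_norm ?sqr_ge0.
split; first by split.
apply: (le_trans (Ex_le I1 I2 le)); rewrite ExZ; last by case: sA.
by apply: ler_wpM2l => //; nonneg.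
Qed.

(** For deterministic [y] and [z] the terms are orthogonal, and their weights inherit the decay of
    [AX]: the variance is smaller than [2 ^ n] by the factor [rho ^+ n]. *)
Lemma flow_sum_diff n y z : sq P (fun w => flow_sum n y w - flow_sum n z w) /\
  Ex P (fun w => (flow_sum n y w - flow_sum n z w) ^+ 2) <=
  2 * C * K ^+ 2 * (2 * rho) ^+ n * (y - z) ^+ 2.
Proof.
have [s E] := orthogonal_sum H (past_flow y z) hv (ltn0Sn 0) (pn n).
have e : (fun w => flow_sum n y w - flow_sum n z w) = (fun w => \sum_(1 <= k < 2 ^ n)
  (phi (AX k w * y + Xt zeta k w) - phi (AX k w * z + Xt zeta k w)) * v k w).
  apply/funext => w; rewrite /flow_sum -sumrB; apply: eq_bigr => k _.
  by rewrite mulrBl.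
have e2 : (fun w => (flow_sum n y w - flow_sum n z w) ^+ 2) = (fun w => (\sum_(1 <= k < 2 ^ n)
  (phi (AX k w * y + Xt zeta k w) - phi (AX k w * z + Xt zeta k w)) * v k w) ^+ 2).
  by apply/funext => w; rewrite -(congr1 (fun h => h w) e).
rewrite e e2; split; first exact: (sqJ_sq (tn_meas H) s).
apply: (le_trans E); rewrite -mulr_sumr.
have c : 0 <= K ^+ 2 * (y - z) ^+ 2 * C by nonneg.
have := ler_wpM2l c (sum_path_rate n).
move: (\sum_(_ <= _ < _) _) ((2 * rho) ^+ n) => x t h; lra.
Qed.

Definition flow_lip (n : nat) (w : Omega) : R :=
  K * \sum_(1 <= k < 2 ^ n) `|AX k w * v k w|.

Lemma flow_sum_lip n y z w :
  `|flow_sum n y w - flow_sum n z w| <= flow_lip n w * `|y - z|.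
Proof.
have [K0 _ lip] := BL.
rewrite /flow_sum -sumrB /flow_lip -mulrA mulr_suml mulr_sumr.
apply: (le_trans (ler_norm_sum _ _ _)); apply: ler_sum => k _.
rewrite -mulrBl !normrM.
have := lip (AX k w * y + Xt zeta k w) (AX k w * z + Xt zeta k w).
have -> : AX k w * y + Xt zeta k w - (AX k w * z + Xt zeta k w) = AX k w * (y - z) by ring.
rewrite normrM => h; apply: (le_trans (ler_wpM2r (normr_ge0 (v k w)) h)).
by rewrite le_eqVlt; apply/orP; left; apply/eqP; ring.
Qed.

Lemma flow_lip_ge0 n w : 0 <= flow_lip n w.
Proof. by have [K0 _ _] := BL; rewrite mulr_ge0// sumr_ge0. Qed.

(** Absolute values destroy orthogonality, and Cauchy-Schwarz costs a factor [2 ^+ n]. Stopping the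
    chaining at level [n], where the squared mesh is [(2 ^- n) ^+ 2], more than compensates it. *)
Lemma flow_lip_sq n : sq P (flow_lip n) /\
  Ex P (fun w => flow_lip n w ^+ 2) <= 2 * C * K ^+ 2 * (2 * rho) ^+ n * 2 ^+ n.
Proof.
have sk k : (0 < k)%N -> sq P (fun w => `|AX k w * v k w|) /\
    Ex P (fun w => `|AX k w * v k w| ^+ 2) <= r ^+ trunc_log 2 k * C.
  move=> k0; have [s E] := orthogonal_term H past_AX hv k0.
  have [m2 I2] := sqJ_sq (tn_meas H) s.
  have e : (fun w => `|AX k w * v k w| ^+ 2) = (fun w => (AX k w * v k w) ^+ 2).
    by apply/funext => w; rewrite real_normK ?num_real.
  by split; [split; [exact: measurableT_comp|rewrite e]|rewrite e].
pose F k w : R := if (0 < k)%N then `|AX k w * v k w| else 0.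
have sF k : sq P (F k).
  by rewrite /F; case: posnP => [_|k0]; [exact: sq_cst|have [] := sk _ k0].
have FE n' w : \sum_(1 <= k < n') `|AX k w * v k w| = \sum_(1 <= k < n') F k w.
  by apply: eq_big_nat => k /andP[k1 _]; rewrite /F k1.
have e : flow_lip n = (fun w => K * \sum_(1 <= k < 2 ^ n) F k w).
  by apply/funext => w; rewrite /flow_lip FE.
rewrite e; split; first by apply: sqZ; exact: sq_sum.
have -> : (fun w => (K * \sum_(1 <= k < 2 ^ n) F k w) ^+ 2) =
   (fun w => K ^+ 2 * (\sum_(1 <= k < 2 ^ n) F k w) ^+ 2).
  by apply/funext => w; rewrite exprMn.
have [_ IS] := sq_sum (index_iota 1 (2 ^ n)) sF.
have IS2 : itg P (fun w => \sum_(1 <= k < 2 ^ n) F k w ^+ 2).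
  by apply: itg_sum => k; case: (sF k).
rewrite ExZ//.
apply: (@le_trans _ _ (K ^+ 2 * (2 ^+ n * (\sum_(1 <= k < 2 ^ n) r ^+ trunc_log 2 k * C)))).
  rewrite ler_wpM2l ?sqr_ge0//.
  apply: (@le_trans _ _ (Ex P (fun w => 2 ^+ n * \sum_(1 <= k < 2 ^ n) F k w ^+ 2))).
    apply: Ex_le => //; first exact: itgZ.
    move=> w; apply: (le_trans (sqr_sum_le _ _)); rewrite ler_wpM2r//.
      by apply: sumr_ge0 => k _; exact: sqr_ge0.
    by rewrite size_iota -natrX ler_nat leq_subr.
  rewrite ExZ// Ex_sum; last by move=> k; case: (sF k).
  rewrite ler_wpM2l ?exprn_ge0// big_nat [leRHS]big_nat; apply: ler_sum => k /andP[k1 _].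
  by rewrite /F k1; have [] := sk _ k1.
rewrite -mulr_suml.
have c : 0 <= K ^+ 2 * 2 ^+ n * C by nonneg.
have := ler_wpM2l c (sum_path_rate n).
move: (\sum_(_ <= _ < _) _) ((2 * rho) ^+ n) (2 ^+ n) => x t u h; lra.
Qed.

Lemma flow_sum_uniform_signed (s : R) (N : nat) : s ^+ 2 = 1 ->
  {ae P, forall w, forall y, 0 <= y -> y < N%:R ->
    (flow_sum n (s * y) w - flow_sum n 0 w) ^+ 2 / 2 ^+ n @[n --> \oo] --> 0}.
Proof.
move=> s2; have [h1 h2 h3] := rho_bounds.
have sabs t : `|s * t| = `|t|.
  have : `|s| ^+ 2 = 1 by rewrite real_normK ?num_real.
  by move/eqP; rewrite sqrf_eq1 => /orP[/eqP e|/eqP e]; rewrite normrM e; [rewrite mul1r|have := normr_ge0 s; rewrite e; lra].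
pose D n w y := flow_sum n (s * y) w.
pose d n y z w := (D n w y - D n w z) ^+ 2.
(* The bound of [dyadic_chaining] at level [J = n], normalised. It is free of [y], so its almost
   sure convergence gives one null set for all [y]; the sign [s] reduces negative states to positive
   ones. *)
pose Gam n w := 2 ^- n * (3 * \sum_(0 <= i < N) d n i%:R 0 w +
   9 * \sum_(0 <= j < n) (3 / 2) ^+ j *
       (\sum_(0 <= i < N * 2 ^ j) d n (i.*2.+1%:R / 2 ^+ j.+1) (i%:R / 2 ^+ j) w) +
   3 * (flow_lip n w ^+ 2 * (2 ^- n) ^+ 2)).
have Id n y z : itg P (d n y z) by have [[_]] := flow_sum_diff n (s * y) (s * z).
have d0 n y z w : 0 <= d n y z w by exact: sqr_ge0.
pose G n := 2 * C * K ^+ 2 * (2 * rho) ^+ n.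
have Ed n y z : Ex P (d n y z) <= G n * (y - z) ^+ 2.
  have [_ E] := flow_sum_diff n (s * y) (s * z); apply: (le_trans E).
  by rewrite -[s * y - _]mulrBr [(s * _) ^+ 2]exprMn s2 mul1r.
have G0 n : 0 <= G n.
  have rho0 : 0 <= rho by lra.
  rewrite /G; nonneg.
have IL n := (flow_lip_sq n).1.2.
have I1 n : itg P (fun w => \sum_(0 <= i < N) d n i%:R 0 w) by exact: itg_sum.
have I2' n j : itg P (fun w => \sum_(0 <= i < N * 2 ^ j) d n (i.*2.+1%:R / 2 ^+ j.+1) (i%:R / 2 ^+ j) w).
  by apply: (@itg_sum _ _ _ _ _ _ (fun i w => d n (i.*2.+1%:R / 2 ^+ j.+1) (i%:R / 2 ^+ j) w)).
have I2 n : itg P (fun w => \sum_(0 <= j < n) (3 / 2) ^+ j *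
    (\sum_(0 <= i < N * 2 ^ j) d n (i.*2.+1%:R / 2 ^+ j.+1) (i%:R / 2 ^+ j) w)).
  apply: (@itg_sum _ _ _ _ _ _ (fun j w => (3 / 2) ^+ j *
    (\sum_(0 <= i < N * 2 ^ j) d n (i.*2.+1%:R / 2 ^+ j.+1) (i%:R / 2 ^+ j) w))) => j.
  by apply: itgZ; exact: I2'.
have I3 n : itg P (fun w => flow_lip n w ^+ 2 * (2 ^- n) ^+ 2).
  by apply: eq_integrable (itgZ ((2 ^- n) ^+ 2) (IL n)) => // w _ /=; rewrite mulrC.
have E1 n : Ex P (fun w => \sum_(0 <= i < N) d n i%:R 0 w) <= G n * N%:R ^+ 3.
  rewrite Ex_sum//; apply: (@le_trans _ _ (\sum_(0 <= i < N) G n * N%:R ^+ 2)).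
    rewrite big_nat [leRHS]big_nat; apply: ler_sum => i /andP[_ iN].
    apply: (le_trans (Ed _ _ _)); rewrite subr0 ler_wpM2l//.
    by rewrite lerXn2r ?nnegrE// ler_nat ltnW.
  by rewrite sumr_const_nat subn0 -[_ *+ N]mulr_natr -mulrA -exprSr.
have E2 n : Ex P (fun w => \sum_(0 <= j < n) (3 / 2) ^+ j *
    (\sum_(0 <= i < N * 2 ^ j) d n (i.*2.+1%:R / 2 ^+ j.+1) (i%:R / 2 ^+ j) w)) <= G n * N%:R.
  rewrite (@Ex_sum _ _ _ _ _ _ (fun j w => (3 / 2) ^+ j *
    (\sum_(0 <= i < N * 2 ^ j) d n (i.*2.+1%:R / 2 ^+ j.+1) (i%:R / 2 ^+ j) w))); last first.
    by move=> j; apply: itgZ; exact: I2'.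
  (* Level [j] has [N * 2 ^ j] steps of squared length [4 ^- j.+1] and weight [(3 / 2) ^+ j]; the
     product is [N / 4 * (3 / 4) ^+ j]. *)
  apply: (@le_trans _ _ (\sum_(0 <= j < n) (G n * N%:R / 4) * (3 / 4) ^+ j)).
    apply: ler_sum => j _; rewrite ExZ; last exact: I2'.
    rewrite (@Ex_sum _ _ _ _ _ _ (fun i w => d n (i.*2.+1%:R / 2 ^+ j.+1) (i%:R / 2 ^+ j) w))//.
    apply: (@le_trans _ _ ((3 / 2) ^+ j * \sum_(0 <= i < N * 2 ^ j) G n * (2 ^- j.+1) ^+ 2)).
      rewrite ler_wpM2l ?exprn_ge0 ?divr_ge0//; apply: ler_sum => i _.
      apply: (le_trans (Ed _ _ _)).
      have -> : i.*2.+1%:R / 2 ^+ j.+1 - i%:R / 2 ^+ j = 2 ^- j.+1 :> R.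
        rewrite -natr1 -mul2n natrM [2 ^+ j.+1]exprS; field; exact: expf_neq0.
      by [].
    rewrite sumr_const_nat subn0 -[_ *+ (N * _)]mulr_natr natrM natrX.
    rewrite le_eqVlt; apply/orP; left; apply/eqP.
    have -> : (3 / 4) ^+ j = (3 / 2) ^+ j / 2 ^+ j :> R.
      by rewrite -exprVn -exprMn; congr (_ ^+ j); field.
    rewrite [2 ^+ j.+1]exprS; have : 2 ^+ j != 0 :> R by exact: expf_neq0.
    by move: ((3 / 2) ^+ j) (2 ^+ j) => x y y0; field.
  rewrite -mulr_sumr.
  have q : \sum_(0 <= j < n) (3 / 4) ^+ j <= (1 - 3 / 4)^-1 :> R by apply: sum_geo_le; lra.
  have c : 0 <= G n * N%:R / 4 by rewrite divr_ge0// mulr_ge0.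
  apply: (le_trans (ler_wpM2l c q)).
  by rewrite le_eqVlt; apply/orP; left; apply/eqP; field.
have E3 n : Ex P (fun w => flow_lip n w ^+ 2 * (2 ^- n) ^+ 2) <= G n.
  have -> : (fun w => flow_lip n w ^+ 2 * (2 ^- n) ^+ 2) = (fun w => (2 ^- n) ^+ 2 * flow_lip n w ^+ 2).
    by apply/funext => w; rewrite mulrC.
  rewrite ExZ//; have [_ E] := flow_lip_sq n.
  apply: (le_trans (ler_wpM2l (sqr_ge0 _) E)); rewrite -/(G n).
  have -> : (2 ^- n) ^+ 2 * (G n * 2 ^+ n) = G n * 2 ^- n by field; exact: expf_neq0.
  by rewrite ler_piMr// invf_le1 ?exprn_gt0// exprn_ege1// ler1n.
have : {ae P, forall w, Gam n w @[n --> \oo] --> 0}.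
  pose CN := 2 * C * K ^+ 2 * (3 * N%:R ^+ 3 + 9 * N%:R + 3).
  apply: (@geometric_Ex_cvg0 _ _ _ _ _ CN rho) => //.
  - by move=> n; apply: itgZ; apply: itgD; [apply: itgD; exact: itgZ|exact: itgZ].
  - move=> n w; rewrite mulr_ge0 ?invr_ge0 ?exprn_ge0//.
    by nonneg.
  - lra.
  - by nonneg.
  move=> n; rewrite ExZ; last by apply: itgD; [apply: itgD; exact: itgZ|exact: itgZ].
  rewrite ExD; [|by apply: itgD; exact: itgZ|exact: itgZ].
  rewrite ExD; [|exact: itgZ|exact: itgZ].
  rewrite !ExZ//.
  apply: (@le_trans _ _ (2 ^- n * (3 * (G n * N%:R ^+ 3) + 9 * (G n * N%:R) + 3 * G n))).
    rewrite ler_wpM2l ?invr_ge0 ?exprn_ge0//.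
    by apply: lerD; [apply: lerD|]; rewrite ler_wpM2l.
  rewrite le_eqVlt; apply/orP; left; apply/eqP; rewrite /G /CN exprMn; field.
  exact: expf_neq0.
apply: filterS => w Gw y y0 yN.
apply: cvgr0_le Gw; apply: nearW => n.
rewrite ger0_norm; last by rewrite divr_ge0 ?sqr_ge0 ?exprn_ge0.
rewrite mulrC ler_wpM2l ?invr_ge0 ?exprn_ge0//.
have := @dyadic_chaining R (D n w) (flow_lip n w) y N n (flow_lip_ge0 n w) _ y0 yN.
have -> : flow_sum n 0 w = D n w 0 by rewrite /D mulr0.
apply => a b.
by rewrite /D -(sabs (a - b)) mulrBr; exact: flow_sum_lip.
Qed.

(* The exceptional null set must not depend on y: X_1 is not assumed independent of
   the noise, so that y = X_1 cannot be handled by conditioning. *)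
Theorem flow_sum_uniform : {ae P, forall w, forall y,
  (flow_sum n y w - flow_sum n 0 w) ^+ 2 / 2 ^+ n @[n --> \oo] --> 0}.
Proof.
have hp : {ae P, forall w, forall N y, 0 <= y -> y < N%:R ->
    (flow_sum n (1 * y) w - flow_sum n 0 w) ^+ 2 / 2 ^+ n @[n --> \oo] --> 0}.
  by apply: ae_foralln => N; apply: flow_sum_uniform_signed; rewrite expr1n.
have hm : {ae P, forall w, forall N y, 0 <= y -> y < N%:R ->
    (flow_sum n (-1 * y) w - flow_sum n 0 w) ^+ 2 / 2 ^+ n @[n --> \oo] --> 0}.
  by apply: ae_foralln => N; apply: flow_sum_uniform_signed; rewrite sqrrN expr1n.
move: hp hm; apply: filterS2 => w h1 h2 y.
have yN : `|y| < (Num.truncn `|y|).+1%:R by exact: truncnS_gt.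
have [y0|y0] := leP 0 y.
  by rewrite -[y]mul1r; apply: (h1 (Num.truncn `|y|).+1) => //; rewrite -{1}(ger0_norm y0).
have -> : y = -1 * - y by ring.
by apply: (h2 (Num.truncn `|y|).+1); [lra|rewrite -(ltr0_norm y0)].
Qed.

End anticipating_initial_state.

(** * Bounded Lipschitz functions and the weights of the estimator *)

Section bounded_lipschitz_algebra.
Context {R : realType}.
Implicit Types (K : R) (phi psi : R -> R).

Lemma bounded_lipschitz_le K K' phi : K <= K' -> bounded_lipschitz K phi ->
  bounded_lipschitz K' phi.
Proof.
move=> KK' [K0 h1 h2]; split; first exact: le_trans KK'.
  by move=> x; exact: le_trans KK'.
by move=> x y; apply: (le_trans (h2 x y)); rewrite ler_wpM2r.
Qed.

Lemma bounded_lipschitz_cst (c : R) : bounded_lipschitz `|c| (fun=> c).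
Proof. by split => // x y; rewrite subrr normr0 mulr_ge0. Qed.

Lemma bounded_lipschitzD K L phi psi : bounded_lipschitz K phi ->
  bounded_lipschitz L psi -> bounded_lipschitz (K + L) (fun x => phi x + psi x).
Proof.
move=> [K0 h1 h2] [L0 g1 g2]; split; first exact: addr_ge0.
  by move=> x; apply: (le_trans (ler_normD _ _)); exact: lerD.
move=> x y; rewrite opprD addrACA mulrDl.
by apply: (le_trans (ler_normD _ _)); exact: lerD.
Qed.

Lemma bounded_lipschitzM K L phi psi : bounded_lipschitz K phi ->
  bounded_lipschitz L psi ->
  bounded_lipschitz (K * L + 2 * (K * L)) (fun x => phi x * psi x).
Proof.
move=> [K0 h1 h2] [L0 g1 g2]; have KL0 : 0 <= K * L by exact: mulr_ge0.
split; first by nonneg.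
  move=> x; rewrite normrM; apply: (@le_trans _ _ (K * L)); first exact: ler_pM.
  by rewrite lerDl; nonneg.
move=> x y; have -> : phi x * psi x - phi y * psi y =
    (phi x - phi y) * psi x + phi y * (psi x - psi y) by ring.
apply: (le_trans (ler_normD _ _)); rewrite !normrM.
have a1 := ler_pM (normr_ge0 _) (normr_ge0 _) (h2 x y) (g1 x).
have a2 := ler_pM (normr_ge0 _) (normr_ge0 _) (h1 y) (g2 x y).
have a3 : 0 <= K * L * `|x - y| by exact: mulr_ge0.
nra.
Qed.

Definition isBL phi := exists K, bounded_lipschitz K phi.

Lemma isBL_cst (c : R) : isBL (fun=> c).
Proof. by exists `|c|; exact: bounded_lipschitz_cst. Qed.

Lemma isBLD phi psi : isBL phi -> isBL psi -> isBL (fun x => phi x + psi x).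
Proof. by move=> [K h] [L g]; exists (K + L); exact: bounded_lipschitzD. Qed.

Lemma isBLM phi psi : isBL phi -> isBL psi -> isBL (fun x => phi x * psi x).
Proof. by move=> [K h] [L g]; exists (K * L + 2 * (K * L)); exact: bounded_lipschitzM. Qed.

Lemma isBLZ (c : R) phi : isBL phi -> isBL (fun x => c * phi x).
Proof. by move=> h; apply: isBLM => //; exact: isBL_cst. Qed.

Lemma isBLB phi psi : isBL phi -> isBL psi -> isBL (fun x => phi x - psi x).
Proof.
move=> h g; have := isBLD h (isBLZ (-1) g).
by under eq_fun do rewrite mulN1r.
Qed.

Lemma isBLX n phi : isBL phi -> isBL (fun x => phi x ^+ n).
Proof.
move=> h; elim: n => [|n IHn]; first exact: isBL_cst.
by under eq_fun do rewrite exprS; exact: isBLM.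
Qed.

Lemma isBL_common phi psi : isBL phi -> isBL psi ->
  exists K, bounded_lipschitz K phi /\ bounded_lipschitz K psi.
Proof.
move=> [K h] [L g]; exists (Num.max K L); split.
  by apply: bounded_lipschitz_le h; rewrite le_max lexx.
by apply: bounded_lipschitz_le g; rewrite le_max lexx orbT.
Qed.

(** With [qw] below, the entries of the weighted matrix [Phi Phi^t / (1 + x ^+ 2)] are [1 - pw x],
    [qw x] and [pw x]. Writing the first as [1 - pw] leaves only two functions to study. *)
Definition pw (x : R) : R := (1 + x ^+ 2)^-1.
Definition qw (x : R) : R := x / (1 + x ^+ 2).

Lemma one_sqr_gt0 (x : R) : 0 < 1 + x ^+ 2.
Proof. by have := sqr_ge0 x; lra. Qed.

Lemma pw_bounds x : 0 < pw x <= 1.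
Proof.
rewrite /pw invr_gt0 one_sqr_gt0 invf_le1 ?one_sqr_gt0//.
by rewrite lerDl sqr_ge0.
Qed.

Lemma isBL_pw : isBL pw.
Proof.
exists 1; split => //.
  by move=> x; have /andP[h1 h2] := pw_bounds x; rewrite gtr0_norm.
move=> x y; rewrite mul1r /pw.
have hx := one_sqr_gt0 x; have hy := one_sqr_gt0 y.
have -> : (1 + x ^+ 2)^-1 - (1 + y ^+ 2)^-1 = (y - x) * ((x + y) / ((1 + x ^+ 2) * (1 + y ^+ 2))).
  by field; apply/andP; split; exact: lt0r_neq0.
rewrite normrM distrC ler_piMr// normrM normfV (gtr0_norm (mulr_gt0 hx hy)).
rewrite ler_pdivrMr ?mulr_gt0// mul1r ler_norml.
have := sqr_ge0 (x - y); have := sqr_ge0 (x + y); have := sqr_ge0 (x * y).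
have := sqr_ge0 (x + y + 1); have := sqr_ge0 (x + y - 1).
have := sqr_ge0 (x - 1 / 2); have := sqr_ge0 (x + 1 / 2); have := sqr_ge0 (y - 1 / 2); have := sqr_ge0 (y + 1 / 2).
by move=> *; apply/andP; split; nra.
Qed.

Lemma isBL_qw : isBL qw.
Proof.
exists 1; split => //.
  move=> x; have hx := one_sqr_gt0 x.
  rewrite /qw normrM normfV (gtr0_norm hx) ler_pdivrMr// mul1r ler_norml.
  have := sqr_ge0 (x - 1 / 2); have := sqr_ge0 (x + 1 / 2).
  by move=> *; apply/andP; split; nra.
move=> x y; rewrite mul1r /qw.
have hx := one_sqr_gt0 x; have hy := one_sqr_gt0 y.
have -> : x / (1 + x ^+ 2) - y / (1 + y ^+ 2) = (x - y) * ((1 - x * y) / ((1 + x ^+ 2) * (1 + y ^+ 2))).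
  by field; apply/andP; split; exact: lt0r_neq0.
rewrite normrM ler_piMr// normrM normfV (gtr0_norm (mulr_gt0 hx hy)).
rewrite ler_pdivrMr ?mulr_gt0// mul1r ler_norml.
have := sqr_ge0 (x - y); have := sqr_ge0 (x + y); have := sqr_ge0 (x * y).
by move=> *; apply/andP; split; nra.
Qed.

Lemma qw_sqr x : qw x ^+ 2 = pw x * (1 - pw x).
Proof. by rewrite /qw /pw; field; apply: lt0r_neq0; exact: one_sqr_gt0. Qed.

Lemma mul_qw x : x * qw x = 1 - pw x.
Proof. by rewrite /qw /pw; field; apply: lt0r_neq0; exact: one_sqr_gt0. Qed.

Lemma mul_pw x : x * pw x = qw x.
Proof. by []. Qed.

End bounded_lipschitz_algebra.

(** * Perturbation of averages *)

Section averages.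
Context {R : realType}.
Implicit Types (u z : nat -> R) (l : R).

Lemma avg_mul0 u z l : u n @[n --> \oo] --> 0 -> (forall n, 0 <= z n) ->
  n%:R^-1 * (\sum_(0 <= k < n) z k) @[n --> \oo] --> l ->
  n%:R^-1 * (\sum_(0 <= k < n) u k * z k) @[n --> \oo] --> 0.
Proof.
move=> u0 z0 zl; apply/cvgr0Pnorm_lt => e e0.
pose L : R := `|l| + 1; have L0 : 0 < L by rewrite /L; have := normr_ge0 l; lra.
have e' : 0 < e / 2 / L by rewrite divr_gt0//; lra.
have /cvgr0Pnorm_lt/(_ _ e') [N _ uN] := u0.
have zL : \forall n \near \oo, n%:R^-1 * (\sum_(0 <= k < n) z k) < L.
  move/cvgrPdist_lt : zl => /(_ 1 ltr01); apply: filterS => n.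
  rewrite ltr_distlC => /andP[_ h]; apply: (lt_le_trans h).
  by rewrite lerD2r ler_norm.
pose A : R := \sum_(0 <= k < N) `|u k * z k|.
have A0 : n%:R^-1 * A @[n --> \oo] --> (0 : R).
  apply: cvg_of_succ; rewrite -[X in _ --> X](mul0r A); apply: cvgMl.
  exact: cvg_invn.
have e2 : 0 < e / 2 by lra.
have /cvgr0Pnorm_lt/(_ _ e2) An := A0.
have nN : \forall n \near \oo, (N <= n)%N by exists N.
move: zL An nN; apply: filterS3 => n zn An Nn.
rewrite normrM (ger0_norm (x := n%:R^-1)) ?invr_ge0//.
have n0 : 0 <= n%:R^-1 :> R by rewrite invr_ge0.
have h : `|\sum_(0 <= k < n) u k * z k| <= A + e / 2 / L * \sum_(0 <= k < n) z k.
  apply: (le_trans (ler_norm_sum _ _ _)).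
  rewrite (big_cat_nat (n := N))//=; apply: lerD => //.
  apply: (@le_trans _ _ (e / 2 / L * \sum_(N <= k < n) z k)).
    rewrite mulr_sumr big_nat [leRHS]big_nat; apply: ler_sum => k /andP[Nk _].
    rewrite normrM (ger0_norm (z0 k)) ler_wpM2r//; apply: ltW.
    exact: uN.
  apply: ler_wpM2l; first exact: ltW.
  rewrite [leRHS](big_cat_nat (n := N))//= lerDr.
  by apply: sumr_ge0.
apply: (le_lt_trans (ler_wpM2l n0 h)); rewrite mulrDr.
have hA : n%:R^-1 * A < e / 2.
  by move: An; rewrite ltr_norml => /andP[].
have hz : n%:R^-1 * (e / 2 / L * \sum_(0 <= k < n) z k) <= e / 2.
  rewrite mulrCA; have := ler_wpM2l (ltW e') (ltW zn).
  by rewrite -[e / 2 / L * L]mulrA mulVf ?lt0r_neq0// mulr1.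
lra.
Qed.

Lemma avg_add u z l : n%:R^-1 * (\sum_(0 <= k < n) u k) @[n --> \oo] --> l ->
  n%:R^-1 * (\sum_(0 <= k < n) z k) @[n --> \oo] --> 0 ->
  n%:R^-1 * (\sum_(0 <= k < n) (u k + z k)) @[n --> \oo] --> l.
Proof.
move=> h1 h2; have := seq_cvgD h1 h2; rewrite addr0; apply: cvg_eq => n.
by rewrite -mulrDr big_split.
Qed.

(** Although [u] may be unbounded, the cross term is at most [|z k| * (u k ^+ 2 + 1)], and the
    averages of [u k ^+ 2 + 1] converge, so [avg_mul0] applies. *)
Lemma avg_sqr_perturbation u z l : n%:R^-1 * (\sum_(0 <= k < n) u k ^+ 2) @[n --> \oo] --> l ->
  z n @[n --> \oo] --> 0 ->
  n%:R^-1 * (\sum_(0 <= k < n) (u k + z k) ^+ 2) @[n --> \oo] --> l.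
Proof.
move=> ul z0.
have one : n%:R^-1 * (\sum_(0 <= k < n) (1 : R)) @[n --> \oo] --> (1 : R).
  by apply: cesaro_mean; exact: cvg_cst.
have u2 : n%:R^-1 * (\sum_(0 <= k < n) (u k ^+ 2 + 1)) @[n --> \oo] --> l + 1.
  have := seq_cvgD ul one; apply: cvg_eq => n.
  by rewrite -mulrDr big_split.
have h1 := avg_mul0 (cvgr0_norm z0) (fun n => addr_ge0 (sqr_ge0 (u n)) ler01) u2.
have h2 : n%:R^-1 * (\sum_(0 <= k < n) (2 * (u k * z k))) @[n --> \oo] --> 0.
  apply: cvgr0_le h1; apply: nearW => n.
  rewrite normrM (ger0_norm (x := n%:R^-1)) ?invr_ge0// ler_wpM2l ?invr_ge0//.
  apply: (le_trans (ler_norm_sum _ _ _)); apply: ler_sum => k _.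
  have -> : `|2 * (u k * z k)| = `|z k| * (2 * `|u k|).
    by rewrite !normrM (ger0_norm (x := 2))//; ring.
  rewrite ler_wpM2l//.
  have -> : u k ^+ 2 = `|u k| ^+ 2 by rewrite real_normK ?num_real.
  by have := sqr_ge0 (`|u k| - 1); nra.
have z2 := seq_cvgM z0 z0; rewrite mul0r in z2.
have := avg_add (avg_add ul h2) (cesaro_mean z2).
apply: cvg_eq => n; congr (_ * _); apply: eq_bigr => k _; ring.
Qed.

Lemma half_rec_cvg (w u : nat -> R) l : (forall n, w n.+1 = w n / 2 + u n / 2) ->
  u n @[n --> \oo] --> l -> w n @[n --> \oo] --> l.
Proof.
move=> wr ul.
have d0 : u n - l @[n --> \oo] --> 0.
  by rewrite -[X in _ --> X](subrr l); apply: seq_cvgB => //; exact: cvg_cst.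
have : `|w n - l| @[n --> \oo] --> 0.
  apply: (@half_rec0 _ _ (fun n => `|u n - l| / 2)) => //.
    move=> n; rewrite wr.
    have -> : w n / 2 + u n / 2 - l = (w n - l) / 2 + (u n - l) / 2 by field.
    by rewrite (le_trans (ler_normD _ _))// !normrM (ger0_norm (x := 2^-1))//; lra.
  have := seq_cvgZ (k := 2^-1) (cvgr0_norm d0); rewrite mulr0.
  by apply: cvg_eq => n; rewrite mulrC.
move=> h; have h' : w n - l @[n --> \oo] --> 0 by apply: cvgr0_le h; exact: nearW.
have cl : (fun=> l) n @[n --> \oo] --> l by exact: cvg_cst.
have := seq_cvgD h' cl; rewrite add0r; apply: cvg_eq => n.
by rewrite subrK.
Qed.

End averages.

Section score.
Context {disp : measure_display} {Omega : measurableType disp} {R : realType}.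
Variables (P : probability Omega R) (zeta : nat -> Omega -> R * R) (r V : R).
Hypothesis H : tree_noise P zeta r V.
Variable X : nat -> Omega -> R.
Hypothesis X_rec : forall k w, (1 < k)%N ->
  X k w = coef zeta k w * X k./2 w + innov zeta k w.
Variables (al be : nat -> Omega -> R) (sa sb M : R).
Hypothesis Hab : centered_pair P zeta al be sa sb M.
Variables g f : R -> R.
Hypotheses (BLg : isBL g) (BLf : isBL f).

Definition score (n : nat) (w : Omega) : R :=
  \sum_(1 <= k < 2 ^ n) (g (X k w) * al k w + f (X k w) * be k w).

Lemma X_decomposition k w : (0 < k)%N -> X k w = AX zeta k w * X 1%N w + Xt zeta k w.
Proof.
move=> k0; have kn : k \in gen (trunc_log 2 k).
  by rewrite mem_index_iota pow_trunc_log_le//= trunc_log_ltn.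
by rewrite (X_gen X_rec w kn).
Qed.

(** The statement uniform in the initial state is evaluated at the random point [X 1 w], once for
    the coefficient part and once for the innovation part. *)
Lemma score_diff : {ae P, forall w,
  (score n w - mart zeta al be g f (2 ^ n) w) / Num.sqrt (2 ^+ n) @[n --> \oo] --> 0}.
Proof.
have [sa0 sb0 _] := variances_ge0 Hab.
have [Kg hg] := BLg; have [Kf hf] := BLf.
have h1 := flow_sum_uniform H hg sa0 (fresh_al H Hab).
have h2 := flow_sum_uniform H hf sb0 (fresh_be H Hab).
have conv (u : nat -> R) : u n ^+ 2 / 2 ^+ n @[n --> \oo] --> 0 ->
    u n / Num.sqrt (2 ^+ n) @[n --> \oo] --> 0.
  move=> u0; apply: cvg0_of_sqr; apply: cvg_eq u0 => n.
  by rewrite exprMn exprVn sqr_sqrtr// exprn_ge0.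
move: h1 h2; apply: filterS2 => w h1 h2.
have := seq_cvgD (conv _ (h1 (X 1%N w))) (conv _ (h2 (X 1%N w))); rewrite addr0.
apply: cvg_eq => n; rewrite -mulrDl; congr (_ / _).
rewrite /flow_sum /score /mart -!sumrB -big_split.
apply: eq_big_nat => k /andP[k0 _].
by rewrite (X_decomposition w k0) /increment !mulr0 !add0r /=; ring.
Qed.

Let nsqr n w := normalized_sqr zeta al be g f n w.

Lemma score_sqrE n w : score n w ^+ 2 / 2 ^+ n =
  (mart zeta al be g f (2 ^ n) w / Num.sqrt (2 ^+ n) +
   (score n w - mart zeta al be g f (2 ^ n) w) / Num.sqrt (2 ^+ n)) ^+ 2.
Proof.
by rewrite -mulrDl addrC subrK exprMn exprVn sqr_sqrtr// exprn_ge0.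
Qed.

Lemma normalized_sqrE n w :
  nsqr n w = (mart zeta al be g f (2 ^ n) w / Num.sqrt (2 ^+ n)) ^+ 2.
Proof. by rewrite exprMn exprVn sqr_sqrtr// exprn_ge0. Qed.

Theorem score_sublinear :
  {ae P, forall w, score n w ^+ 2 / 2 ^+ n / n.+1%:R @[n --> \oo] --> 0}.
Proof.
have [K [hg hf]] := isBL_common BLg BLf.
have := normalized_sqr_sublinear H Hab hg hf; have := score_diff.
apply: filterS2 => w h1 h2.
have h3 := seq_cvgM (seq_cvgM h1 h1) (@cvg_invn R); rewrite !mul0r in h3.
have := seq_cvgD (seq_cvgZ (k := 2) h2) (seq_cvgZ (k := 2) h3); rewrite mulr0 addr0.
apply: cvgr0_le; apply: nearW => n.
rewrite ger0_norm; last by nonneg.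
rewrite -/(nsqr n w) normalized_sqrE score_sqrE.
set y := (score n w - _) / _; set x := mart zeta al be g f (2 ^ n) w / _.
rewrite (_ : 2 * _ + 2 * _ = (2 * x ^+ 2 + 2 * (y * y)) / n.+1%:R); last by ring.
rewrite ler_wpM2r ?invr_ge0//.
by have := sqr_ge0 (x - y); nra.
Qed.

Theorem score_sqr_avg (l : R) :
  {ae P, forall w, gen_avg n (fun k => sa * g (Xt zeta k w) ^+ 2 + sb * f (Xt zeta k w) ^+ 2)
    @[n --> \oo] --> l} ->
  {ae P, forall w, n%:R^-1 * (\sum_(0 <= k < n) score k.+1 w ^+ 2 / 2 ^+ k.+1)
    @[n --> \oo] --> l}.
Proof.
move=> hl; have [K [hg hf]] := isBL_common BLg BLf.
have := normalized_sqr_avg H Hab hg hf hl; have := score_diff.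
apply: filterS2 => w h1 h2.
have h3 : n%:R^-1 * (\sum_(0 <= k < n)
    (mart zeta al be g f (2 ^ k.+1) w / Num.sqrt (2 ^+ k.+1)) ^+ 2) @[n --> \oo] --> l.
  apply: cvg_eq h2 => n; congr (_ * _); apply: eq_bigr => k _.
  exact: normalized_sqrE.
have := avg_sqr_perturbation h3 (cvg_succ h1); apply: cvg_eq => n.
by congr (_ * _); apply: eq_bigr => k _; rewrite score_sqrE.
Qed.

End score.

(** * Empirical Gram matrices *)

Section tree_means.
Context {disp : measure_display} {Omega : measurableType disp} {R : realType}.
Variables (P : probability Omega R) (zeta : nat -> Omega -> R * R) (r V : R).
Hypothesis H : tree_noise P zeta r V.

(** The sum has [2 ^ n - 1] terms; dividing by [2 ^ n] instead makes the recursion [tmeanS]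
    exact. *)
Definition tmean (n : nat) (F : nat -> R) : R := 2 ^- n * \sum_(1 <= k < 2 ^ n) F k.

Lemma tmeanS n F : tmean n.+1 F = tmean n F / 2 + gen_avg n F / 2.
Proof.
rewrite /tmean /gen_avg /gen (big_cat_nat (n := 2 ^ n)) ?expn_gt0 ?leq_exp2l//=.
rewrite [2 ^+ n.+1]exprS; move: (\sum_(_ <= _ < _) _) (\sum_(_ <= _ < _) _) => x y.
by field; exact: expf_neq0.
Qed.

Lemma tmeanB n F G : tmean n (fun k => F k - G k) = tmean n F - tmean n G.
Proof. by rewrite /tmean sumrB mulrBr. Qed.

Lemma tmeanD n F G : tmean n (fun k => F k + G k) = tmean n F + tmean n G.
Proof. by rewrite /tmean big_split mulrDr. Qed.

Lemma tmeanZ n x F : tmean n (fun k => x * F k) = x * tmean n F.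
Proof. by rewrite /tmean -mulr_sumr mulrCA. Qed.

Lemma tmean_cvg (F : nat -> R) (l : R) : gen_avg n F @[n --> \oo] --> l ->
  tmean n F @[n --> \oo] --> l.
Proof. by apply: half_rec_cvg => n; exact: tmeanS. Qed.

Lemma gen_avg_Xt (phi : R -> R) n :
  gen_avg n (fun k => Ex P (fun w => phi (path_value zeta n k w))) =
  gen_avg n (fun k => Ex P (fun w => phi (Xt zeta k w))).
Proof.
by apply: eq_gen_avg => k kn; apply: eq_Ex => w; rewrite (Xt_gen zeta w kn).
Qed.

Lemma itg_BL (phi : R -> R) k : isBL phi -> (0 < k)%N ->
  itg P (fun w => phi (Xt zeta k w)).
Proof.
move=> [K BL] k0; have [_ phiK _] := BL.
apply: (@itg_bounded _ _ _ _ _ K) => [|w]; last exact: phiK.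
apply: measurableT_comp; first exact: bounded_lipschitz_measurable BL.
exact: (mJ_mf (tn_meas H) (Xt_mJ H k0)).
Qed.

Lemma Xt_sq k : (0 < k)%N -> sqJ P zeta (below k) (Xt zeta k) /\
  Ex P (fun w => Xt zeta k w ^+ 2) <= value_bound r V.
Proof.
move=> k0; have h := pow_trunc_log_le k0.
have [s E] := noise_value_sq H h; split => //.
exact: (sqJ_mono (path_nodes_below h) s).
Qed.

(** Convexity: [1 / (1 + y)] lies above its tangent at [value_bound r V], and the linear term has a
    favourable sign because the second moment of [Xt] is below this value. *)
Lemma Ex_pw_ge k : (0 < k)%N ->
  (1 + value_bound r V)^-1 <= Ex P (fun w => pw (Xt zeta k w)).
Proof.
move=> k0; have [sX EX] := Xt_sq k0; have B0 := noise_bound_ge0 H.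
set B := value_bound r V in EX B0 *.
have b0 : 0 < 1 + B by lra.
have IX := sX.2; have Ip := itg_BL isBL_pw k0.
have le w : (1 + B)^-1 - (1 + B) ^- 2 * (Xt zeta k w ^+ 2 - B) <= pw (Xt zeta k w).
  have x0 := one_sqr_gt0 (Xt zeta k w); rewrite /pw.
  set y := Xt zeta k w ^+ 2 in x0 *; rewrite -subr_ge0.
  have -> : (1 + y)^-1 - ((1 + B)^-1 - (1 + B) ^- 2 * (y - B)) =
     (y - B) ^+ 2 / ((1 + y) * (1 + B) ^+ 2).
    by field; apply/andP; split; exact: lt0r_neq0.
  by apply: divr_ge0; nonneg.
have I0 : itg P (fun w => (1 + B) ^- 2 * (Xt zeta k w ^+ 2 - B)).
  by apply: itgZ; apply: itgB => //; exact: itg_cst.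
have I1 : itg P (fun w => (1 + B)^-1 - (1 + B) ^- 2 * (Xt zeta k w ^+ 2 - B)).
  by apply: itgB => //; exact: itg_cst.
apply: le_trans (Ex_le I1 Ip le).
rewrite ExB//; last exact: itg_cst.
rewrite Ex_cst ExZ; last by apply: itgB => //; exact: itg_cst.
rewrite ExB//; last exact: itg_cst.
rewrite Ex_cst lerDl oppr_ge0 mulr_ge0_le0 ?subr_le0//.
by rewrite invr_ge0 exprn_ge0// ltW.
Qed.

Definition mean_pw k := Ex P (fun w => pw (Xt zeta k w)).
Definition mean_qw k := Ex P (fun w => qw (Xt zeta k w)).

(** Minimised over [t], this quadratic polynomial equals the determinant of the mean weighted matrix
    divided by [mean_pw k]. A lower bound uniform in [t] therefore bounds determinants from
    below. *)
Lemma weighted_dist t k : (0 < k)%N ->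
  itg P (fun w => (Xt zeta k w - t) ^+ 2 * pw (Xt zeta k w)) /\
  Ex P (fun w => (Xt zeta k w - t) ^+ 2 * pw (Xt zeta k w)) =
  (1 - mean_pw k) - (2 * t) * mean_qw k + t ^+ 2 * mean_pw k.
Proof.
move=> k0; have Ip := itg_BL isBL_pw k0; have Iq := itg_BL isBL_qw k0.
have e : (fun w => (Xt zeta k w - t) ^+ 2 * pw (Xt zeta k w)) = (fun w =>
    (1 - pw (Xt zeta k w)) - (2 * t) * qw (Xt zeta k w) + t ^+ 2 * pw (Xt zeta k w)).
  apply/funext => w; set x := Xt zeta k w; rewrite -(mul_qw x) -(mul_pw x); ring.
have I1 : itg P (fun w => 1 - pw (Xt zeta k w)) by apply: itgB => //; exact: itg_cst.
have I2 := itgB I1 (itgZ (2 * t) Iq).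
rewrite e; split; first by apply: itgD => //; exact: itgZ.
rewrite ExD//; last exact: itgZ.
rewrite ExB//; last exact: itgZ.
by rewrite ExB//; [rewrite !ExZ// Ex_cst|exact: itg_cst].
Qed.

Variables (al be : nat -> Omega -> R) (sa sb M a c : R).
Hypothesis Hab : centered_pair P zeta al be sa sb M.
Hypothesis Hal : forall j w, (0 < j)%N -> coef zeta j.*2 w = al j w + a.
Hypothesis Hbe : forall j w, (0 < j)%N -> innov zeta j.*2 w = be j w + c.
Hypothesis sb_gt0 : 0 < sb.

Lemma Xt_double j w : (0 < j)%N ->
  Xt zeta j.*2 w = coef zeta j.*2 w * Xt zeta j w + innov zeta j.*2 w.
Proof. by move=> j0; rewrite /Xt trunc_log2_double//= doubleK. Qed.

(** An upper bound for the expectation of [e ^+ 2 * (1 + x ^+ 2)] when [x = y + c + e], [e] being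
    the centered innovation and [y] independent of it; the factors 3 come from expanding the square
    of a sum of three terms. *)
Let W : R := sb * (1 + 3 * c ^+ 2) + 3 * (r * value_bound r V * sb) + 3 * M.

Lemma W_gt0 : 0 < W.
Proof.
have [_ sb0 M0] := variances_ge0 Hab; have r0 := tn_r0 H; have B0 := noise_bound_ge0 H.
have b0 : 0 <= r * value_bound r V * sb by nonneg.
have c0 : 0 < 1 + 3 * c ^+ 2 by have := sqr_ge0 c; lra.
have := mulr_gt0 sb_gt0 c0; rewrite /W; lra.
Qed.

(* Duality: [2 lam (x - t) e <= (x - t)^2 / (1 + x^2) + lam^2 e^2 (1 + x^2)],
   with e the centered innovation at the even child. *)
Lemma weighted_dist_ge t j : (0 < j)%N ->
  sb ^+ 2 / W <= (1 - mean_pw j.*2) - (2 * t) * mean_qw j.*2 + t ^+ 2 * mean_pw j.*2.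
Proof.
move=> j0; have k0 : (0 < j.*2)%N by lia.
have [_ sb0 M0] := variances_ge0 Hab; have r0 := tn_r0 H; have B0 := noise_bound_ge0 H.
have [I1 <-] := weighted_dist t k0.
have mz := tn_meas H; have hi := tn_indep H.
have [sX EX] := Xt_sq j0.
have [sal _] := sq_of_pow4 H (cp_al Hab j0) (cp_al4 Hab j0).1.
have [sbe _] := sq_of_pow4 H (cp_be Hab j0) (cp_be4 Hab j0).1.
have je : [set j.*2] `<=` noise_index by move=> _ ->; rewrite /noise_index/=; lia.
have jo : [set j.*2.+1] `<=` noise_index by move=> _ ->; rewrite /noise_index/=; lia.
have cE : coef zeta j.*2 = (fun w => al j w + a) by apply/funext => w; exact: Hal.
have [Ic' Ec'] : itg P (fun w => coef zeta j.*2 w ^+ 2) /\ Ex P (fun w => coef zeta j.*2 w ^+ 2) <= r.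
  by apply: (tn_coef H); lia.
have sc : sqJ P zeta [set j.*2] (coef zeta j.*2).
  by split => //; rewrite cE; apply: mJD; [case: sal|exact: mJ_cst].
have d1 : [set j.*2] `&` below j = set0.
  by apply/seteqP; split => // i [/= ->]; rewrite /below/=; lia.
pose J := [set i | (1 < i <= j.*2)%N].
have J1 : [set j.*2] `<=` J by move=> _ ->; rewrite /J/=; lia.
have J2 : below j `<=` J by move=> i; rewrite /J/below/=; lia.
have JD : J `<=` noise_index by move=> i; rewrite /J/noise_index/=; lia.
have dJ : J `&` [set j.*2.+1] = set0.
  by apply/seteqP; split => // i [/= Ji ij]; move: Ji; rewrite /J/= ij; lia.
have [sY EY] := sqJM mz hi je (@below_noise j) d1 J1 J2 sc sX.
pose Y w := coef zeta j.*2 w * Xt zeta j w.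
have EY2 : Ex P (fun w => Y w ^+ 2) <= r * value_bound r V.
  rewrite /Y EY; apply: ler_pM => //; apply: Ex_ge0 => w; exact: sqr_ge0.
have sYe := sqJM mz hi JD jo dJ (@subsetUl _ J [set j.*2.+1]) (@subsetUr _ J [set j.*2.+1]) sY sbe.
have [sYe1 EYe2] := sYe.
have hY := sqJ_sq mz sY; have he := sqJ_sq mz sbe.
have [IYe EYe] := noise_ExM H JD jo dJ sY.1 sbe.1 (sq_itg hY) (sq_itg he).
have Ebe := cp_Ebe Hab j0; have Ebe2 := cp_Ebe2 Hab j0.
have [I4 E4] := cp_be4 Hab j0.
rewrite Ebe mulr0 in EYe; rewrite Ebe2 in EYe2.
(* The maximiser of [2 * lam * sb - lam ^+ 2 * W], with maximum [sb ^+ 2 / W]. *)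
pose lam := sb / W; have W0 := W_gt0.
have Ie := sq_itg he; have Ie2 := he.2.
have XE w : Xt zeta j.*2 w = Y w + c + be j w.
  by rewrite Xt_double// Hbe// /Y; ring.
pose lhs w := (2 * lam) * (Y w * be j w) + (2 * lam * (c - t)) * be j w + (2 * lam) * be j w ^+ 2.
pose rhs w := (Xt zeta j.*2 w - t) ^+ 2 * pw (Xt zeta j.*2 w) +
  lam ^+ 2 * ((1 + 3 * c ^+ 2) * be j w ^+ 2 + 3 * (Y w * be j w) ^+ 2 + 3 * be j w ^+ 4).
have le w : lhs w <= rhs w.
  have p0 := one_sqr_gt0 (Xt zeta j.*2 w).
  have -> : lhs w = 2 * lam * ((Xt zeta j.*2 w - t) * be j w) by rewrite /lhs XE; ring.
  apply: (@le_trans _ _ ((Xt zeta j.*2 w - t) ^+ 2 * pw (Xt zeta j.*2 w) +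
     lam ^+ 2 * (be j w ^+ 2 * (1 + Xt zeta j.*2 w ^+ 2)))).
    rewrite /pw; set x := Xt zeta j.*2 w in p0 *; set e := be j w.
    rewrite -subr_ge0.
    have -> : (x - t) ^+ 2 / (1 + x ^+ 2) + lam ^+ 2 * (e ^+ 2 * (1 + x ^+ 2)) -
        2 * lam * ((x - t) * e) = ((x - t) - lam * e * (1 + x ^+ 2)) ^+ 2 / (1 + x ^+ 2).
      by field; exact: lt0r_neq0.
    by apply: divr_ge0; nonneg.
  rewrite /rhs lerD2l; apply: ler_wpM2l; first exact: sqr_ge0.
  rewrite XE; move: (Y w) (be j w) => y e.
  have q : (y + c + e) ^+ 2 <= 3 * y ^+ 2 + 3 * c ^+ 2 + 3 * e ^+ 2.
    by have := sqr_ge0 (y - c); have := sqr_ge0 (y - e); have := sqr_ge0 (c - e); nra.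
  apply: (@le_trans _ _ (e ^+ 2 * (1 + (3 * y ^+ 2 + 3 * c ^+ 2 + 3 * e ^+ 2)))).
    by apply: ler_wpM2l; [exact: sqr_ge0|rewrite lerD2l].
  by rewrite le_eqVlt; apply/orP; left; apply/eqP; ring.
have IYe2 := (sqJ_sq mz sYe1).2.
have Il : itg P lhs.
  by apply: itgD; [apply: itgD; exact: itgZ|exact: itgZ].
have Ir1 : itg P (fun w => (1 + 3 * c ^+ 2) * be j w ^+ 2 + 3 * (Y w * be j w) ^+ 2 + 3 * be j w ^+ 4).
  by apply: itgD; [apply: itgD; exact: itgZ|exact: itgZ].
have Ir : itg P rhs by apply: itgD => //; exact: itgZ.
have := Ex_le Il Ir le; rewrite /lhs /rhs.
rewrite ExD; [|by apply: itgD; exact: itgZ|exact: itgZ].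
rewrite ExD; [|exact: itgZ|exact: itgZ].
rewrite !ExZ// EYe Ebe Ebe2 ExD//; last exact: itgZ.
rewrite ExZ// ExD; [|by apply: itgD; exact: itgZ|exact: itgZ].
rewrite ExD; [|exact: itgZ|exact: itgZ].
rewrite !ExZ// Ebe2 EYe2.
set Z := Ex P (fun w => _ * pw _) => h.
have hW : (1 + 3 * c ^+ 2) * sb + 3 * (Ex P (fun w => Y w ^+ 2) * sb) + 3 * Ex P (fun w => be j w ^+ 4) <= W.
  have := ler_wpM2r sb0 EY2; rewrite /W; lra.
have l0 : 0 <= lam ^+ 2 by exact: sqr_ge0.
have := ler_wpM2l l0 hW => h2.
have e1 : sb ^+ 2 / W = 2 * lam * sb - lam ^+ 2 * W.
  by rewrite /lam; field; exact: lt0r_neq0.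
rewrite e1; rewrite /Y in h2; lra.
Qed.

Lemma sum_even_le (F : nat -> R) m : (forall k, (0 < k)%N -> 0 <= F k) ->
  \sum_(1 <= j < m) F j.*2 <= \sum_(1 <= k < m.*2) F k.
Proof.
move=> F0; elim: m => [|m IHm]; first by rewrite !big_geq.
have [->|m0] := posnP m; first by rewrite big_geq// big_nat1 F0.
rewrite big_nat_recr//= doubleS 2?big_nat_recr//=; try lia.
by rewrite -addrA lerD// lerDl F0.
Qed.

Lemma sum_pow2_const (x : R) n : \sum_(1 <= k < 2 ^ n) x = (2 ^+ n - 1) * x.
Proof.
by rewrite sumr_const_nat -[x *+ _]mulr_natr natrB ?expn_gt0// natrX mulrC.
Qed.

Theorem gram_det_ge : exists2 delta, 0 < delta &
  forall n, (1 < n)%N -> delta <= tmean n (fun k => 1 - mean_pw k) * tmean n mean_pw - tmean n mean_qw ^+ 2.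
Proof.
have W0 := W_gt0; have B0 := noise_bound_ge0 H.
have d0 : 0 < sb ^+ 2 / W by rewrite divr_gt0// exprn_gt0.
(* The bound on distances holds at even nodes, and [2 ^ n.-1 - 1] of them, at least a quarter of
   [2 ^ n] when [1 < n], lie below [2 ^ n]. The factor 1/2 is a lower bound of [1 - 2 ^- n]. *)
exists (sb ^+ 2 / W / 4 * ((1 + value_bound r V)^-1 / 2)).
  by apply: mulr_gt0; apply: divr_gt0 => //; rewrite invr_gt0; lra.
move=> n n1.
have e0 : 0 < 2 ^+ n :> R by rewrite exprn_gt0.
have mp : (1 + value_bound r V)^-1 / 2 <= tmean n mean_pw.
  apply: (@le_trans _ _ (2 ^- n * \sum_(1 <= k < 2 ^ n) (1 + value_bound r V)^-1)); last first.
    rewrite /tmean ler_wpM2l ?invr_ge0 ?(ltW e0)// big_nat [leRHS]big_nat.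
    by apply: ler_sum => k /andP[k0 _]; exact: Ex_pw_ge.
  rewrite sum_pow2_const mulrA [leRHS]mulrC.
  rewrite ler_wpM2l ?invr_ge0//; first by lra.
  rewrite mulrBr mulVf ?lt0r_neq0// mulr1.
  have : 2 ^- n <= 2^-1 :> R.
    rewrite lef_pV2 ?posrE// -[leLHS]expr1 ler_weXn2l//; [by rewrite ler1n|lia].
  lra.
have mp0 : 0 < tmean n mean_pw.
  by apply: lt_le_trans mp; rewrite divr_gt0// invr_gt0; lra.
(* The minimiser of the averaged quadratic polynomial; it varies with [n], whence the need for a
   bound uniform in [t]. *)
pose t := tmean n mean_qw / tmean n mean_pw.
have Qt : tmean n (fun k => 1 - mean_pw k) * tmean n mean_pw - tmean n mean_qw ^+ 2 =
   tmean n (fun k => (1 - mean_pw k) - (2 * t) * mean_qw k + t ^+ 2 * mean_pw k) * tmean n mean_pw.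
  rewrite (tmeanD n (fun k => 1 - mean_pw k - 2 * t * mean_qw k) (fun k => t ^+ 2 * mean_pw k)).
  rewrite (tmeanB n (fun k => 1 - mean_pw k) (fun k => 2 * t * mean_qw k)) !tmeanZ /t.
  by move: mp0; move: (tmean n mean_pw) (tmean n mean_qw) (tmean n (fun k => 1 - mean_pw k)) => x y z x0; field; exact: lt0r_neq0.
rewrite Qt; apply: ler_pM => //; [by apply: divr_ge0 => //; exact: ltW|by apply: divr_ge0 => //; rewrite invr_ge0; lra|].
have nn k : (0 < k)%N -> 0 <= (1 - mean_pw k) - (2 * t) * mean_qw k + t ^+ 2 * mean_pw k.
  move=> k0; have [_ <-] := weighted_dist t k0; apply: Ex_ge0 => w.
  by rewrite mulr_ge0 ?sqr_ge0//; have /andP[/ltW] := pw_bounds (Xt zeta k w).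
have := sum_even_le (2 ^ n.-1) nn.
have -> : ((2 ^ n.-1).*2 = 2 ^ n)%N by rewrite -mul2n -expnS prednK; lia.
move=> h; apply: le_trans (ler_wpM2l _ h); last by rewrite invr_ge0 ltW.
apply: (@le_trans _ _ (2 ^- n * \sum_(1 <= j < 2 ^ n.-1) sb ^+ 2 / W)); last first.
  apply: ler_wpM2l; first by rewrite invr_ge0 ltW.
  rewrite big_nat [leRHS]big_nat; apply: ler_sum => j /andP[j0 _].
  exact: weighted_dist_ge.
rewrite sum_pow2_const mulrA [leRHS]mulrC.
apply: ler_wpM2l; first exact: ltW.
have -> : n = n.-1.+1 by rewrite prednK//; lia.
rewrite /= exprS; set x : R := 2 ^+ n.-1.
have x2 : 2 <= x.
  rewrite /x -[leLHS]expr1 ler_weXn2l//; [by rewrite ler1n|lia].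
rewrite ler_pdivlMl ?mulr_gt0//; lra.
Qed.

End tree_means.

Section empirical_means.
Context {disp : measure_display} {Omega : measurableType disp} {R : realType}.
Variables (P : probability Omega R) (zeta : nat -> Omega -> R * R) (r V : R).
Hypothesis H : tree_noise P zeta r V.
Variable X : nat -> Omega -> R.
Hypothesis X_rec : forall k w, (1 < k)%N ->
  X k w = coef zeta k w * X k./2 w + innov zeta k w.

Theorem tmean_lln (phi : R -> R) : isBL phi ->
  {ae P, forall w, tmean n (fun k => phi (X k w)) -
     tmean n (fun k => Ex P (fun w => phi (Xt zeta k w))) @[n --> \oo] --> 0}.
Proof.
move=> [K BL]; have := tree_lln_X H X_rec BL; apply: filterS => w h.
apply: half_rec_cvg h => n; rewrite !tmeanS gen_avg_Xt.
by field.
Qed.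

Lemma gen_avg_Xt_lln (phi : R -> R) (l : R) : isBL phi ->
  gen_avg n (fun k => Ex P (fun w => phi (Xt zeta k w))) @[n --> \oo] --> l ->
  {ae P, forall w, gen_avg n (fun k => phi (Xt zeta k w)) @[n --> \oo] --> l}.
Proof.
move=> [K BL] hl; have := tree_lln H BL; apply: filterS => w h.
have := seq_cvgD h hl; rewrite add0r; apply: cvg_eq => n.
rewrite gen_avg_Xt subrK; apply: eq_gen_avg => k kn.
by rewrite (Xt_gen zeta w kn).
Qed.

End empirical_means.

(** * The limit law *)

Section random_walk.
Context {disp : measure_display} {Omega : measurableType disp} {R : realType}.
Variable P : probability Omega R.
Variables (X : nat -> {RV P >-> R}) (kappa : nat -> {RV P >-> bool}).
Hypothesis coin : is_coin_sequence X kappa.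

Let flip (i : nat) (w : Omega) : bool := kappa i.+1 w.

Let mflip i : measurable_fun setT (flip i).
Proof. exact: measurable_funPT. Qed.

Lemma walk_gen m w : walk kappa m w \in gen m.
Proof.
elim: m => [|m IHm]; first by rewrite mem_index_iota.
move: IHm; rewrite !mem_index_iota /= => /andP[h1 h2].
by case: (kappa m.+1 w); rewrite /= !expnS; apply/andP; split; rewrite expnS in h2; lia.
Qed.

Definition at_node (m k : nat) (w : Omega) : R := (walk kappa m w == k)%:R.

Lemma at_nodeS m k w :
  at_node m.+1 k w = at_node m k./2 w * (flip m w == odd k)%:R.
Proof.
rewrite /at_node /flip -natrM mulnb /=; congr (nat_of_bool _)%:R.
apply/eqP/andP => [<-|[/eqP h1 /eqP h2]]; last first.
  by rewrite h1 h2 mul2n addnC odd_double_half.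
by rewrite mul2n; case: (kappa m.+1 w); rewrite ?addn1 ?addn0 /= ?uphalf_double ?doubleK ?odd_double ?eqxx.
Qed.

Lemma flip_mJ m (b : bool) : mJ flip [set m] (fun w => (flip m w == b)%:R : R).
Proof. by apply: (mJ_coord (h := fun x : bool => (x == b)%:R : R)). Qed.

Lemma at_node_mJ m k : mJ flip [set i | (i < m)%N] (at_node m k).
Proof.
elim: m k => [|m IHm] k; first exact: mJ_cst.
have -> : at_node m.+1 k = (fun w => at_node m k./2 w * (flip m w == odd k)%:R).
  by apply/funext => w; exact: at_nodeS.
apply: mJM.
  by apply: (mJ_mono _) (IHm _) => i /=; lia.
by apply: (mJ_mono _) (@flip_mJ m (odd k)) => i /= ->.
Qed.

Lemma itg_indicator (b : Omega -> bool) J : mJ flip J (fun w => (b w)%:R : R) ->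
  itg P (fun w => (b w)%:R).
Proof.
move=> m; apply: (@itg_bounded _ _ _ _ _ 1); first exact: (mJ_mf mflip m).
by move=> w; case: (b w); rewrite ?normr1 ?normr0.
Qed.

Lemma Ex_flip m (b : bool) : Ex P (fun w => (flip m w == b)%:R) = 2^-1.
Proof.
have [_ dist _] := coin.
have mb : measurable (flip m @^-1` [set b]) by rewrite -[X in measurable X]setTI; exact: mflip.
have -> : (fun w => (flip m w == b)%:R : R) = \1_(flip m @^-1` [set b]).
  apply/funext => w; rewrite indicE; congr (nat_of_bool _)%:R.
  by apply/eqP/idP => [e|]; rewrite ?inE//=.
rewrite /Ex integral_indic// setIT.
transitivity (fine (bernoulli_prob (2^-1 : R) [set b])).
  by congr fine; exact: dist.
rewrite /bernoulli_prob ifT; last by apply/andP; split; lra.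
by rewrite fsbig_set1 /bernoulli_pmf /=; case: b {mb}; lra.
Qed.

(** The walk sits at [k] exactly when the [m] flips are the binary digits of [k] after the leading
    one. *)
Lemma Ex_at_node m k : k \in gen m -> Ex P (at_node m k) = 2 ^- m.
Proof.
have [mi _ _] := coin.
elim: m k => [|m IHm] k.
  rewrite mem_index_iota expn0 => h; have -> : k = 1%N by lia.
  have -> : at_node 0 1 = (fun=> 1) by apply/funext.
  by rewrite Ex_cst expr0 invr1.
rewrite mem_index_iota => /andP[k1 k2].
have kg : k./2 \in gen m.
  by rewrite mem_index_iota; rewrite !expnS in k1 k2 *; apply/andP; split; lia.
have d : [set i | (i < m)%N] `&` [set m] = set0.
  by apply/seteqP; split => // i [/= + im]; rewrite im ltnn.
have [|||_ E] := @mJ_ExM _ _ _ P _ _ flip mflip setT _ _ _ _ _ _ _ d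
    (@at_node_mJ m k./2) (@flip_mJ m (odd k)) (itg_indicator (@at_node_mJ m k./2))
    (itg_indicator (@flip_mJ m (odd k))).
- by move=> J B uJ _ mB; exact: mi.
- by [].
- by [].
have -> : at_node m.+1 k = (fun w => at_node m k./2 w * (flip m w == odd k)%:R).
  by apply/funext => w; exact: at_nodeS.
by rewrite E Ex_flip IHm// exprSr invfM mulrC.
Qed.

Lemma Ex_at_nodeM m k (phi : R -> R) K : k \in gen m -> measurable_fun setT phi ->
  (forall x, `|phi x| <= K) ->
  itg P (fun w => at_node m k w * phi (X k w)) /\
  Ex P (fun w => at_node m k w * phi (X k w)) = 2 ^- m * Ex P (fun w => phi (X k w)).
Proof.
have [_ _ ind] := coin => km mphi phiK.
have IX : itg P (fun w => phi (X k w)).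
  apply: (@itg_bounded _ _ _ _ _ K) => //.
  by apply: measurableT_comp => //; exact: measurable_funPT.
have hi : indep2 P (at_node m k) (fun w => phi (X k w)).
  move=> A B mA mB; apply: ind.
    have := @at_node_mJ m k measurableT A mA; rewrite setTI.
    apply: sub_smallest2r; first exact: smallest_sigma_algebra.
    by move=> _ [i _ [C mC <-]]; exists i.+1 => //; exists C.
  apply: sub_sigma_algebra; exists k; first exact: (gen_gt0 km).
  exists (phi @^-1` B); last by rewrite setTI.
  by rewrite -[X in measurable X]setTI; exact: mphi.
have [h1 h2] := indep2_ExM hi (itg_indicator (@at_node_mJ m k)) IX.
by split => //; rewrite h2 (Ex_at_node km).
Qed.

Lemma Ex_Y m (phi : R -> R) K : measurable_fun setT phi -> (forall x, `|phi x| <= K) ->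
  Ex P (fun w => phi (Y_ X kappa m w)) = gen_avg m (fun k => Ex P (fun w => phi (X k w))).
Proof.
move=> mphi phiK.
pose F k w : R := if k \in gen m then at_node m k w * phi (X k w) else 0.
have IF k : itg P (F k).
  rewrite /F; case: (boolP (k \in gen m)) => km; last exact: itg_cst.
  by have [] := Ex_at_nodeM km mphi phiK.
have -> : (fun w => phi (Y_ X kappa m w)) = (fun w => \sum_(k <- gen m) F k w).
  apply/funext => w; rewrite (bigD1_seq (walk kappa m w)) ?iota_uniq ?walk_gen//=.
  rewrite big_seq_cond big1; last first.
    move=> k /andP[km kw]; rewrite /F km /at_node.
    by rewrite eq_sym (negbTE kw) mul0r.
  by rewrite /F walk_gen /at_node eqxx mul1r addr0.
rewrite Ex_sum// /gen_avg mulr_sumr; apply: eq_big_seq => k km.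
have [_ <-] := Ex_at_nodeM km mphi phiK; apply: eq_Ex => w.
by rewrite /F km.
Qed.

End random_walk.

Section limit_law.
Context {disp : measure_display} {Omega : measurableType disp} {R : realType}.
Variables (P : probability Omega R) (zeta : nat -> Omega -> R * R) (r V : R).
Hypothesis H : tree_noise P zeta r V.

Lemma Ex_dominated (f : nat -> Omega -> R) K : (forall n, measurable_fun setT (f n)) ->
  (forall n w, `|f n w| <= K) -> {ae P, forall w, f n w @[n --> \oo] --> 0} ->
  Ex P (f n) @[n --> \oo] --> 0.
Proof.
move=> mf fK f0.
have [||||| _ _ ] := @dominated_convergence _ _ _ P setT measurableT
  (fun n w => (f n w)%:E) (fun=> 0%E) (fun=> K%:E).
- by move=> n; exact/measurable_EFinP.
- exact: measurable_cst.
- by apply: filterS f0 => w h _; apply/fine_cvgP; split; [exact: nearW|].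
- exact: itg_cst.
- by apply: aeW => w n _; rewrite lee_fin.
by rewrite integral0 => /fine_cvgP[_].
Qed.

Variables (X : nat -> {RV P >-> R}) (kappa : nat -> {RV P >-> bool}).
Hypothesis X_rec : forall k w, (1 < k)%N ->
  X k w = coef zeta k w * X k./2 w + innov zeta k w.
Hypothesis coin : is_coin_sequence X kappa.
Context {disp' : measure_display} {Omega' : measurableType disp'}.
Variables (Q : probability Omega' R) (T : {RV Q >-> R}).
Hypothesis TY : cvg_in_distribution P Q (Y_ X kappa) T.

(** The law of [Y_] averages the means of [phi (X k)], not those of [phi (Xt zeta k)]. The two
    generation averages differ by a bounded quantity that tends to 0 almost surely, so their
    expectations have the same limit. *)
Theorem mean_cvg_T (phi : R -> R) : isBL phi ->
  gen_avg n (fun k => Ex P (fun w => phi (Xt zeta k w))) @[n --> \oo] --> Ex Q (fun w => phi (T w)).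
Proof.
move=> hphi; have [K BL] := hphi; have [K0 phiK _] := BL.
have mphi := bounded_lipschitz_measurable BL.
have mX k : measurable_fun setT (fun w => phi (X k w)).
  by apply: measurableT_comp => //; exact: measurable_funPT.
have IX k : itg P (fun w => phi (X k w)) by apply: (@itg_bounded _ _ _ _ _ K).
have It n k : k \in gen n -> itg P (fun w => phi (path_value zeta n k w)).
  move=> kn; apply: sq_itg.
  by have := phi_value_sq H BL (gen_ge kn).
have mT : measurable_fun setT (fun w => phi (T w)).
  by apply: measurableT_comp => //; exact: measurable_funPT.
have IT : itg Q (fun w => phi (T w)) by apply: (@itg_bounded _ _ _ _ _ K).
have h1 : gen_avg n (fun k => Ex P (fun w => phi (X k w))) @[n --> \oo] --> Ex Q (fun w => phi (T w)).
  have := TY (bounded_lipschitz_continuous BL) (ex_intro _ K phiK).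
  have -> : 'E_Q[phi \o T]%E = (Ex Q (fun w => phi (T w)))%:E by rewrite unlock; exact: ExE.
  move=> /fine_cvgP[_]; apply: cvg_eq => n.
  by rewrite -(Ex_Y coin n mphi phiK) /= unlock.
pose f n w := gen_avg n (fun k => phi (X k w)) - gen_avg n (fun k => phi (path_value zeta n k w)).
have If n : itg P (f n).
  have sX k : sq P (fun w => phi (X k w)) by apply: (@sq_bounded _ _ _ _ _ K).
  have sP k : k \in gen n -> sq P (fun w => phi (path_value zeta n k w)).
    by move=> kn; exact: (phi_value_sq H BL (gen_ge kn)).
  by apply: itgB; apply: sq_itg; apply: gen_avg_sq => k kn; [exact: sX|exact: sP].
have h2 : Ex P (f n) @[n --> \oo] --> 0.
  apply: (@Ex_dominated f (2 * K)).
  - by move=> n; exact: (itg_mf (If n)).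
  - move=> n w; apply: (le_trans (ler_normB _ _)).
    have b (F : nat -> R) : (forall k, `|F k| <= K) -> `|gen_avg n F| <= K.
      move=> FK; apply: (le_trans (norm_gen_avg_le _ _)).
      by rewrite -[leRHS](gen_avg_const n); apply: gen_avg_le => k _.
    have := b _ (fun k => phiK (X k w)).
    have := b _ (fun k => phiK (path_value zeta n k w)); lra.
  - exact: (avg_initial_state0 H X_rec BL).
have := seq_cvgB h1 h2; rewrite subr0; apply: cvg_eq => n.
rewrite /f ExB; last 2 first.
- by apply: sq_itg; apply: gen_avg_sq => k kn; apply: (@sq_bounded _ _ _ _ _ K).
- by apply: sq_itg; apply: gen_avg_sq => k kn; exact: (phi_value_sq H BL (gen_ge kn)).
rewrite (Ex_gen_avg (F := fun k w => phi (X k w)))//.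
rewrite (Ex_gen_avg (F := fun k w => phi (path_value zeta n k w))); last by move=> k; exact: It.
by rewrite gen_avg_Xt opprB addrC subrK.
Qed.

End limit_law.

(** * Linear algebra *)

Section two_by_two.
Context {R : realType}.

Lemma ord2_ind (Pr : 'I_2 -> Prop) : Pr 0 -> Pr 1 -> forall i, Pr i.
Proof.
move=> h0 h1 [[|[|//]] i2]; first by congr (Pr _): h0; exact: val_inj.
by congr (Pr _): h1; exact: val_inj.
Qed.

Lemma sum_ord2 (V : zmodType) (F : 'I_2 -> V) : \sum_i F i = F 0 + F 1.
Proof.
by rewrite !big_ord_recl big_ord0 addr0; congr (F _ + F _); apply: val_inj.
Qed.

Lemma mx22E (p q r s : R) : ((mx22 p q r s 0 0 = p) * (mx22 p q r s 0 1 = q) *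
  (mx22 p q r s 1 0 = r) * (mx22 p q r s 1 1 = s))%type.
Proof. by rewrite /mx22 !mxE. Qed.

Lemma eq_mx22 (M : 'M[R]_2) : M = mx22 (M 0 0) (M 0 1) (M 1 0) (M 1 1).
Proof.
by apply/matrixP => i j; elim/ord2_ind: i; elim/ord2_ind: j; rewrite mx22E.
Qed.

Lemma mx22_mul (p q r s p' q' r' s' : R) : mx22 p q r s *m mx22 p' q' r' s' =
  mx22 (p * p' + q * r') (p * q' + q * s') (r * p' + s * r') (r * q' + s * s').
Proof.
by rewrite [LHS]eq_mx22 !mxE !sum_ord2 !mx22E.
Qed.

Lemma mx22Z (x p q r s : R) : x *: mx22 p q r s = mx22 (x * p) (x * q) (x * r) (x * s).
Proof. by rewrite [LHS]eq_mx22 !mxE. Qed.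

Lemma mx22_scalar (x : R) : x%:M = mx22 x 0 0 x.
Proof. by rewrite [LHS]eq_mx22 !mxE. Qed.

Lemma mx22_inv (p q r s : R) : p * s - q * r != 0 ->
  mx22 p q r s \in unitmx /\
  invmx (mx22 p q r s) = (p * s - q * r)^-1 *: mx22 s (- q) (- r) p.
Proof.
set dt := _ - _ => dt0.
set N := _ *: _; have NM : N *m mx22 p q r s = 1%:M.
  rewrite /N -scalemxAl mx22_mul mx22Z mx22_scalar.
  by congr mx22; rewrite -?[dt]/(p * s - q * r) in dt0 *; field.
have [Mu _] := mulmx1_unit NM; have [_ Mu'] := mulmx1_unit NM; split => //.
by rewrite -[LHS]mul1mx -NM mulmxK.
Qed.

Lemma sum_mxtens (V : zmodType) (m n : nat) (F : 'I_(m * n) -> V) :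
  \sum_k F k = \sum_i \sum_j F (mxtens_index (i, j)).
Proof.
rewrite pair_big (reindex (@mxtens_index m n)) /=.
  by apply: eq_bigr => -[i j].
by exists (@mxtens_unindex m n) => k _; [exact: mxtens_indexK|exact: mxtens_unindexK].
Qed.

Lemma vecE (m n : nat) (M : 'M[R]_(m, n)) i j : vec M (mxtens_index (j, i)) 0 = M i j.
Proof. by rewrite mxE mxtens_indexK. Qed.

Lemma vecB (m n : nat) (M N : 'M[R]_(m, n)) : vec M - vec N = vec (M - N).
Proof. by apply/matrixP => i j; rewrite !mxE. Qed.

Lemma vec_surj (m n : nat) (v : 'cV[R]_(n * m)) : exists M : 'M[R]_(m, n), v = vec M.
Proof.
exists (\matrix_(i, j) v (mxtens_index (j, i)) 0); apply/matrixP => k l.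
by rewrite !mxE ord1 -surjective_pairing mxtens_unindexK.
Qed.

Lemma sqr_enorm (n : nat) (v : 'cV[R]_n) : enorm v ^+ 2 = \sum_i v i 0 ^+ 2.
Proof. by rewrite sqr_sqrtr// sumr_ge0// => i _; exact: sqr_ge0. Qed.

Lemma sqr_enorm_vec (M : 'M[R]_2) :
  enorm (vec M) ^+ 2 = \sum_j (M 0 j ^+ 2 + M 1 j ^+ 2).
Proof.
rewrite sqr_enorm sum_mxtens; apply: eq_bigr => j _.
by rewrite sum_ord2 !vecE.
Qed.

Lemma vec_form (K M : 'M[R]_2) :
  ((vec M)^T *m (1%:M *t K : 'M[R]_(2 * 2)) *m vec M) 0 0 =
  \sum_j (K 0 0 * M 0 j ^+ 2 + (K 0 1 + K 1 0) * (M 0 j * M 1 j) + K 1 1 * M 1 j ^+ 2).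
Proof.
rewrite mxE sum_mxtens; apply: eq_bigr => j _.
have e j' : ((vec M)^T *m (1%:M *t K : 'M[R]_(2 * 2))) 0 (mxtens_index (j, j')) =
    M 0 j * K 0 j' + M 1 j * K 1 j'.
  rewrite mxE sum_mxtens (bigD1 j)//= [X in _ + X = _]big1 => [|i ij].
    by rewrite addr0 sum_ord2 !tensmxE !mxE !mxtens_indexK /= eqxx !mul1r.
  by rewrite sum_ord2 !tensmxE !mxE (negbTE ij) !mul0r !mulr0 addr0.
rewrite sum_ord2 !vecE !e; ring.
Qed.

End two_by_two.

Section square_root.
Context {R : realType}.

Lemma tens1_unit (K : 'M[R]_2) : K \in unitmx -> (1%:M *t K : 'M[R]_(2 * 2)) \in unitmx.
Proof. by move=> Ku; rewrite tensmx_unit// unitmx1. Qed.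

Variables p q s : R.
Let C := mx22 p q q s.
(** The trace is 1 for the matrix [C_mx], since its diagonal entries are the expectations of
    [1 - pw] and [pw] at [T]. *)
Hypotheses (ps1 : p + s = 1) (det0 : 0 < p * s - q ^+ 2).

Lemma diag_gt0 : 0 < p /\ 0 < s.
Proof.
have ps0 : 0 < p * s by have := det0; have := sqr_ge0 q; lra.
have ep : p = p ^+ 2 + p * s by rewrite expr2 -mulrDr ps1 mulr1.
have es : s = s ^+ 2 + p * s by rewrite expr2 -mulrDl addrC ps1 mul1r.
by have := sqr_ge0 p; have := sqr_ge0 s; split; lra.
Qed.

(* By Cayley-Hamilton, a square root of a positive definite 2 x 2 matrix [C] of
   trace 1 is [(C + sqrt (det C)) / sqrt (1 + 2 sqrt (det C))]. *)
Lemma sqrtmx_tens : sqrtmx (1%:M *t C : 'M[R]_(2 * 2)) *m sqrtmx (1%:M *t C) = 1%:M *t C.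
Proof.
pose d := Num.sqrt (p * s - q ^+ 2); pose t := Num.sqrt (1 + 2 * d).
have d0 : 0 <= d by exact: sqrtr_ge0.
have d2 : d ^+ 2 = p * s - q ^+ 2 by rewrite sqr_sqrtr// ltW.
have t2 : t ^+ 2 = 1 + 2 * d by rewrite sqr_sqrtr//; lra.
have t0 : 0 < t by rewrite sqrtr_gt0; lra.
have [p0 s0] := diag_gt0.
pose S := t^-1 *: mx22 (p + d) q q (s + d).
rewrite /sqrtmx; set A := (X in xget 0 X).
(* Exhibiting one positive root suffices: the root selected by [xget] then satisfies the same
   defining properties. *)
suff : A (1%:M *t S) by move=> AS; have [_ _ ->] : A (xget 0 A) by exact: (xgetPex 0 (ex_intro _ _ AS)).
split.
- rewrite trmx_tens trmx1; congr (_ *t _); rewrite [LHS]eq_mx22 [RHS]eq_mx22.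
  by rewrite !mxE.
- move=> v; have [M ->] := vec_surj v.
  rewrite vec_form; apply: sumr_ge0 => j _.
  rewrite /S mx22Z !mx22E; set x := M 0 j; set y := M 1 j.
  have -> : t^-1 * (p + d) * x ^+ 2 + (t^-1 * q + t^-1 * q) * (x * y) +
      t^-1 * (s + d) * y ^+ 2 =
      t^-1 * (p^-1 * ((p * x + q * y) ^+ 2 + (p * s - q ^+ 2) * y ^+ 2) +
              d * (x ^+ 2 + y ^+ 2)).
    by field; rewrite !gt_eqF.
  rewrite mulr_ge0 ?invr_ge0 ?(ltW t0)// addr_ge0 ?mulr_ge0 ?invr_ge0 ?(ltW p0)//.
    by apply: addr_ge0; [exact: sqr_ge0|apply: mulr_ge0; [exact: ltW|exact: sqr_ge0]].
  by apply: addr_ge0; exact: sqr_ge0.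
- rewrite tensmx_mul mulmx1; congr (_ *t _).
  rewrite /S -scalemxAl -scalemxAr mx22_mul !mx22Z /C.
  have tn : t != 0 by rewrite gt_eqF.
  have e x y : t ^+ 2 * x = y -> t^-1 * (t^-1 * y) = x by move=> <-; field.
  have es : s = 1 - p by rewrite -ps1 [p + s]addrC addrK.
  have q2 : q * q = p * (1 - p) - d ^+ 2 by rewrite d2 es; ring.
  by congr mx22; apply: e; rewrite t2 ?q2 ?es; ring.
Qed.

(** By cyclicity the trace depends on [S] through [S *m S], which is the inverse of the block
    diagonal matrix. Hence the explicit inverse of [C] and the diagonal blocks of [L]. *)
Lemma trace_sqrtmx (L : 'M[R]_(2 * 2)) :
  let S := invmx (sqrtmx (1%:M *t C : 'M[R]_(2 * 2))) in
  \tr (S *m L *m S) = \sum_j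
   (s * L (mxtens_index (j, 0)) (mxtens_index (j, 0)) -
    q * (L (mxtens_index (j, 0)) (mxtens_index (j, 1)) +
         L (mxtens_index (j, 1)) (mxtens_index (j, 0))) +
    p * L (mxtens_index (j, 1)) (mxtens_index (j, 1))) / (p * s - q ^+ 2).
Proof.
have dn : p * s - q * q != 0 by rewrite -expr2 gt_eqF.
have [Cu CV] := mx22_inv dn.
set Z := sqrtmx _ => S; have ZZ : Z *m Z = 1%:M *t C := sqrtmx_tens.
have Zu : Z \in unitmx.
  have := tens1_unit Cu; rewrite -ZZ !unitmxE det_mulmx unitrM => /andP[//].
have SS : S *m S = 1%:M *t invmx C.
  have CC : (1%:M *t C : 'M[R]_(2 * 2)) *m (1%:M *t invmx C) = 1%:M.
    rewrite tensmx_mul mulmx1 mulmxV// ; apply/matrixP => i j.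
    rewrite -[i]mxtens_unindexK -[j]mxtens_unindexK; move: (mxtens_unindex i) (mxtens_unindex j) => [i1 i2] [j1 j2].
    rewrite tensmxE !mxE (can_eq (@mxtens_indexK 2 2)) xpair_eqE -natrM mulnb //.
  have SSC : S *m S *m (1%:M *t C) = 1%:M by rewrite -ZZ mulmxA mulmxKV// mulVmx.
  by rewrite -[LHS]mulmx1 -CC mulmxA SSC mul1mx.
rewrite -mulmxA mxtrace_mulC -mulmxA SS /mxtrace sum_mxtens; apply: eq_bigr => j _.
have e i : (L *m (1%:M *t invmx C)) (mxtens_index (j, i)) (mxtens_index (j, i)) =
    L (mxtens_index (j, i)) (mxtens_index (j, 0)) * invmx C 0 i +
    L (mxtens_index (j, i)) (mxtens_index (j, 1)) * invmx C 1 i.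
  rewrite mxE sum_mxtens (bigD1 j)//= [X in _ + X = _]big1 => [|k kj].
    by rewrite addr0 sum_ord2 !tensmxE !mxE eqxx !mul1r.
  by rewrite sum_ord2 !tensmxE !mxE (negbTE kj) !mul0r !mulr0 addr0.
rewrite sum_ord2 !e CV mx22Z !mx22E; field.
by rewrite gt_eqF.
Qed.

End square_root.

(** * The estimator along a trajectory *)

Lemma mulmx_col_row {R : realType} (u : 'cV[R]_2) (v : 'rV[R]_2) i j :
  (u *m v) i j = u i 0 * v 0 j.
Proof. by rewrite mxE big_ord1. Qed.

Section trajectory.
Context {R : realType}.
Variables (x : nat -> R) (th : 'M[R]_2) (al be : 'I_2 -> nat -> R).
Hypothesis x_rec : forall k j, (0 < k)%N ->
  chi x k j 0 = th 0 j * x k + th 1 j + (al j k * x k + be j k).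

(** With [gramB] and [gramD], the entries of [S0] divided by [2 ^+ n]. Index [n] refers to the nodes
    below [2 ^ n], hence to [S0 x n.-1], the matrix that occurs in [theta_hat x n]. *)
Definition gramA n : R := tmean n (fun k => 1 - pw (x k)).
Definition gramB n : R := tmean n (fun k => qw (x k)).
Definition gramD n : R := tmean n (fun k => pw (x k)).
Definition gram_det n : R := gramA n * gramD n - gramB n ^+ 2.

Definition path_score (g f : R -> R) j n : R :=
  \sum_(1 <= k < 2 ^ n) (g (x k) * al j k + f (x k) * be j k).

Definition score0 := path_score (fun y => 1 - pw y) qw.
Definition score1 := path_score qw pw.

Lemma S0_gram n : S0 x n = 2 ^+ n.+1 *: mx22 (gramA n.+1) (gramB n.+1) (gramB n.+1) (gramD n.+1).
Proof.
have e2 : (2 ^+ n.+1 : R) != 0 by exact: expf_neq0.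
rewrite mx22Z ![2 ^+ n.+1 * _]mulVKf// /S0 [LHS]eq_mx22 !summxE /tree.
congr mx22; apply: eq_bigr => k _; rewrite mxE mulmx_col_row !mxE /= ?mulr1//.
- by rewrite -mul_qw /qw mulrC mulrA.
- by rewrite mulrC.
- by rewrite mul1r mulrC.
Qed.

Lemma norm_tmean_le1 n (F : nat -> R) : (forall k, (0 < k)%N -> `|F k| <= 1) -> `|tmean n F| <= 1.
Proof.
move=> F1; have e2 : (0 : R) < 2 ^+ n by exact: exprn_gt0.
rewrite /tmean normrM (ger0_norm (x := _^-1)) ?invr_ge0 ?(ltW e2)// ler_pdivrMl//.
apply: (le_trans (ler_norm_sum _ _ _)); apply: (@le_trans _ _ (\sum_(1 <= k < 2 ^ n) 1)).
  by apply: ler_sum_nat => k /andP[k0 _]; exact: F1.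
by rewrite sum_pow2_const; lra.
Qed.

Lemma gram_le1 n : [/\ `|gramA n| <= 1, `|gramB n| <= 1 & `|gramD n| <= 1].
Proof.
split; apply: norm_tmean_le1 => k _; have /andP[h1 h2] := pw_bounds (x k).
- by rewrite ger0_norm; lra.
- by rewrite -(@expr_le1 _ 2%N)// real_normK ?num_real// qw_sqr; nra.
- by rewrite ger0_norm; lra.
Qed.

Lemma theta_hat_error n : gram_det n.+1 != 0 ->
  theta_hat x n.+1 - th = (2 ^+ n.+1 * gram_det n.+1)^-1 *:
    \matrix_(i, j) nth 0
     [:: gramD n.+1 * score0 j n.+1 - gramB n.+1 * score1 j n.+1;
         gramA n.+1 * score1 j n.+1 - gramB n.+1 * score0 j n.+1] i.
Proof.
rewrite /gram_det; set A := gramA _; set B := gramB _; set D := gramD _ => dn.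
have e2 : (2 ^+ n.+1 : R) != 0 by exact: expf_neq0.
have [Gu GV] : mx22 A B B D \in unitmx /\ invmx (mx22 A B B D) = (A * D - B ^+ 2)^-1 *: mx22 D (- B) (- B) A.
  by rewrite expr2; apply: mx22_inv; rewrite -expr2.
have Su : S0 x n \in unitmx by rewrite S0_gram unitmxZ ?unitfE.
have SV : invmx (S0 x n) = (2 ^+ n.+1 * (A * D - B ^+ 2))^-1 *: mx22 D (- B) (- B) A.
  by rewrite S0_gram invmxZ -?S0_gram// GV scalerA invfM.
rewrite /theta_hat /= /S_ Su.
have -> : \sum_(k <- tree n) (weight x k)^-1 *: (Phi x k *m (chi x k)^T) =
    S0 x n *m th + \matrix_(i, j) nth 0 [:: score0 j n.+1; score1 j n.+1] i.
  apply/matrixP => i j; rewrite summxE [RHS]mxE /S0 mulmx_suml summxE.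
  rewrite mxE.
  have -> : nth 0 [:: score0 j n.+1; score1 j n.+1] i = \sum_(1 <= k < 2 ^ n.+1)
      ((weight x k)^-1 *: (Phi x k)) i 0 * (al j k * x k + be j k).
    elim/ord2_ind: i; apply: eq_bigr => k _ /=; rewrite !mxE /=.
      by rewrite -mul_qw -mul_pw -/(pw (x k)); ring.
    by rewrite -mul_pw -/(pw (x k)); ring.
  rewrite -[RHS]big_split /=; apply: eq_big_nat => k /andP[k0 _].
  rewrite -scalemxAl -mulmxA !scalemxAl !mulmx_col_row [(chi x k)^T 0 j]mxE x_rec//.
  rewrite -mulrDr; congr (_ * _); rewrite [(_ *m th) _ _]mxE sum_ord2 !mxE /=; ring.
rewrite mulmxDr mulmxA mulVmx// mul1mx addrC addKr SV -scalemxAl; congr (_ *: _).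
apply/matrixP => i j; elim/ord2_ind: i; rewrite mxE sum_ord2 !mx22E !mxE /=; ring.
Qed.

End trajectory.

Section trajectory_rates.
Context {R : realType}.
Variables (x : nat -> R) (th : 'M[R]_2) (al be : 'I_2 -> nat -> R).
Hypothesis x_rec : forall k j, (0 < k)%N ->
  chi x k j 0 = th 0 j * x k + th 1 j + (al j k * x k + be j k).
Variable delta : R.
Hypothesis delta_gt0 : 0 < delta.
Hypothesis gram_ge : \forall n \near \oo, delta <= gram_det x n.

Let err n := theta_hat x n - th.
Let m0 := score0 x al be.
Let m1 := score1 x al be.

Lemma sqr_comb_le (u v y z : R) : `|u| <= 1 -> `|v| <= 1 ->
  (u * y - v * z) ^+ 2 <= 2 * (y ^+ 2 + z ^+ 2).
Proof.
move=> u1 v1.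
have u2 : u ^+ 2 <= 1 by rewrite -real_normK ?num_real// expr_le1.
have v2 : v ^+ 2 <= 1 by rewrite -real_normK ?num_real// expr_le1.
have := sqr_ge0 (u * y + v * z).
have := mulr_ge0 (sqr_ge0 y) (_ : 0 <= 1 - u ^+ 2).
have := mulr_ge0 (sqr_ge0 z) (_ : 0 <= 1 - v ^+ 2).
rewrite !subr_ge0 => /(_ v2) h1 /(_ u2) h2 h3; nra.
Qed.

Lemma error_sqr_le n : delta <= gram_det x n.+1 ->
  2 ^+ n.+1 * enorm (vec (err n.+1)) ^+ 2 <=
  4 / delta ^+ 2 * \sum_j (m0 j n.+1 ^+ 2 / 2 ^+ n.+1 + m1 j n.+1 ^+ 2 / 2 ^+ n.+1).
Proof.
move=> dn; have d0 : 0 < gram_det x n.+1 := lt_le_trans delta_gt0 dn.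
have e2 : 0 < (2 ^+ n.+1 : R) by exact: exprn_gt0.
have [A1 B1 D1] := gram_le1 x n.+1.
rewrite sqr_enorm_vec !mulr_sumr; apply: ler_sum => j _.
rewrite /err (theta_hat_error x_rec) ?gt_eqF// -/m0 -/m1 !mxE /=.
set g := gram_det x n.+1 in dn d0 *; set N := 2 ^+ n.+1 in e2 *.
set s0 := m0 j n.+1; set s1 := m1 j n.+1.
have c0 := sqr_comb_le s0 s1 D1 B1; have c1 := sqr_comb_le s1 s0 A1 B1.
rewrite !exprMn.
have -> : N * ((N * g)^-1 ^+ 2 * (gramD x n.+1 * s0 - gramB x n.+1 * s1) ^+ 2 +
    (N * g)^-1 ^+ 2 * (gramA x n.+1 * s1 - gramB x n.+1 * s0) ^+ 2) =
    (N * g ^+ 2)^-1 * ((gramD x n.+1 * s0 - gramB x n.+1 * s1) ^+ 2 +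
    (gramA x n.+1 * s1 - gramB x n.+1 * s0) ^+ 2).
  by field; rewrite !gt_eqF.
have -> : 4 / delta ^+ 2 * (s0 ^+ 2 / N + s1 ^+ 2 / N) =
    (N * delta ^+ 2)^-1 * (4 * (s0 ^+ 2 + s1 ^+ 2)).
  by have dl := delta_gt0; field; rewrite !gt_eqF.
have dl := delta_gt0.
apply: ler_pM.
- by rewrite invr_ge0 mulr_ge0 ?(ltW e2)// sqr_ge0.
- by apply: addr_ge0; exact: sqr_ge0.
- rewrite lef_pV2 ?posrE ?mulr_gt0 ?exprn_gt0// ler_pM2l//.
  by apply: lerXn2r => //; rewrite nnegrE ltW.
- lra.
Qed.

Hypothesis score_rate : forall j,
  m0 j n ^+ 2 / 2 ^+ n / n.+1%:R @[n --> \oo] --> 0 /\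
  m1 j n ^+ 2 / 2 ^+ n / n.+1%:R @[n --> \oo] --> 0.

Lemma error_rate :
  2 ^+ n * enorm (vec (err n)) ^+ 2 / n.+1%:R @[n --> \oo] --> 0.
Proof.
pose u n := 4 / delta ^+ 2 * (\sum_j (m0 j n ^+ 2 / 2 ^+ n + m1 j n ^+ 2 / 2 ^+ n)) / n.+1%:R.
have u0 : u n @[n --> \oo] --> 0.
  have h : (m0 0 n ^+ 2 / 2 ^+ n / n.+1%:R + m1 0 n ^+ 2 / 2 ^+ n / n.+1%:R) +
    (m0 1 n ^+ 2 / 2 ^+ n / n.+1%:R + m1 1 n ^+ 2 / 2 ^+ n / n.+1%:R) @[n --> \oo] --> ((0 + 0) + (0 + 0) : R).
    have [h1 h2] := score_rate 0; have [h3 h4] := score_rate 1.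
    exact: (seq_cvgD (seq_cvgD h1 h2) (seq_cvgD h3 h4)).
  have := seq_cvgZ (k := 4 / delta ^+ 2) h; rewrite !addr0 mulr0.
  by apply: cvg_eq => n; rewrite /u sum_ord2; ring.
apply: cvgr0_le u0; have n1 : \forall n \near \oo, (1 <= n)%N by exists 1%N.
apply: filterS2 gram_ge n1 => -[//|n] dn _.
rewrite ger0_norm; last by nonneg.
by rewrite ler_wpM2r ?invr_ge0//; exact: error_sqr_le.
Qed.

Lemma enorm_error_cvg0 : enorm (vec (err n)) ^+ 2 @[n --> \oo] --> 0.
Proof.
apply: cvgr0_le error_rate; apply: nearW => n.
rewrite ger0_norm ?sqr_ge0// [_ * enorm _ ^+ 2]mulrC -mulrA ler_peMr ?sqr_ge0//.
by rewrite ler_pdivlMr// mul1r -natrX ler_nat ltn_expl.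
Qed.

Lemma theta_hat_cvg : vec (theta_hat x n) @[n --> \oo] --> vec th.
Proof.
apply/cvgrPdist_lt => e e0.
have e2 : 0 < e ^+ 2 by rewrite exprn_gt0.
have /cvgr0Pnorm_lt/(_ _ e2) := enorm_error_cvg0.
apply: filterS => n; rewrite ger0_norm ?sqr_ge0// => h.
rewrite distrC vecB -/(err n) -[Num.norm _]/(mx_norm _) mx_normrE.
apply: bigmax_lt => // -[i j] _ /=.
rewrite -ltr_sqr ?nnegrE// ?ltW// real_normK ?num_real//; apply: le_lt_trans h.
rewrite sqr_enorm (bigD1 i)//= ord1 lerDl.
by apply: sumr_ge0 => k _; exact: sqr_ge0.
Qed.

Lemma error_bigO : (fun n => enorm (vec (theta_hat x n) - vec th) ^+ 2 : R^o)
  =O_\oo (fun n => n%:R / (size (tree n.-1))%:R : R^o).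
Proof.
rewrite (_ : (fun n => _) = fun n => enorm (vec (err n)) ^+ 2 : R^o); last first.
  by apply/funext => n; rewrite vecB.
(* [error_rate] has the denominator [n.+1], which is at most [2 * n] for positive [n]; replacing
   [2 ^+ n] by [2 ^+ n - 1] goes in the right direction. *)
apply/eqO_exP; exists 2 => //.
have /cvgr0Pnorm_lt/(_ _ ltr01) := error_rate.
have n1 : \forall n \near \oo, (1 <= n)%N by exists 1%N.
apply: filterS2 n1 => -[//|n] _ h.
rewrite ger0_norm ?sqr_ge0// ger0_norm; last by rewrite mulr_ge0 ?invr_ge0.
have -> : size (tree n.+1.-1) = (2 ^ n.+1 - 1)%N by rewrite size_iota.
rewrite natrB ?expn_gt0// natrX.
have e2 : 2 <= (2 ^+ n.+1 : R) by rewrite exprS ler_peMr// exprn_ege1// ler1n.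
move: h; set N := 2 ^+ n.+1 in e2 *; set v := enorm _ ^+ 2.
have N0 : 0 < N by lra.
have v0 : 0 <= v by exact: sqr_ge0.
rewrite ger0_norm; last by rewrite mulr_ge0 ?invr_ge0// mulr_ge0// ltW.
rewrite ltr_pdivrMr// mul1r => h.
rewrite mulrA ler_pdivlMr; last by lra.
apply: (@le_trans _ _ (N * v)); first by nra.
apply: (le_trans (ltW h)).
by rewrite -[n.+2%:R]natr1 -[n.+1%:R]natr1; have : (0 : R) <= n%:R by []; lra.
Qed.

End trajectory_rates.

Section weighted_averages.
Context {R : realType}.
Implicit Types (u v c y t : nat -> R).

Lemma avg_mul_cvg c y t (cl l m : R) : c n @[n --> \oo] --> cl ->
  (forall n, `|y n| <= t n) ->
  n%:R^-1 * (\sum_(0 <= k < n) t k) @[n --> \oo] --> m ->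
  n%:R^-1 * (\sum_(0 <= k < n) y k) @[n --> \oo] --> l ->
  n%:R^-1 * (\sum_(0 <= k < n) c k * y k) @[n --> \oo] --> cl * l.
Proof.
move=> hc yt ht hy.
have hc0 : `|c n - cl| @[n --> \oo] --> 0.
  apply: cvgr0_norm; rewrite -[X in _ --> X](subrr cl).
  by apply: seq_cvgB => //; exact: cvg_cst.
have t0 n : 0 <= t n by exact: le_trans (yt n).
have h0 : n%:R^-1 * (\sum_(0 <= k < n) (c k - cl) * y k) @[n --> \oo] --> 0.
  apply: cvgr0_le (avg_mul0 hc0 t0 ht); apply: nearW => n.
  rewrite normrM (ger0_norm (x := n%:R^-1)) ?invr_ge0// ler_wpM2l ?invr_ge0//.
  apply: (le_trans (ler_norm_sum _ _ _)); apply: ler_sum => k _.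
  by rewrite normrM ler_wpM2l.
have h1 : n%:R^-1 * (\sum_(0 <= k < n) cl * y k) @[n --> \oo] --> cl * l.
  by have := seq_cvgZ (k := cl) hy; apply: cvg_eq => n; rewrite -mulr_sumr mulrCA.
have := avg_add h1 h0; apply: cvg_eq => n; congr (_ * _).
by apply: eq_bigr => k _; ring.
Qed.

Lemma avg_near_eq u v (l : R) : (\forall n \near \oo, u n = v n) ->
  n%:R^-1 * (\sum_(0 <= k < n) u k) @[n --> \oo] --> l ->
  n%:R^-1 * (\sum_(0 <= k < n) v k) @[n --> \oo] --> l.
Proof.
move=> uv ul; have d0 : v n - u n @[n --> \oo] --> 0.
  have : (fun=> 0 : R) n @[n --> \oo] --> 0 by exact: cvg_cst.
  by apply: cvg_near_eq; apply: filterS uv => n ->; rewrite subrr.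
have := avg_add ul (cesaro_mean d0); apply: cvg_eq => n; congr (_ * _).
by apply: eq_bigr => k _; ring.
Qed.

Lemma avg_sum3 u v y (l m k : R) :
  n%:R^-1 * (\sum_(0 <= k < n) u k) @[n --> \oo] --> l ->
  n%:R^-1 * (\sum_(0 <= k < n) v k) @[n --> \oo] --> m ->
  n%:R^-1 * (\sum_(0 <= k < n) y k) @[n --> \oo] --> k ->
  n%:R^-1 * (\sum_(0 <= k < n) (u k + v k + y k)) @[n --> \oo] --> l + m + k.
Proof.
move=> hu hv hy; have := seq_cvgD (seq_cvgD hu hv) hy; apply: cvg_eq => n.
by rewrite !big_split/= !mulrDr.
Qed.

(* Off-diagonal averages come from the diagonal ones by polarization. *)
Lemma avg_quadratic_form (c0 c1 c2 y z : nat -> R) (d0 d1 d2 l0 l1 l2 : R) :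
  c0 n @[n --> \oo] --> d0 -> c1 n @[n --> \oo] --> d1 -> c2 n @[n --> \oo] --> d2 ->
  n%:R^-1 * (\sum_(0 <= k < n) y k ^+ 2 / 2 ^+ k.+1) @[n --> \oo] --> l0 ->
  n%:R^-1 * (\sum_(0 <= k < n) z k ^+ 2 / 2 ^+ k.+1) @[n --> \oo] --> l2 ->
  n%:R^-1 * (\sum_(0 <= k < n) (y k + z k) ^+ 2 / 2 ^+ k.+1) @[n --> \oo] --> l0 + 2 * l1 + l2 ->
  n%:R^-1 * (\sum_(0 <= k < n) (c0 k * (y k ^+ 2 / 2 ^+ k.+1) +
     c1 k * (y k * z k / 2 ^+ k.+1) + c2 k * (z k ^+ 2 / 2 ^+ k.+1)))
    @[n --> \oo] --> d0 * l0 + d1 * l1 + d2 * l2.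
Proof.
move=> h0 h1 h2 a0 a2 a1.
have e2 k : 0 < (2 ^+ k.+1 : R) by exact: exprn_gt0.
have ay : n%:R^-1 * (\sum_(0 <= k < n) y k * z k / 2 ^+ k.+1) @[n --> \oo] --> l1.
  have -> : l1 = 2^-1 * (l0 + 2 * l1 + l2 - l0 - l2) by field.
  have := seq_cvgZ (k := 2^-1) (seq_cvgB (seq_cvgB a1 a0) a2).
  apply: cvg_eq => n; rewrite -!mulrBr -!sumrB mulrCA mulr_sumr; congr (_ * _).
  by apply: eq_bigr => k _; field; rewrite gt_eqF.
have at_ : n%:R^-1 * (\sum_(0 <= k < n) (y k ^+ 2 / 2 ^+ k.+1 + z k ^+ 2 / 2 ^+ k.+1))
    @[n --> \oo] --> l0 + l2.
  by have := seq_cvgD a0 a2; apply: cvg_eq => n; rewrite big_split mulrDr.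
have q0 (w : nat -> R) k : 0 <= w k ^+ 2 / 2 ^+ k.+1.
  by rewrite divr_ge0 ?sqr_ge0// ltW.
apply: avg_sum3.
- apply: (avg_mul_cvg (t := fun k => y k ^+ 2 / 2 ^+ k.+1) h0 _ a0 a0) => n.
  by rewrite ger0_norm.
- apply: (avg_mul_cvg h1 _ at_ ay) => n.
  rewrite normrM normfV (ger0_norm (ltW (e2 n))) -mulrDl ler_wpM2r ?invr_ge0 ?(ltW (e2 n))//.
  rewrite ler_norml.
  have := sqr_ge0 (y n + z n); have := sqr_ge0 (y n - z n).
  have := sqr_ge0 (y n); have := sqr_ge0 (z n).
  by move=> *; apply/andP; split; nra.
- apply: (avg_mul_cvg (t := fun k => z k ^+ 2 / 2 ^+ k.+1) h2 _ a2 a2) => n.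
  by rewrite ger0_norm.
Qed.

End weighted_averages.

Section trajectory_quadratic_law.
Context {R : realType}.
Variables (x : nat -> R) (th : 'M[R]_2) (al be : 'I_2 -> nat -> R).
Hypothesis x_rec : forall k j, (0 < k)%N ->
  chi x k j 0 = th 0 j * x k + th 1 j + (al j k * x k + be j k).
Variables CA CB CD : R.
Hypothesis hA : gramA x n @[n --> \oo] --> CA.
Hypothesis hB : gramB x n @[n --> \oo] --> CB.
Hypothesis hD : gramD x n @[n --> \oo] --> CD.
Hypothesis det_gt0 : 0 < CA * CD - CB ^+ 2.

Let m0 := score0 x al be.
Let m1 := score1 x al be.
Let err n := theta_hat x n - th.
Let det := CA * CD - CB ^+ 2.

Lemma gram_det_cvg : gram_det x n @[n --> \oo] --> det.
Proof.
apply: seq_cvgB; first exact: seq_cvgM.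
by rewrite expr2; have := seq_cvgM hB hB; apply: cvg_eq => n; rewrite -expr2.
Qed.

(** The numerator is the size of [tree n.-1] over [2 ^+ n]; the denominator comes from the two
    inverse matrices in the quadratic form. *)
Let p n : R := (1 - 2 ^- n) / gram_det x n ^+ 2.

Lemma form_coef_cvg (c : nat -> R) (l : R) :
  c n @[n --> \oo] --> l -> p n.+1 * c n.+1 @[n --> \oo] --> l / det ^+ 2.
Proof.
move=> cl; have h : p n @[n --> \oo] --> det ^- 2.
  rewrite -[X in _ --> X]mul1r; apply: seq_cvgM.
    rewrite -[X in _ --> X]subr0; apply: seq_cvgB; first exact: cvg_cst.
    have := @cvg_expr0 R 2^-1; rewrite invr_ge0 ler0n invf_lt1 ?ltr1n// => /(_ isT isT).
    by apply: cvg_eq => n; rewrite exprVn.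
  have d2 : gram_det x n ^+ 2 @[n --> \oo] --> det ^+ 2.
    by have := seq_cvgM gram_det_cvg gram_det_cvg; apply: cvg_eq => n; rewrite -expr2.
  by apply: cvgV d2; rewrite expf_neq0// gt_eqF.
by rewrite mulrC; apply: seq_cvgM; apply: cvg_succ.
Qed.

Variables l0 l1 l2 : 'I_2 -> R.
Hypothesis avgs : forall j, [/\
  n%:R^-1 * (\sum_(0 <= k < n) m0 j k.+1 ^+ 2 / 2 ^+ k.+1) @[n --> \oo] --> l0 j,
  n%:R^-1 * (\sum_(0 <= k < n) m1 j k.+1 ^+ 2 / 2 ^+ k.+1) @[n --> \oo] --> l2 j &
  n%:R^-1 * (\sum_(0 <= k < n) (m0 j k.+1 + m1 j k.+1) ^+ 2 / 2 ^+ k.+1)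
    @[n --> \oo] --> l0 j + 2 * l1 j + l2 j].

Lemma quadratic_law :
  let e n := vec (theta_hat x n) - vec th in
  n%:R^-1 * (\sum_(1 <= k < n.+1) (size (tree k.-1))%:R *
    ((e k)^T *m (1%:M *t mx22 CA CB CB CD : 'M[R]_(2 * 2)) *m e k) 0 0)
  @[n --> \oo] --> \sum_j (CD * l0 j - CB * (l1 j + l1 j) + CA * l2 j) / det.
Proof.
move=> e.
(* [w0], [w1], [w2] are the coefficients, in the two scores, of the form [adj(G) C adj(G)] with [G]
   the normalised Gram matrix. As [G] tends to [C], this form tends to [det * adj(C)]. *)
pose w0 n := CA * gramD x n ^+ 2 - 2 * CB * gramD x n * gramB x n + CD * gramB x n ^+ 2.
pose w1 n := 2 * (CB * (gramA x n * gramD x n + gramB x n ^+ 2)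
  - CA * gramD x n * gramB x n - CD * gramA x n * gramB x n).
pose w2 n := CA * gramB x n ^+ 2 - 2 * CB * gramA x n * gramB x n + CD * gramA x n ^+ 2.
have hw0 : w0 n @[n --> \oo] --> CD * det.
  have -> : CD * det = CA * (CD * CD) - 2 * CB * (CD * CB) + CD * (CB * CB).
    by rewrite /det; ring.
  have := seq_cvgD (seq_cvgB (seq_cvgZ (k := CA) (seq_cvgM hD hD))
    (seq_cvgZ (k := 2 * CB) (seq_cvgM hD hB))) (seq_cvgZ (k := CD) (seq_cvgM hB hB)).
  by apply: cvg_eq => n; rewrite /w0; ring.
have hw1 : w1 n @[n --> \oo] --> - 2 * CB * det.
  have -> : - 2 * CB * det = 2 * CB * (CA * CD + CB * CB) - 2 * CA * (CD * CB) - 2 * CD * (CA * CB).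
    by rewrite /det; ring.
  have := seq_cvgB (seq_cvgB (seq_cvgZ (k := 2 * CB) (seq_cvgD (seq_cvgM hA hD) (seq_cvgM hB hB)))
    (seq_cvgZ (k := 2 * CA) (seq_cvgM hD hB))) (seq_cvgZ (k := 2 * CD) (seq_cvgM hA hB)).
  by apply: cvg_eq => n; rewrite /w1; ring.
have hw2 : w2 n @[n --> \oo] --> CA * det.
  have -> : CA * det = CA * (CB * CB) - 2 * CB * (CA * CB) + CD * (CA * CA).
    by rewrite /det; ring.
  have := seq_cvgD (seq_cvgB (seq_cvgZ (k := CA) (seq_cvgM hB hB))
    (seq_cvgZ (k := 2 * CB) (seq_cvgM hA hB))) (seq_cvgZ (k := CD) (seq_cvgM hA hA)).
  by apply: cvg_eq => n; rewrite /w2; ring.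
pose T j k := p k.+1 * w0 k.+1 * (m0 j k.+1 ^+ 2 / 2 ^+ k.+1) +
     p k.+1 * w1 k.+1 * (m0 j k.+1 * m1 j k.+1 / 2 ^+ k.+1) +
     p k.+1 * w2 k.+1 * (m1 j k.+1 ^+ 2 / 2 ^+ k.+1).
have hT j : n%:R^-1 * (\sum_(0 <= k < n) T j k) @[n --> \oo] -->
    (CD * l0 j - CB * (l1 j + l1 j) + CA * l2 j) / det.
  have -> : (CD * l0 j - CB * (l1 j + l1 j) + CA * l2 j) / det =
      CD * det / det ^+ 2 * l0 j + - 2 * CB * det / det ^+ 2 * l1 j + CA * det / det ^+ 2 * l2 j.
    by field; rewrite gt_eqF.
  have [a0 a2 a1] := avgs j.
  by apply: avg_quadratic_form => //; exact: form_coef_cvg.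
have hS : n%:R^-1 * (\sum_(0 <= k < n) \sum_j T j k) @[n --> \oo] -->
    \sum_j (CD * l0 j - CB * (l1 j + l1 j) + CA * l2 j) / det.
  rewrite sum_ord2; have := seq_cvgD (hT 0) (hT 1); apply: cvg_eq => n.
  by rewrite -mulrDr -big_split/=; congr (_ * _); apply: eq_bigr => k _; rewrite sum_ord2.
apply: cvg_eq => [n|]; first by rewrite big_add1.
(* The error formula holds once the determinant is nonzero, thus for all large [n], and averages
   forget finitely many terms. *)
apply: avg_near_eq hS.
have dpos : \forall n \near \oo, 0 < gram_det x n.+1.
  have := cvg_succ gram_det_cvg; move/cvgrPdist_lt => /(_ _ det_gt0); apply: filterS => n.
  by rewrite ltr_distlC => /andP[+ _]; rewrite subrr.
apply: filterS dpos => n dn; have e2 : 0 < (2 ^+ n.+1 : R) by exact: exprn_gt0.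
have -> : size (tree n.+1.-1) = (2 ^ n.+1 - 1)%N by rewrite size_iota.
rewrite /e vecB vec_form natrB ?expn_gt0// natrX mulr_sumr; apply: eq_bigr => j _.
rewrite /err (theta_hat_error x_rec) ?gt_eqF// -/m0 -/m1 !mx22E !mxE /=.
rewrite /T /p /w0 /w1 /w2; set g := gram_det x n.+1 in dn *.
by field; rewrite !gt_eqF.
Qed.

End trajectory_quadratic_law.

(** * The noise of the model *)

Lemma half_gt0 i : (1 < i)%N -> (i./2.-1.+1 = i./2)%N.
Proof. by move=> i1; rewrite prednK//; lia. Qed.

Lemma half_pred_double k (b : bool) : ((k.+1.*2 + b)./2.-1 = k)%N.
Proof. by case: b; lia. Qed.

Lemma double_half i : (i./2.*2 + odd i = i)%N.
Proof. by rewrite addnC odd_double_half. Qed.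

Section interleaving.
Context {disp : measure_display} {Omega : measurableType disp} {R : realType}.
Variable P : probability Omega R.
Context {disp' : measure_display} {E : measurableType disp'}.
Variables U V : nat -> Omega -> E.

(** Merging the coefficient pairs and the innovation pairs into one independent sequence lets a
    single family of sigma-algebras describe all the noise. *)
Definition interleave (i : nat) (w : Omega) : E := if odd i then V i./2 w else U i./2 w.

Lemma interleave_even k w : interleave k.*2 w = U k w.
Proof. by rewrite /interleave odd_double doubleK. Qed.

Lemma interleave_odd k w : interleave k.*2.+1 w = V k w.
Proof. by rewrite /interleave /= odd_double uphalf_double. Qed.

Lemma sigma_family_bigcap (Y : nat -> Omega -> E) (D : set nat) (s : seq nat) (h : nat -> nat)
    (B : nat -> set E) : (forall k, k \in s -> D (h k)) -> (forall k, measurable (B k)) ->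
  sigma_family D Y (\bigcap_(k in [set` s]) Y (h k) @^-1` B k).
Proof.
move=> sD mB; pose T := g_sigma_algebraType
  (\bigcup_(i in D) preimage_set_system setT (Y i) measurable).
rewrite -[X in X _]/(@measurable _ T); apply: bigcap_measurableType => k ks.
apply: sub_sigma_algebra; exists (h k); first exact: sD.
by exists (B k) => //; rewrite setTI.
Qed.

Hypothesis indU : mutually_independent P (fun i => U i.+1).
Hypothesis indV : mutually_independent P (fun i => V i.+1).
Hypothesis indUV : indep_systems P (sigma_family [set i | (0 < i)%N] U)
  (sigma_family [set i | (0 < i)%N] V).

Lemma interleave_indep (J : seq nat) (B : nat -> set E) : uniq J ->
  (forall i, i \in J -> noise_index i) -> (forall i, measurable (B i)) ->
  P (\bigcap_(i in [set` J]) interleave i @^-1` B i) =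
  (\prod_(i <- J) P (interleave i @^-1` B i))%E.
Proof.
move=> uJ Jn mB.
(* The nodes whose index of parity [b] lies in [J], shifted down by one because independence is
   assumed for [U i.+1] and [V i.+1]. *)
pose s (b : bool) := [seq i./2.-1 | i <- J & odd i == b].
have su b : uniq (s b).
  rewrite map_inj_in_uniq ?filter_uniq// => i j.
  rewrite !mem_filter => /andP[/eqP oi /Jn i1] /andP[/eqP oj /Jn j1].
  move=> e; rewrite -(double_half i) -(double_half j) oi oj.
  by rewrite -(half_gt0 i1) -(half_gt0 j1) e.
have sE b k : (k \in s b) = (k.+1.*2 + b \in J)%N.
  apply/mapP/idP => [[i]|kJ].
    rewrite mem_filter => /andP[/eqP <- iJ] ->.
    by rewrite (half_gt0 (Jn i iJ)) double_half.
  exists (k.+1.*2 + b)%N; last by rewrite half_pred_double.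
  by rewrite mem_filter kJ andbT oddD odd_double oddb eqxx.
have -> : \bigcap_(i in [set` J]) interleave i @^-1` B i =
    (\bigcap_(k in [set` s false]) U k.+1 @^-1` B k.+1.*2) `&`
    (\bigcap_(k in [set` s true]) V k.+1 @^-1` B k.+1.*2.+1).
  apply/seteqP; split => [w h|w [h0 h1] i /= iJ].
    split => k /=; rewrite sE ?addn0 ?addn1 => /h /=.
      by rewrite interleave_even.
    by rewrite (interleave_odd k.+1).
  have i2 := half_gt0 (Jn i iJ); have ei := double_half i.
  move: (iJ); rewrite -{1}ei -i2 -sE; rewrite /interleave; case: (odd i) ei => ei /=.
    by move=> /h1 /=; rewrite i2 -{3}ei addn1.
  by move=> /h0 /=; rewrite i2 -{3}ei addn0.
rewrite indUV; last 2 first.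
- by apply: (@sigma_family_bigcap U _ (s false) S (fun k => B k.+1.*2)).
- by apply: (@sigma_family_bigcap V _ (s true) S (fun k => B k.+1.*2.+1)).
rewrite (indU (B := fun k => B k.+1.*2))// (indV (B := fun k => B k.+1.*2.+1))//.
rewrite [RHS](bigID odd)/= muleC; congr (_ * _)%E.
  rewrite big_map big_filter; rewrite big_seq_cond [RHS]big_seq_cond.
  apply: eq_big => [i|i /andP[/Jn /half_gt0 i2 /eqP oi]]; first by rewrite eqb_id.
  have -> : interleave i = V i./2 by apply/funext => w; rewrite /interleave oi.
  by have := double_half i; rewrite oi i2 addn1 => ->.
rewrite big_map big_filter; rewrite big_seq_cond [RHS]big_seq_cond.
apply: eq_big => [i|i /andP[/Jn /half_gt0 i2 /eqP oi]]; first by rewrite eqbF_neg.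
have -> : interleave i = U i./2 by apply/funext => w; rewrite /interleave oi.
by have := double_half i; rewrite oi i2 addn0 => ->.
Qed.

End interleaving.

(** * From constant conditional moments to plain moments *)

Section conditional_moments.
Context {disp : measure_display} {Omega : measurableType disp} {R : realType}.
Variables (P : probability Omega R) (G : set (set Omega)).
Implicit Types X M : Omega -> R.

Lemma cexp_Ex X M : is_cexp P G X M -> [/\ itg P X, itg P M & Ex P X = Ex P M].
Proof.
move=> [IX IM GM h]; split => //; rewrite /Ex -h//.
by have := GM setT measurableT; rewrite preimage_setT.
Qed.

Lemma cexp_cst X (m : R) : is_cexp P G X (cst m) -> itg P X /\ Ex P X = m.
Proof. by move=> /cexp_Ex[IX _ ->]; rewrite Ex_cst. Qed.

(** [is_cvar] brings its own version [M] of the conditional mean, which must be identified with the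
    constant [m]. The event where [M] is at least [m] and its complement both lie in [G], so the
    integral of the modulus of [M - m] vanishes. *)
Lemma cexp_unique_cst X M (m : R) : is_cexp P G X M -> is_cexp P G X (cst m) ->
  {ae P, forall w, M w = m}.
Proof.
move=> [IX IM GM hM] [_ Im _ hm].
have If : itg P (fun w => M w - m) by exact: itgB.
pose A := M @^-1` `[m, +oo[%classic.
have mM := itg_mf IM.
have mA : measurable A by rewrite -[A]setTI; apply: mM.
have GA : G A by apply: GM.
have GAc : G (~` A) by rewrite /A preimage_setC; apply: GM; exact: measurableC.
have zero B : G B -> measurable B -> \int[P]_(w in B) (M w - m) = 0.
  move=> GB mB; have sub := integrableS measurableT mB (@subsetT _ B).
  rewrite RintegralB//; last 2 first; [exact: (sub _ _ _ IM)|exact: (sub _ _ _ Im)|].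
  by rewrite /Rintegral hM// -hm// subrr.
have abs0 : Ex P (fun w => `|M w - m|) = 0.
  have Ia := itg_abs If.
  rewrite -[Ex _ _]/(\int[P]_(w in setT) `|M w - m|) -(setUv A).
  rewrite Rintegral_setU ?setUv//; [|exact: measurableC|by apply/disj_setPCl].
  rewrite [X in X + _](_ : _ = \int[P]_(w in A) (M w - m)); last first.
    apply: eq_Rintegral => w; rewrite inE /A /= in_itv/= andbT => h.
    by rewrite ger0_norm// subr_ge0.
  rewrite [X in _ + X](_ : _ = - \int[P]_(w in ~` A) (M w - m)); last first.
    rewrite -[RHS]mulN1r -RintegralZl; [|exact: measurableC|].
      apply: eq_Rintegral => w; rewrite inE /A /= in_itv/= andbT => /negP; rewrite -ltNge => h.
      by rewrite ltr0_norm ?subr_lt0// mulN1r.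
    by apply: integrableS If => //; exact: measurableC.
  by rewrite !zero ?oppr0 ?addr0//; exact: measurableC.
have mf : measurable_fun setT (fun w => (M w - m)%:E) by exact/measurable_EFinP/(itg_mf If).
have : (\int[P]_(w in setT) `|(M w - m)%:E| = 0)%E.
  by rewrite -[RHS]/(0%R%:E) -abs0 -ExE//; exact: itg_abs.
move/(ae_eq_integral_abs P measurableT mf); apply: filterS => w /= /(_ I) [] /eqP.
by rewrite subr_eq0 => /eqP.
Qed.

Lemma cvar_cst X (m v : R) : is_cexp P G X (cst m) -> is_cvar P G X (cst v) ->
  itg P (fun w => (X w - m) ^+ 2) /\ Ex P (fun w => (X w - m) ^+ 2) = v.
Proof.
move=> Xm [M XM /cexp_cst[I2 E2]].
have Mm := cexp_unique_cst XM Xm.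
have [IX _ _ _] := Xm.
have mX : measurable_fun setT (fun w => (X w - m) ^+ 2).
  by apply: measurable_funX; apply: measurable_funB => //; exact: itg_mf IX.
have e : ae_eq P setT (EFin \o (fun w => (X w - M w) ^+ 2)) (EFin \o (fun w => (X w - m) ^+ 2)).
  by apply: filterS Mm => w /= ->.
have mX' : measurable_fun setT (EFin \o (fun w => (X w - m) ^+ 2)) by exact/measurable_EFinP.
have m2 := measurable_int _ I2.
split; last by rewrite -E2 /Ex; congr fine; apply: ae_eq_integral => //; exact: ae_eq_sym.
apply/integrableP; split => //; have /integrableP[_] := I2.
congr (_ < _)%E; apply: ge0_ae_eq_integral => //; try exact: measurableT_comp.
by apply: filterS Mm => w /= ->.
Qed.

Lemma sqr_moment X (m v : R) : itg P X -> Ex P X = m ->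
  itg P (fun w => (X w - m) ^+ 2) -> Ex P (fun w => (X w - m) ^+ 2) = v ->
  itg P (fun w => X w ^+ 2) /\ Ex P (fun w => X w ^+ 2) = v + m ^+ 2.
Proof.
move=> IX EX I2 E2.
have e : (fun w => X w ^+ 2) = (fun w => (X w - m) ^+ 2 + (2 * m * X w - m ^+ 2)).
  by apply/funext => w; ring.
have I1 : itg P (fun w => 2 * m * X w - m ^+ 2).
  by apply: itgB; [exact: itgZ|exact: itg_cst].
rewrite e; split; first exact: itgD.
rewrite ExD// ExB; last 2 first; [exact: itgZ|exact: itg_cst|].
by rewrite ExZ// Ex_cst EX E2; ring.
Qed.

End conditional_moments.

Section model_noise.
Context {disp : measure_display} {Omega : measurableType disp} {R : realType}.
Variable P : probability Omega R.
Variables (X a_ b_ eps : nat -> {RV P >-> R}).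
Variables (a b c d sigma_a sigma_b sigma_c sigma_d rho_ab rho_cd : R).
Hypothesis hmodel : is_RCBAR X a_ b_ eps.
Hypothesis hmeans : cond_means X a_ b_ eps a b c d.
Hypothesis h1 : H1 a_ b_.
Hypothesis h2 : H2 X a_ b_ eps sigma_a sigma_b sigma_c sigma_d.
Hypothesis h4 : H4 X a_ b_ eps a b c d sigma_a sigma_b sigma_c sigma_d rho_ab rho_cd.

Definition model_noise : nat -> Omega -> R * R := interleave
  (fun k w => (a_ k w, b_ k w)) (fun k w => (eps (2 * k)%N w, eps (2 * k).+1%N w)).
Let zeta := model_noise.

(** The index [j] is the column of [theta]: 0 for the even children, 1 for the odd ones. *)
Definition coef_dev (j : 'I_2) k w : R := if j == 0 then a_ k w - a else b_ k w - b.
Definition innov_dev (j : 'I_2) k w : R :=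
  if j == 0 then eps (2 * k)%N w - c else eps (2 * k).+1%N w - d.
Definition coef_var (j : 'I_2) : R := if j == 0 then sigma_a ^+ 2 else sigma_b ^+ 2.
Definition innov_var (j : 'I_2) : R := if j == 0 then sigma_c ^+ 2 else sigma_d ^+ 2.

Lemma gen_trunc_log k : (0 < k)%N -> k \in gen (trunc_log 2 k).
Proof. by move=> k0; rewrite mem_index_iota pow_trunc_log_le//= trunc_log_ltn. Qed.

Lemma node_moments (G : set (set Omega)) (Y : Omega -> R) (m v u : R) :
  is_cexp P G Y (cst m) -> is_cvar P G Y (cst v) ->
  is_cexp P G (fun w => (Y w - m) ^+ 4) (cst u) ->
  [/\ itg P (fun w => Y w ^+ 2) /\ Ex P (fun w => Y w ^+ 2) = v + m ^+ 2,
      Ex P (fun w => Y w - m) = 0,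
      Ex P (fun w => (Y w - m) ^+ 2) = v &
      itg P (fun w => (Y w - m) ^+ 4) /\ Ex P (fun w => (Y w - m) ^+ 4) = u].
Proof.
move=> hm hv hu; have [IY EY] := cexp_cst hm; have [I2 E2] := cvar_cst hm hv.
split => //; last exact: cexp_cst hu; first exact: sqr_moment.
by rewrite ExB ?Ex_cst ?EY ?subrr//; exact: itg_cst.
Qed.

Lemma model_moments : exists M : R, forall k, (0 < k)%N ->
  [/\ [/\ itg P (fun w => a_ k w ^+ 2) /\ Ex P (fun w => a_ k w ^+ 2) = sigma_a ^+ 2 + a ^+ 2,
      itg P (fun w => b_ k w ^+ 2) /\ Ex P (fun w => b_ k w ^+ 2) = sigma_b ^+ 2 + b ^+ 2,
      itg P (fun w => eps (2 * k)%N w ^+ 2) /\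
        Ex P (fun w => eps (2 * k)%N w ^+ 2) = sigma_c ^+ 2 + c ^+ 2 &
      itg P (fun w => eps (2 * k).+1%N w ^+ 2) /\
        Ex P (fun w => eps (2 * k).+1%N w ^+ 2) = sigma_d ^+ 2 + d ^+ 2] &
   forall j, [/\ Ex P (coef_dev j k) = 0 /\ Ex P (innov_dev j k) = 0,
     Ex P (fun w => coef_dev j k w ^+ 2) = coef_var j,
     Ex P (fun w => innov_dev j k w ^+ 2) = innov_var j,
     itg P (fun w => coef_dev j k w ^+ 4) /\ Ex P (fun w => coef_dev j k w ^+ 4) <= M &
     itg P (fun w => innov_dev j k w ^+ 4) /\ Ex P (fun w => innov_dev j k w ^+ 4) <= M]].
Proof.
have [[mu_a [mu_b [mu_c [mu_d [_ _ _ _ hmu]]]]] _ _] := h4.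
have e4 (u : R) : 0 <= u ^+ 4 by rewrite (exprM u 2 2) sqr_ge0.
exists (mu_a ^+ 4 + mu_b ^+ 4 + mu_c ^+ 4 + mu_d ^+ 4) => k k0.
have kg := gen_trunc_log k0.
have [ca cb cc cd] := hmeans kg; have [_ _ _ _ /(_ _ _ kg) [va vb vc vd]] := h2.
have [ua ub uc ud] := hmu _ _ kg.
have [ma1 ma2 ma3 [ma4 ma5]] := node_moments ca va ua.
have [mb1 mb2 mb3 [mb4 mb5]] := node_moments cb vb ub.
have [mc1 mc2 mc3 [mc4 mc5]] := node_moments cc vc uc.
have [md1 md2 md3 [md4 md5]] := node_moments cd vd ud.
have := (e4 mu_a, e4 mu_b, e4 mu_c, e4 mu_d) => -[[[pa pb] pc] pd].
split => //; elim/ord2_ind; rewrite /coef_dev /innov_dev /coef_var /innov_var /=.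
  by split => //; split=> //; rewrite ?ma5 ?mc5; lra.
by split => //; split=> //; rewrite ?mb5 ?md5; lra.
Qed.

Lemma coef_model k : coef zeta k = if odd k then b_ k./2 : Omega -> R else a_ k./2.
Proof. by apply/funext => w; rewrite /coef /zeta /model_noise !interleave_even; case: (odd k). Qed.

Lemma innov_model k : innov zeta k =
  if odd k then eps (2 * k./2).+1%N : Omega -> R else eps (2 * k./2)%N.
Proof. by apply/funext => w; rewrite /innov /zeta /model_noise !interleave_odd; case: (odd k). Qed.

Lemma model_tree_noise : exists r V, tree_noise P zeta r V.
Proof.
have [_ _ [indab _] [indeps _] indabeps] := hmodel.
have [M hM] := model_moments.
(* These are the second moments of the coefficients, the same at every node, so [H1] at one node
   yields [r < 1] uniformly. *)
pose r := Num.max (sigma_a ^+ 2 + a ^+ 2) (sigma_b ^+ 2 + b ^+ 2).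
pose V := (sigma_c ^+ 2 + c ^+ 2) + (sigma_d ^+ 2 + d ^+ 2).
have sc := addr_ge0 (sqr_ge0 sigma_c) (sqr_ge0 c).
have sd := addr_ge0 (sqr_ge0 sigma_d) (sqr_ge0 d).
have half2 k : (1 < k)%N -> (0 < k./2)%N by move=> /half_gt0 <-.
exists r, V; split.
- move=> i; rewrite /zeta /model_noise /interleave; case: (odd i); exact: measurable_fun_pair.
- by move=> J B uJ Jn mB; exact: interleave_indep.
- by rewrite le_max addr_ge0 ?sqr_ge0.
- have [ha hb] := h1 (ltnSn 0); have [[[Ia Ea] [Ib Eb] _ _] _] := hM 1%N (ltnSn 0).
  move: ha hb; rewrite unlock (ExE Ia) (ExE Ib) Ea Eb !lte_fin => ha hb.
  by rewrite gt_max ha hb.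
- exact: addr_ge0.
- move=> k /half2 k0; have [[[Ia Ea] [Ib Eb] _ _] _] := hM _ k0.
  by rewrite coef_model; case: (odd k); rewrite ?Ea ?Eb le_max lexx ?orbT.
- move=> k /half2 k0; have [[_ _ [Ic Ec] [Id Ed]] _] := hM _ k0.
  by rewrite innov_model; case: (odd k); rewrite ?Ec ?Ed ?lerDl ?lerDr.
Qed.

Lemma model_centered_pair : exists M, forall j,
  centered_pair P zeta (coef_dev j) (innov_dev j) (coef_var j) (innov_var j) M.
Proof.
have [M hM] := model_moments; exists M => j; split => k k0; have [_ /(_ j)] := hM k k0; last first.
- by case.
- by case.
- by case=> -[].
- by case=> -[].
- by case.
- by case.
- move=> _; have mh : measurable_fun setT (fun p : R * R => if j == 0 then p.1 - c else p.2 - d).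
    by case: (j == 0); exact: measurable_funB.
  have := @mJ_coord _ Omega R _ _ zeta [set k.*2.+1] k.*2.+1 _ erefl mh.
  rewrite /innov_dev; congr mJ; apply/funext => w.
  by rewrite /zeta /model_noise interleave_odd.
- move=> _; have mh : measurable_fun setT (fun p : R * R => if j == 0 then p.1 - a else p.2 - b).
    by case: (j == 0); exact: measurable_funB.
  have := @mJ_coord _ Omega R _ _ zeta [set k.*2] k.*2 _ erefl mh.
  rewrite /coef_dev; congr mJ; apply/funext => w.
  by rewrite /zeta /model_noise interleave_even.
Qed.

Lemma model_rec k w : (1 < k)%N -> X k w = coef zeta k w * X k./2 w + innov zeta k w.
Proof.
have [hX _ _ _ _] := hmodel => /half_gt0 k2.
have [e0 e1] : X (2 * k./2)%N w = a_ k./2 w * X k./2 w + eps (2 * k./2)%N w /\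
    X (2 * k./2).+1%N w = b_ k./2 w * X k./2 w + eps (2 * k./2).+1%N w.
  by apply: hX; rewrite -k2.
rewrite coef_model innov_model -{1}(double_half k); case: (odd k).
  by rewrite addn1 -mul2n e1.
by rewrite addn0 -mul2n e0.
Qed.

Lemma model_chi w k j : (0 < k)%N ->
  chi (fun k => X k w) k j 0 = theta a b c d 0 j * X k w + theta a b c d 1 j +
    (coef_dev j k w * X k w + innov_dev j k w).
Proof.
have [hX _ _ _ _] := hmodel => k0; have [e0 e1] := hX k w k0.
rewrite /theta !mxE /=; elim/ord2_ind: j; rewrite /coef_dev /innov_dev /=.
  by rewrite e0; ring.
by rewrite e1; ring.
Qed.

Lemma coef_even j w : (0 < j)%N -> coef zeta j.*2 w = coef_dev 0 j w + a.
Proof. by move=> _; rewrite coef_model odd_double doubleK /coef_dev /= subrK. Qed.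

Lemma innov_even j w : (0 < j)%N -> innov zeta j.*2 w = innov_dev 0 j w + c.
Proof. by move=> _; rewrite innov_model odd_double doubleK /innov_dev /= subrK. Qed.

Lemma innov_var_gt0 : 0 < innov_var 0.
Proof. by have [] := h2. Qed.

End model_noise.

(** * Gram matrices along almost every trajectory *)

Section empirical_gram.
Context {disp : measure_display} {Omega : measurableType disp} {R : realType}.
Variables (P : probability Omega R) (zeta : nat -> Omega -> R * R) (r V : R).
Hypothesis H : tree_noise P zeta r V.
Variable X : nat -> Omega -> R.
Hypothesis X_rec : forall k w, (1 < k)%N ->
  X k w = coef zeta k w * X k./2 w + innov zeta k w.
Variables (al be : nat -> Omega -> R) (sa sb M a c : R).
Hypothesis Hab : centered_pair P zeta al be sa sb M.
Hypothesis Hal : forall j w, (0 < j)%N -> coef zeta j.*2 w = al j w + a.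
Hypothesis Hbe : forall j w, (0 < j)%N -> innov zeta j.*2 w = be j w + c.
Hypothesis sb_gt0 : 0 < sb.

Lemma isBL_1pw : isBL (fun y : R => 1 - pw y).
Proof. by apply: isBLB; [exact: isBL_cst|exact: isBL_pw]. Qed.

(** Deterministic equivalents of the Gram entries; they replace limits as long as [T] is not
    given. *)
Definition mean_gramA n := tmean n (fun k => Ex P (fun w => 1 - pw (Xt zeta k w))).
Definition mean_gramB n := tmean n (mean_qw P zeta).
Definition mean_gramD n := tmean n (mean_pw P zeta).

Lemma mean_gramAE n : mean_gramA n = tmean n (fun k => 1 - mean_pw P zeta k).
Proof.
rewrite /mean_gramA /tmean; congr (_ * _); apply: eq_big_nat => k /andP[k0 _].
by rewrite (ExB (itg_cst P 1) (itg_BL H isBL_pw k0)) Ex_cst.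
Qed.

Lemma mean_gram_le1 n : [/\ `|mean_gramA n| <= 1, `|mean_gramB n| <= 1 & `|mean_gramD n| <= 1].
Proof.
have b (phi : R -> R) k : isBL phi -> (forall y, `|phi y| <= 1) -> (0 < k)%N ->
    `|Ex P (fun w => phi (Xt zeta k w))| <= 1.
  move=> BL p1 k0; have I := itg_BL H BL k0.
  rewrite (le_trans (Ex_norm I))// -[leRHS](Ex_cst P 1); apply: Ex_le => //.
  - exact: itg_abs.
  - exact: itg_cst.
have p0 y : 0 < pw y <= 1 := @pw_bounds R y.
split; apply: norm_tmean_le1 => k k0.
- by apply: (b (fun y => 1 - pw y)) => //; [exact: isBL_1pw|move=> y; have := p0 y => /andP[*]; rewrite ger0_norm; lra].
- apply: b => //; first exact: isBL_qw.
  by move=> y; have := p0 y => /andP[*]; rewrite -(@expr_le1 _ 2%N)// real_normK ?num_real// qw_sqr; nra.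
- by apply: b => //; [exact: isBL_pw|move=> y; have := p0 y => /andP[*]; rewrite ger0_norm; lra].
Qed.

Lemma gram_sub_cvg0 : {ae P, forall w,
  [/\ gramA (fun k => X k w) n - mean_gramA n @[n --> \oo] --> 0,
      gramB (fun k => X k w) n - mean_gramB n @[n --> \oo] --> 0 &
      gramD (fun k => X k w) n - mean_gramD n @[n --> \oo] --> 0]}.
Proof.
have h1 := tmean_lln H X_rec isBL_1pw.
have h2 := tmean_lln H X_rec isBL_qw.
have h3 := tmean_lln H X_rec isBL_pw.
by apply: filterS3 h1 h2 h3.
Qed.

Lemma mean_gram_det_ge : exists2 delta : R, 0 < delta & \forall n \near \oo,
  delta <= mean_gramA n * mean_gramD n - mean_gramB n ^+ 2.
Proof.
have [delta d0 hd] := gram_det_ge H Hab Hal Hbe sb_gt0.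
by exists delta => //; exists 2%N => // n /= n2; rewrite mean_gramAE; exact: hd.
Qed.

Lemma det_lipschitz (u v z u' v' z' : R) : `|z| <= 1 -> `|u'| <= 1 -> `|v| <= 1 -> `|v'| <= 1 ->
  `|(u * z - v ^+ 2) - (u' * z' - v' ^+ 2)| <= `|u - u'| + `|z - z'| + 2 * `|v - v'|.
Proof.
move=> z1 u1 v1 v1'.
have -> : u * z - v ^+ 2 - (u' * z' - v' ^+ 2) =
  (u - u') * z + u' * (z - z') - (v - v') * (v + v') by ring.
apply: (le_trans (ler_normB _ _)); apply: lerD.
  apply: (le_trans (ler_normD _ _)); rewrite !normrM.
  by apply: lerD; [exact: ler_piMr|exact: ler_piMl].
rewrite normrM mulrC ler_wpM2r// (le_trans (ler_normD _ _))//; lra.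
Qed.

Lemma gram_det_ge_near : exists2 delta : R, 0 < delta & {ae P, forall w,
  \forall n \near \oo, delta <= gram_det (fun k => X k w) n}.
Proof.
have [delta d0 hd] := mean_gram_det_ge; exists (delta / 2); first lra.
have d4 : 0 < delta / 2 by lra.
apply: filterS gram_sub_cvg0 => w [hA hB hD].
have hs := seq_cvgD (seq_cvgD (cvgr0_norm hA) (cvgr0_norm hD)) (seq_cvgZ (k := 2) (cvgr0_norm hB)).
rewrite mulr0 !addr0 in hs; have /cvgr0Pnorm_lt/(_ _ d4) := hs.
apply: filterS2 hd => n hn {}hs.
have [_ B1 D1] := gram_le1 (fun k => X k w) n; have [A1' B1' _] := mean_gram_le1 n.
have := det_lipschitz (gramA (fun k => X k w) n) (mean_gramD n) D1 A1' B1 B1'.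
move: hs; rewrite ger0_norm; last by rewrite !addr_ge0// mulr_ge0.
rewrite -/(gram_det _ _) ler_norml => hs /andP[h _]; lra.
Qed.

End empirical_gram.

Section limit_constants.
Context {disp : measure_display} {Omega : measurableType disp} {R : realType}.
Variables (P : probability Omega R) (zeta : nat -> Omega -> R * R) (r V : R).
Hypothesis H : tree_noise P zeta r V.
Variables (X : nat -> {RV P >-> R}) (kappa : nat -> {RV P >-> bool}).
Hypothesis X_rec : forall k w, (1 < k)%N ->
  X k w = coef zeta k w * X k./2 w + innov zeta k w.
Hypothesis coin : is_coin_sequence X kappa.
Context {disp' : measure_display} {Omega' : measurableType disp'}.
Variables (Q : probability Omega' R) (T : {RV Q >-> R}).
Hypothesis TY : cvg_in_distribution P Q (Y_ X kappa) T.

Lemma itg_BL_T (phi : R -> R) : isBL phi -> itg Q (fun w => phi (T w)).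
Proof.
move=> [K BL]; have [_ phiK _] := BL.
apply: (@itg_bounded _ _ _ _ _ K) => [|w]; last exact: phiK.
apply: measurableT_comp; first exact: bounded_lipschitz_measurable BL.
exact: measurable_funPT.
Qed.

Definition limA := Ex Q (fun w => 1 - pw (T w)).
Definition limB := Ex Q (fun w => qw (T w)).
Definition limD := Ex Q (fun w => pw (T w)).

Lemma limA_limD : limA + limD = 1.
Proof.
by rewrite /limA (ExB (itg_cst Q 1) (itg_BL_T isBL_pw)) Ex_cst subrK.
Qed.

Lemma mean_gram_cvg : [/\ mean_gramA P zeta n @[n --> \oo] --> limA,
  mean_gramB P zeta n @[n --> \oo] --> limB & mean_gramD P zeta n @[n --> \oo] --> limD].
Proof.
split; apply: tmean_cvg.
- exact: (mean_cvg_T H X_rec coin TY isBL_1pw).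
- exact: (mean_cvg_T H X_rec coin TY isBL_qw).
- exact: (mean_cvg_T H X_rec coin TY isBL_pw).
Qed.

Lemma gram_cvg : {ae P, forall w,
  [/\ gramA (fun k => X k w) n @[n --> \oo] --> limA,
      gramB (fun k => X k w) n @[n --> \oo] --> limB &
      gramD (fun k => X k w) n @[n --> \oo] --> limD]}.
Proof.
have [mA mB mD] := mean_gram_cvg.
apply: filterS (gram_sub_cvg0 H X_rec) => w [hA hB hD].
have add (u v : nat -> R) (l : R) : u n - v n @[n --> \oo] --> 0 -> v n @[n --> \oo] --> l ->
    u n @[n --> \oo] --> l.
  by move=> h1 h2; have := seq_cvgD h1 h2; rewrite add0r; apply: cvg_eq => n; rewrite subrK.
by split; [exact: add hA mA|exact: add hB mB|exact: add hD mD].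
Qed.

Section lower_bound.
Variables (al be : nat -> Omega -> R) (sa sb M a c : R).
Hypothesis Hab : centered_pair P zeta al be sa sb M.
Hypothesis Hal : forall j w, (0 < j)%N -> coef zeta j.*2 w = al j w + a.
Hypothesis Hbe : forall j w, (0 < j)%N -> innov zeta j.*2 w = be j w + c.

Lemma lim_det_gt0 : 0 < sb -> 0 < limA * limD - limB ^+ 2.
Proof.
move=> sb0; have [delta d0 hd] := mean_gram_det_ge H Hab Hal Hbe sb0.
have [mA mB mD] := mean_gram_cvg.
apply: (lt_le_trans d0); have := seq_cvgB (seq_cvgM mA mD) (seq_cvgM mB mB).
rewrite expr2; move/cvgr_to_ge; apply; apply: filterS hd => n.
by rewrite expr2.
Qed.

End lower_bound.

Variables (al be : nat -> Omega -> R) (sa sb M : R).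
Hypothesis Hab : centered_pair P zeta al be sa sb M.

Definition lim_score (g f : R -> R) :=
  Ex Q (fun w => sa * g (T w) ^+ 2 + sb * f (T w) ^+ 2).
Definition lim_cross (g f g' f' : R -> R) :=
  Ex Q (fun w => sa * (g (T w) * g' (T w)) + sb * (f (T w) * f' (T w))).

Lemma score_limit (g f : R -> R) : isBL g -> isBL f -> {ae P, forall w,
  n%:R^-1 * (\sum_(0 <= k < n) score X al be g f k.+1 w ^+ 2 / 2 ^+ k.+1)
    @[n --> \oo] --> lim_score g f}.
Proof.
move=> Bg Bf; apply: (score_sqr_avg H X_rec Hab Bg Bf).
have B : isBL (fun y => sa * g y ^+ 2 + sb * f y ^+ 2).
  by apply: isBLD; apply: isBLZ; exact: isBLX.
by apply: (gen_avg_Xt_lln H B); exact: (mean_cvg_T H X_rec coin TY B).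
Qed.

Lemma lim_scoreD (g f g' f' : R -> R) : isBL g -> isBL f -> isBL g' -> isBL f' ->
  lim_score (fun y => g y + g' y) (fun y => f y + f' y) =
  lim_score g f + 2 * lim_cross g f g' f' + lim_score g' f'.
Proof.
move=> Bg Bf Bg' Bf'.
have B1 : isBL (fun y => sa * g y ^+ 2 + sb * f y ^+ 2).
  by apply: isBLD; apply: isBLZ; exact: isBLX.
have B2 : isBL (fun y => sa * (g y * g' y) + sb * (f y * f' y)).
  by apply: isBLD; apply: isBLZ; exact: isBLM.
have B3 : isBL (fun y => sa * g' y ^+ 2 + sb * f' y ^+ 2).
  by apply: isBLD; apply: isBLZ; exact: isBLX.
have I1 := itg_BL_T B1; have I2 := itg_BL_T B2; have I3 := itg_BL_T B3.
rewrite /lim_score /lim_cross -(ExZ 2 I2) -(ExD I1 (itgZ 2 I2)) -ExD//; last first.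
  by apply: itgD => //; exact: itgZ.
by apply: eq_Ex => w; ring.
Qed.

End limit_constants.

Section limit_matrices.
Context {disp : measure_display} {Omega : measurableType disp} {R : realType}.
Variables (Q : probability Omega R) (T : {RV Q >-> R}).
Variables (sigma_a sigma_b sigma_c sigma_d rho_ab rho_cd : R).

Lemma expectation_mxE (m n : nat) (A : Omega -> 'M[R]_(m, n)) i j :
  expectation_mx Q A i j = Ex Q (fun w => A w i j).
Proof. by rewrite /expectation_mx mxE unlock. Qed.

Lemma LambdaE : Lambda Q T = 1%:M *t mx22 (limA T) (limB T) (limB T) (limD T).
Proof.
congr (_ *t _); rewrite [LHS]eq_mx22 !expectation_mxE.
by congr mx22; apply: eq_Ex => w; rewrite mx22Z mx22E -?mul_qw -?mul_pw /pw; ring.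
Qed.

Let sa := coef_var sigma_a sigma_b.
Let sb := innov_var sigma_c sigma_d.
Let L := L_mx Q T sigma_a sigma_b sigma_c sigma_d rho_ab rho_cd.

(** The diagonal blocks, met by the trace because [Lambda] is block diagonal, carry the polynomials
    P and R. Their entries are the limits attached to the two scores of column [j]. *)
Lemma L_mxE j : [/\
  L (mxtens_index (j, 0)) (mxtens_index (j, 0)) =
    lim_score T (sa j) (sb j) (fun y => 1 - pw y) qw,
  L (mxtens_index (j, 0)) (mxtens_index (j, 1)) =
    lim_cross T (sa j) (sb j) (fun y => 1 - pw y) qw qw pw,
  L (mxtens_index (j, 1)) (mxtens_index (j, 0)) =
    lim_cross T (sa j) (sb j) (fun y => 1 - pw y) qw qw pw &
  L (mxtens_index (j, 1)) (mxtens_index (j, 1)) =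
    lim_score T (sa j) (sb j) qw pw].
Proof.
have e (y u : R) : ((1 + y ^+ 2) ^+ 2)^-1 * u = pw y ^+ 2 * u by rewrite /pw exprVn.
rewrite /L /L_mx; split; rewrite expectation_mxE; apply: eq_Ex => w;
  rewrite mxE tensmxE e -?mul_qw -?mul_pw;
  elim/ord2_ind: j; rewrite !mx22E /polyP /polyR !hornerE /sa /sb /coef_var /innov_var /=; ring.
Qed.

End limit_matrices.

(** * Assembling the rate and the quadratic strong law *)

Lemma ae_ord2 {disp : measure_display} {Omega : measurableType disp} {R : realType}
  (P : probability Omega R) (A : 'I_2 -> Omega -> Prop) :
  (forall j, {ae P, forall w, A j w}) -> {ae P, forall w, forall j, A j w}.
Proof. by move=> h; apply: filterS2 (h 0) (h 1) => w h0 h1; elim/ord2_ind. Qed.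

Theorem theorem5p4 (disp : measure_display) (Omega : measurableType disp)
    (R : realType) (P : probability Omega R)
    (X a_ b_ eps : nat -> {RV P >-> R})
    (a b c d sigma_a sigma_b sigma_c sigma_d rho_ab rho_cd : R)
    (hmodel : is_RCBAR X a_ b_ eps)
    (hmeans : cond_means X a_ b_ eps a b c d)
    (h1 : H1 a_ b_)
    (h2 : H2 X a_ b_ eps sigma_a sigma_b sigma_c sigma_d)
    (h3 : H3 X a_ b_ eps a b c d sigma_a sigma_b sigma_c sigma_d rho_ab rho_cd)
    (h4 : H4 X a_ b_ eps a b c d sigma_a sigma_b sigma_c sigma_d rho_ab rho_cd)
    (h5 : H5 X a_ b_ eps a b c d) :
  let err w n := vec (theta_hat (fun k => X k w) n) - vec (theta a b c d) in
  [/\ {ae P, forall w,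
        vec (theta_hat (fun k => X k w) n) @[n --> \oo]
          --> vec (theta a b c d)},
      {ae P, forall w,
        (fun n => enorm (err w n) ^+ 2 : R^o)
          =O_\oo (fun n => n%:R / (size (tree n.-1))%:R : R^o)} &
      forall (kappa : nat -> {RV P >-> bool})
        (disp' : measure_display) (Omega' : measurableType disp')
        (Q : probability Omega' R) (T : {RV Q >-> R}),
        is_coin_sequence X kappa ->
        cvg_in_distribution P Q (Y_ X kappa) T ->
        let Lam := Lambda Q T in
        let L := L_mx Q T sigma_a sigma_b sigma_c sigma_d rho_ab rho_cd in
        let Lam_inv_sqrt := invmx (sqrtmx Lam) in
        {ae P, forall w,
          n%:R^-1 * (\sum_(1 <= k < n.+1)
             (size (tree k.-1))%:R * ((err w k)^T *m Lam *m err w k) 0 0)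
            @[n --> \oo] --> \tr (Lam_inv_sqrt *m L *m Lam_inv_sqrt)}].
Proof.
move=> err.
have [r [V H]] := model_tree_noise hmodel hmeans h1 h2 h4.
have [M Hc] := model_centered_pair hmeans h2 h4.
set zeta := model_noise a_ b_ eps in H Hc.
have X_rec := model_rec hmodel; rewrite -/zeta in X_rec.
have sb0 := innov_var_gt0 h2.
have Hal := @coef_even _ _ _ _ a_ b_ eps a b; rewrite -/zeta in Hal.
have Hbe := @innov_even _ _ _ _ a_ b_ eps c d; rewrite -/zeta in Hbe.
have x_rec w := model_chi a b c d hmodel w.
have rates : {ae P, forall w, forall j : 'I_2,
    let al j k := coef_dev a_ b_ a b j k w in let be j k := innov_dev eps c d j k w in
    score0 (fun k => X k w) al be j n ^+ 2 / 2 ^+ n / n.+1%:R @[n --> \oo] --> 0 /\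
    score1 (fun k => X k w) al be j n ^+ 2 / 2 ^+ n / n.+1%:R @[n --> \oo] --> 0}.
  apply: ae_ord2 => j; have s0 := score_sublinear H X_rec (Hc j) isBL_1pw isBL_qw.
  have s1 := score_sublinear H X_rec (Hc j) isBL_qw isBL_pw.
  by apply: filterS2 s0 s1 => w h0 h1'; split; [exact: h0|exact: h1'].
(* The lower bound uses the randomness at the even children, hence column 0. *)
have [delta d0 gram_ge] := gram_det_ge_near H X_rec (Hc 0) Hal Hbe sb0.
split.
- by apply: filterS2 rates gram_ge => w rt gd; exact: (theta_hat_cvg (x_rec w) d0 gd rt).
- by apply: filterS2 rates gram_ge => w rt gd; exact: (error_bigO (x_rec w) d0 gd rt).
move=> kappa disp' Omega' Q T coin TY Lam L Lis.
have det0 := lim_det_gt0 H X_rec coin TY (Hc 0) Hal Hbe sb0.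
have LamE : Lam = 1%:M *t mx22 (limA T) (limB T) (limB T) (limD T) := LambdaE T.
rewrite /Lis LamE (trace_sqrtmx (limA_limD T) det0).
pose l0 j := lim_score T (coef_var sigma_a sigma_b j) (innov_var sigma_c sigma_d j)
  (fun y => 1 - pw y) qw.
pose l1 j := lim_cross T (coef_var sigma_a sigma_b j) (innov_var sigma_c sigma_d j)
  (fun y => 1 - pw y) qw qw pw.
pose l2 j := lim_score T (coef_var sigma_a sigma_b j) (innov_var sigma_c sigma_d j) qw pw.
rewrite (eq_bigr (fun j => (limD T * l0 j - limB T * (l1 j + l1 j) + limA T * l2 j) /
  (limA T * limD T - limB T ^+ 2))); last first.
  by move=> j _; have [-> -> -> ->] := L_mxE T sigma_a sigma_b sigma_c sigma_d rho_ab rho_cd j.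
have avgs : {ae P, forall w, forall j : 'I_2,
    let al j k := coef_dev a_ b_ a b j k w in let be j k := innov_dev eps c d j k w in
    let m0 := score0 (fun k => X k w) al be in let m1 := score1 (fun k => X k w) al be in
    [/\ n%:R^-1 * (\sum_(0 <= k < n) m0 j k.+1 ^+ 2 / 2 ^+ k.+1) @[n --> \oo] --> l0 j,
        n%:R^-1 * (\sum_(0 <= k < n) m1 j k.+1 ^+ 2 / 2 ^+ k.+1) @[n --> \oo] --> l2 j &
        n%:R^-1 * (\sum_(0 <= k < n) (m0 j k.+1 + m1 j k.+1) ^+ 2 / 2 ^+ k.+1)
          @[n --> \oo] --> l0 j + 2 * l1 j + l2 j]}.
  apply: ae_ord2 => j.
  have s0 := score_limit H X_rec coin TY (Hc j) isBL_1pw isBL_qw.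
  have s1 := score_limit H X_rec coin TY (Hc j) isBL_qw isBL_pw.
  (* The sum of the two scores is the score of the summed weights; its limit supplies the third
     average needed for polarization. *)
  have s2 := score_limit H X_rec coin TY (Hc j) (isBLD isBL_1pw isBL_qw) (isBLD isBL_qw isBL_pw).
  rewrite -(lim_scoreD _ _ _ isBL_1pw isBL_qw isBL_qw isBL_pw).
  apply: filterS3 s0 s1 s2 => w a0 a1 a2; split; [exact: a0|exact: a1|].
  apply: cvg_eq a2 => n; congr (_ * _); apply: eq_bigr => k _; congr (_ ^+ 2 / _).
  by rewrite /score0 /score1 /path_score -big_split; apply: eq_bigr => i _ /=; ring.
apply: filterS2 avgs (gram_cvg H X_rec coin TY) => w av [hA hB hD].
exact: (quadratic_law (x_rec w) hA hB hD det0 av).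
Qed.
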